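(* Let $(\mathcal{E},\nabla,M)\in\mathrm{Conn}_X^2(\Gamma)$ be a $\Gamma$-transverse logarithmic $\mathfrak{sl}_2$-connection on $(X,D)$ with residue data $a$, and let $(\mathcal{L},\partial,\mu)\in\mathrm{Conn}_\Sigma^1$ be its abelianisation with respect to $\Gamma$. For any simply connected open subset $U\subset\Sigma\setminus R$, the line bundle $\mathcal{L}$ has a generator $e$ over $U$ which is an eigensection for $\partial$ with eigenvalue the canonical one-form $\eta$, i.e. $$\partial e=\eta\otimes e .$$ Moreover, over any spectral region $U_i\subset\Sigma$, there is a canonical flat inclusion $\mathcal{L}\hookrightarrow\pi^*\mathcal{E}$ with respect to which this section $e$ is an eigensection for $\pi^*\nabla$ with eigenvalue $\eta$: $$\pi^*\nabla\, e=\eta\otimes e .$$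
   Context: Setting. $X$ is a compact smooth complex curve of genus $g_X$, $D\subset X$ a nonempty finite set with $|D|>2-2g_X$. Residue data is $a=(a_p)_{p\in D}\in H^0(X,\mathcal{O}_D)$; write $\pm\lambda_p$ for the square roots of $a_p$. It is generic if $\mathrm{Re}(\lambda_p)\neq 0$ and $\lambda_p\notin\frac12\mathbb{Z}$ for all $p$; we choose signs so that $\mathrm{Re}(\lambda_p)>0$. A quadratic differential on $(X,D)$ is a holomorphic section $\phi$ of $S^2\Omega^1_X(2D)$; its residue at $p$ is the coefficient $a_p$ in $\phi=(a_px^{-2}+\cdots)dx^2$. It is generic if all its zeroes are simple. Spectral curve. For $\phi$ generic with generic residues $a$, $\Sigma$ is the curve of square roots of $\phi$ in the total space of $\Omega^1_X(D)$. It is smooth, and the projection $\pi:\Sigma\to X$ is a simply ramified double cover branched exactly at the set $B$ of zeroes of $\phi$. Let $R\subset\Sigma$ be the ramification divisor, $\sigma$ the canonical involution, $C=\pi^{-1}(D)$, and $\eta$ the canonical one-form on $\Sigma$ (the pullback of the tautological one-form; $\eta^2=\pi^*\phi$, $\sigma^*\eta=-\eta$, logarithmic poles along $C$). The preimages of $p\in D$ are labelled $p_\pm$ so that $\mathrm{Res}_{p_\pm}\eta=\pm\lambda_p$; $p_-$ is called a sink, $p_+$ a source. Stokes graph. On $\Sigma\setminus(C\cup R)$ integrate the real line field $\ker(\mathrm{Im}\,\eta)$; its image under $\pi$ is the horizontal foliation of $X\setminus(D\cup B)$. A leaf is critical if one of its endpoints is in $B$, and a saddle trajectory if both are. $\phi$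 is saddle-free if there are no saddle trajectories; $a$ is very generic if it is generic and some generic saddle-free $\phi$ has residues $a$. Fix very generic $a$ and such a $\phi$. The Stokes graph $\Gamma$ has vertices $D\cup B$ and edges (Stokes rays) the critical leaves; each Stokes ray joins a polar vertex (in $D$) to a branch vertex (in $B$). Its faces (Stokes regions) are open discs bounded by four Stokes rays, with two polar vertices (possibly equal) and two branch vertices. Each Stokes region $I$ has exactly two preimages $i$, $i'=\sigma(i)$ in $\Sigma$ (spectral regions), written $I=\{i,i'\}$; each spectral region has one sink and one source among its vertices. If $I$ has polar vertices $p,p'$ and $i$ has sink $p_-$, then $i$ has source $p'_+$ and $i'$ has sink $p'_-$ and source $p_+$. Each Stokes ray $\alpha$ with polar vertex $p$ has two preimages $\alpha_\pm$ with polar vertex $p_\pm$. $U_I,U_\alpha,U_i,U_\alpha^\pm$ denote (germs of) small open neighbourhoods of the corresponding faces and edges in $X^\circ=X\setminus(D\cup B)$ and $\Sigma^\circ=\Sigma\setminus(C\cup R)$ (still called Stokes regions, etc.), and $U_p,U_p^\pm$ infinitesimal discs around $p,p_\pm$. The restrictions $\pi_i:U_i\to U_I$, $\pi_\alpha^\pm:U_\alpha^\pm\to U_\alpha$, $\pi_p^\pm:U_p^\pm\to U_p$ are isomorphisms. $\mathfrak{sl}_2$-connections. A logarithmic $\mathfrak{sl}_2$-connection on $(X,D)$ is $(\mathcal{E},\nabla,M)$ with $\mathcal{E}$ a rank-two holomorphic vector bundle, $\nabla:\mathcal{E}\to\mathcal{E}\otimes\Omega^1_X(D)$ a connection, $M:\det\mathcal{E}\to\mathcal{O}_X$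 an isomorphism with $M(\mathrm{tr}\nabla)M^{-1}=d$. It has residue data $a$ if the eigenvalues (Levelt exponents) of $\mathrm{Res}_p\nabla$ are $\pm\lambda_p$ for all $p\in D$. Then at each $p\in D$ there is a canonical flat ordered decomposition of germs $\mathcal{E}_p\cong\Lambda_p^-\oplus\Lambda_p^+$, $\nabla\simeq\partial_p^-\oplus\partial_p^+$, into rank-one logarithmic connections with residue $-\lambda_p$ on $\Lambda_p^-$ and $+\lambda_p$ on $\Lambda_p^+$; $M$ induces a flat skew-symmetric isomorphism $M_p:\Lambda_p^-\otimes\Lambda_p^+\to\mathcal{O}_{X,p}$. For a Stokes region $U_I$ with $I=\{i,i'\}$ and polar vertices $p,p'$ ($i$ having sink $p_-$, $i'$ having sink $p'_-$), let $(\Lambda_i,\partial_i)$, $(\Lambda_{i'},\partial_{i'})$ be the flat continuations of $\Lambda_p^-$, $\Lambda_{p'}^-$ to $U_I$ (from the respective ends of the strip) inside $\mathcal{E}$. The connection is transverse with respect to $\Gamma$ if $\Lambda_i\neq\Lambda_{i'}$ for every Stokes region; then $\mathcal{E}|_{U_I}=\Lambda_i\oplus\Lambda_{i'}$ and $M$ induces a flat skew-symmetric $M_I:\Lambda_i\otimes\Lambda_{i'}\to\mathcal{O}_{U_I}$. $\mathrm{Conn}_X^2(\Gamma)$ is the category of $\Gamma$-transverse connections with residue data $a$. Odd abelian connections. $\mathcal{O}_\Sigma(R)$ carries the connection $\partial_R$ for which $\mathcal{O}_\Sigma\to\mathcal{O}_\Sigma(R)$ is flat. $\mathrm{Conn}_\Sigma^1$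 consists of $(\mathcal{L},\partial,\mu)$ with $\mathcal{L}$ a line bundle on $\Sigma$, $\partial$ a logarithmic connection with poles along $C\cup R$ and residues $\pm\lambda_p$ at $p_\pm$ and $-1/2$ along $R$, and $\mu:\mathcal{L}\otimes\sigma^*\mathcal{L}\to\mathcal{O}_\Sigma(R)$ an isomorphism intertwining $\partial\otimes\sigma^*\partial$ with $\partial_R$ and satisfying $\sigma^*\mu=-\mu$. Abelianisation. The abelianisation $(\mathcal{L},\partial,\mu)$ of $(\mathcal{E},\nabla,M)\in\mathrm{Conn}_X^2(\Gamma)$ is defined as follows. (i) Over $U_p^\pm$ it is $(\pi_p^\pm)^*(\Lambda_p^\pm,\partial_p^\pm)$, with $\mu$ the pullback of $M_p$. (ii) Over a spectral region $U_i$ it is $\pi_i^*(\Lambda_i,\partial_i)$, with $\mu=\pi_i^*M_I$. (iii) If $U_\alpha$ is a Stokes ray in $U_I\cap U_J$, $I=\{i,i'\}$, $J=\{j,j'\}$, with $U_\alpha^+\subset U_i\cap U_j$ and $U_\alpha^-\subset U_{i'}\cap U_{j'}$, then $\Lambda_{i'}=\Lambda_{j'}$ in $\mathcal{E}|_{U_\alpha}$; glue over $U_\alpha^-$ by the pullback of this identity and over $U_\alpha^+$ by the pullback of $g_\alpha:\Lambda_i\cong\mathcal{E}/\Lambda_{i'}=\mathcal{E}/\Lambda_{j'}\cong\Lambda_j$. (iv) Over the intersection of $U_p^-$ with a spectral region $U_{i'}$ having sink $p_-$, glue by the identity; over the intersection of $U_p^+$ with $U_i$ having source $p_+$ (with $i'=\sigma(i)$),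 glue by the pullback of $\Lambda_p^+\cong\mathcal{E}/\Lambda_p^-=\mathcal{E}/\Lambda_{i'}\cong\Lambda_i$. (v) Over $R$ take the Deligne extension with logarithmic poles and residues $-1/2$ (unique up to unique isomorphism), to which $\mu$ extends uniquely as an odd structure. *)

(* Defs.v *)
From HB Require Import structures.
From mathcomp Require Import all_boot all_order all_algebra.
From mathcomp Require Import complex.
From mathcomp Require Import all_classical all_reals all_analysis.
Import Order.TTheory GRing.Theory Num.Theory.
Import numFieldNormedType.Exports.

Set Implicit Arguments.
Unset Strict Implicit.
Unset Printing Implicit Defensive.

Local Open Scope classical_set_scope.
Local Open Scope ring_scope.
Local Open Scope complex_scope.

(* R[i] with its numFieldType structure, which is what gives it its topology
   and makes derivable / derive1 mean complex differentiation. *)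
Definition cpx (R : realType) : numFieldType := R[i].

Section SimplyConnected.
Context {R : realType} {T : topologicalType}.

Definition path_in (U : set T) (c : R -> T) (x y : T) : Prop :=
  [/\ {within `[0, 1], continuous c}, forall t, `[0, 1]%classic t -> U (c t),
      c 0 = x & c 1 = y].

Definition simply_connected (U : set T) : Prop :=
  [/\ U !=set0,
      forall x y, U x -> U y -> exists c, path_in U c x y &
      forall x c, path_in U c x x -> exists H : R * R -> T,
        [/\ {within (`[0, 1] `*` `[0, 1]), continuous H},
            forall u, (`[0, 1] `*` `[0, 1])%classic u -> U (H u),
            forall t, `[0, 1]%classic t -> H (t, 0) = c t /\ H (t, 1) = x &
            forall u, `[0, 1]%classic u -> H (0, u) = x /\ H (1, u) = x]].

End SimplyConnected.

(* A Riemann surface; its atlas is indexed by the points, the chart [chart p] on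
   [chart_dom p] being centred at [p], with inverse [chart_inv p].  Any atlas
   can be brought to this form. *)
Record surface (R : realType) := Surface {
  pts :> topologicalType;
  chart_dom : pts -> set pts;
  chart : pts -> pts -> cpx R;
  chart_inv : pts -> cpx R -> pts;
  surface_hausdorff : hausdorff_space pts;
  chart_dom_open : forall p, open (chart_dom p);
  chart_dom_self : forall p, chart_dom p p;
  chart_self : forall p, chart p p = 0;
  chart_continuous : forall p x, chart_dom p x -> {for x, continuous (chart p)};
  chart_image_open : forall p, open (chart p @` chart_dom p);
  chart_inv_continuous : forall p w, (chart p @` chart_dom p) w ->
    {for w, continuous (chart_inv p)};
  chartK : forall p x, chart_dom p x -> chart_inv p (chart p x) = x;
  chart_transition : forall p q x, chart_dom p x -> chart_dom q x ->
    derivable (chart q \o chart_inv p) (chart p x) 1 }.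

Section Surface.
Context {R : realType}.
Local Notation C := (cpx R).

Definition cdiff (S : surface R) (f : S -> C) (x : S) : Prop :=
  derivable (f \o chart_inv x) (chart x x) 1.

(* The coefficient of dz_p in df, at a point x of chart_dom p. *)
Definition ddz (S : surface R) (p : S) (f : S -> C) (x : S) : C :=
  derive1 (f \o chart_inv p) (chart p x).

Definition holo (S : surface R) (f : S -> C) (x : S) : Prop :=
  \forall y \near x, cdiff f y.

(* Objects with a pole of order at most k along P are recorded by their
   coefficients in the charts; at a point p of P, where the coefficient itself
   makes no sense, the recorded value is that of z_p ^ k times the coefficient.
   Multiplication by [wgt k P p] thus turns the coefficient near p into a
   function which is to be holomorphic at p too. *)
Definition wgt (S : surface R) (k : nat) (P : set S) (p x : S) : C :=
  if (p \in P) && (x != p) then chart p x ^+ k else 1.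

(* Holomorphic sections [sum_p w p (dz_p) ^ k] of (Omega^1 (P))^k. The leading
   coefficient at a point of P does not depend on the chart. *)
Definition differential (S : surface R) (k : nat) (P : set S)
    (w : S -> S -> C) : Prop :=
  (forall p q x, chart_dom p x -> chart_dom q x ->
     w q x = if x \in P then w p x else ddz q (chart p) x ^+ k * w p x) /\
  (forall x, holo (fun y => wgt k P x y * w x y) x).

(* h^0(Omega^1) = g *)
Definition has_genus (X : surface R) (g : nat) : Prop :=
  exists b : 'I_g -> X -> X -> C,
    (forall i, differential 1 set0 (b i)) /\
    forall w, differential 1 set0 w ->
      exists! c : {ffun 'I_g -> C}, forall p x, chart_dom p x ->
        w p x = \sum_i c i * b i p x.

Definition compact_curve (X : surface R) : Prop :=
  compact [set: X] /\ connected [set: X].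

(* A holomorphic vector bundle of rank n, each fibre being identified with C^n
   by a basis chosen pointwise (with no continuity): the holomorphic structure
   is carried by the local frames [frm p], whose columns are bases of the
   fibres over [fdom p].  Sections are functions S -> 'cV[C]_n. *)
Record bundle (S : surface R) (n : nat) := Bundle {
  fdom : S -> set S;
  frm : S -> S -> 'M[C]_n;
  fdom_open : forall p, open (fdom p);
  fdom_self : forall p, fdom p p;
  frm_unit : forall p x, fdom p x -> frm p x \in unitmx;
  frm_transition : forall p q x i j, fdom p x -> fdom q x ->
    cdiff (fun y => (invmx (frm p y) *m frm q y) i j) x }.

(* Holomorphy near x of a section of the bundle with frames F. *)
Definition hol_section (S : surface R) (n : nat) (F : S -> S -> 'M[C]_n)
    (s : S -> 'cV[C]_n) (x : S) : Prop :=
  \forall y \near x, forall k, cdiff (fun w => (invmx (F y w) *m s w) k 0) y.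

(* A connection with logarithmic poles along P.  [cov p s x] is the coefficient
   of dz_p in the covariant derivative of s at x; at x in P it is, as
   above, the value at x of z_x times the coefficient, i.e. Res_x (s x). *)
Record connection (S : surface R) (P : set S) (n : nat) (E : bundle S n) :=
Connection {
  cov :> S -> (S -> 'cV[C]_n) -> S -> 'cV[C]_n;
  cov_local : forall p x s t, chart_dom p x ->
    (\forall y \near x, s y = t y) -> cov p s x = cov p t x;
  covD : forall p x s t, chart_dom p x ->
    hol_section (frm E) s x -> hol_section (frm E) t x ->
    cov p (fun y => s y + t y) x = cov p s x + cov p t x;
  cov_leibniz : forall p x f s, chart_dom p x -> ~ P x ->
    holo f x -> hol_section (frm E) s x ->
    cov p (fun y => f y *: s y) x = ddz p f x *: s x + f x *: cov p s x;
  cov_chart : forall p q x s, chart_dom p x -> chart_dom q x ->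
    hol_section (frm E) s x ->
    cov q s x = if x \in P then cov p s x else ddz q (chart p) x *: cov p s x;
  cov_hol : forall x s, hol_section (frm E) s x ->
    hol_section (frm E) (fun y => wgt 1 P x y *: cov x s y) x }.

(* Matrix of Res_p in the chosen basis of the fibre at p. *)
Definition residue (S : surface R) (P : set S) (n : nat) (E : bundle S n)
    (nabla : connection P E) (p : S) : 'M[C]_n :=
  (\matrix_(i, j) nabla p (fun x => col j (frm E p x)) p i 0) *m
    invmx (frm E p p).

(* v generates, near x, a rank-one subbundle preserved by the connection. *)
Definition flat_generator (S : surface R) (P : set S) (n : nat)
    (E : bundle S n) (nabla : connection P E) (v : S -> 'cV[C]_n) (x : S) :=
  hol_section (frm E) v x /\
  \forall y \near x, v y != 0 /\ exists c, nabla y v y = c *: v y.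

Definition line (n : nat) (v : 'cV[C]_n) : set 'cV[C]_n :=
  [set w | exists c, w = c *: v].

(* [generator U e]: e trivialises the line bundle L over the open set U. *)
Definition generator (S : surface R) (L : bundle S 1) (U : set S)
    (e : S -> 'cV[C]_1) : Prop :=
  forall s, U s -> hol_section (frm L) e s /\ e s != 0.

(* The equation "covariant derivative of e = w (x) e" over U. *)
Definition eigensection (S : surface R) (P : set S) (n : nat) (E : bundle S n)
    (nabla : connection P E) (w : S -> S -> C) (U : set S)
    (e : S -> 'cV[C]_n) : Prop :=
  forall s p, U s -> chart_dom p s -> nabla p e s = w p s *: e s.

(* The pairing of sections of E induced by M : det E -> O; the fibre of M at x
   is m x times the standard volume form of C^2. *)
Definition vol (S : surface R) (m : S -> C) (x : S) (u v : 'cV[C]_2) : C :=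
  m x * \det (row_mx u v).

Record sl2_connection (X : surface R) (D : set X) := Sl2Connection {
  sl2_bundle : bundle X 2;
  sl2_conn :> connection D sl2_bundle;
  sl2_vol : X -> C;
  sl2_vol_neq0 : forall x, sl2_vol x != 0;
  sl2_vol_hol : forall x s t,
    hol_section (frm sl2_bundle) s x -> hol_section (frm sl2_bundle) t x ->
    holo (fun y => vol sl2_vol y (s y) (t y)) x;
  sl2_vol_flat : forall x s t, ~ D x ->
    hol_section (frm sl2_bundle) s x -> hol_section (frm sl2_bundle) t x ->
    ddz x (fun y => vol sl2_vol y (s y) (t y)) x =
      vol sl2_vol x (sl2_conn x s x) (t x) +
      vol sl2_vol x (s x) (sl2_conn x t x) }.

(* The Levelt exponents at p in D are +lam p and -lam p. *)
Definition has_residue_data (X : surface R) (D : set X) (lam : X -> C)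
    (E : sl2_connection D) : Prop :=
  forall p, D p ->
    char_poly (residue E p) = ('X - (lam p)%:P) * ('X - (- lam p)%:P).

End Surface.

Section Quadratic.
Context {R : realType} {X : surface R}.
Variables (D : set X) (lam : X -> cpx R) (phi : X -> X -> cpx R).
Local Notation C := (cpx R).

Definition generic_residue_data (a : X -> C) : Prop :=
  forall p, D p -> [/\ lam p ^+ 2 = a p, 0 < complex.Re (lam p) &
                       forall n : int, lam p *+ 2 != n%:~R].

Definition zeros : set X := [set x | phi x x = 0].

Definition generic_quadratic (a : X -> C) : Prop :=
  [/\ differential 2 D phi, forall p, D p -> phi p p = a p &
      forall x, zeros x -> ddz x (phi x) x != 0].

(* The curve of square roots of phi, as a Riemann surface embedded in the total
   space of Omega^1(D).  The point s lies over [prX s], and is the vector with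
   coordinate [taut p s] with respect to dz_p (dz_p / z_p at the points of D;
   this is the residue).  A holomorphic injective immersion onto the smooth
   curve v ^ 2 = phi is an isomorphism, so this determines the curve up to unique
   isomorphism. *)
Record spectral_curve := SpectralCurve {
  curve :> surface R;
  prX : curve -> X;
  taut : X -> curve -> C;
  prX_continuous : continuous prX;
  prX_hol : forall p s, chart_dom p (prX s) -> cdiff (chart p \o prX) s;
  taut_chart : forall p q s, chart_dom p (prX s) -> chart_dom q (prX s) ->
    taut q s =
      if prX s \in D then taut p s else ddz q (chart p) (prX s) * taut p s;
  taut_hol : forall s,
    holo (fun t => wgt 1 D (prX s) (prX t) * taut (prX s) t) s;
  prX_taut_inj : forall s t,
    prX s = prX t -> taut (prX s) s = taut (prX s) t -> s = t;
  prX_taut_image : forall x v, v ^+ 2 = phi x x <->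
    exists s, prX s = x /\ taut x s = v;
  prX_taut_immersion : forall s, ddz s (chart (prX s) \o prX) s != 0 \/
    ddz s (fun t => wgt 1 D (prX s) (prX t) * taut (prX s) t) s != 0;
  sigma : curve -> curve;
  prX_sigma : forall s, prX (sigma s) = prX s;
  taut_sigma : forall s, taut (prX s) (sigma s) = - taut (prX s) s }.
Arguments prX {_} _.
Arguments taut {_} _ _.
Arguments sigma {_} _.

Section Spectral.
Variable Sg : spectral_curve.

Definition poles : set Sg := prX @^-1` D.

Definition ramification : set Sg :=
  [set s | ddz s (chart (prX s) \o prX) s = 0].

(* The pullback of the tautological form; its residue at s in C = prX^-1(D) is
   taut s because prX is unramified there. *)
Definition can_form (p s : Sg) : C :=
  taut (prX s) s * (if prX s \in D then 1 else ddz p (chart (prX s) \o prX) s).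

Definition source (c : Sg) : Prop := poles c /\ can_form c c = lam (prX c).
Definition sink (c : Sg) : Prop := poles c /\ can_form c c = - lam (prX c).

End Spectral.
Arguments poles {Sg} _.
Arguments ramification {Sg} _.

(* c passes through time t in X \ (D u B), moving along the horizontal foliation
   at unit speed: phi(c'(t)) = 1. In particular c'(t) is in the image of
   ker (Im eta), spanned by the tangent vectors on which the square root eta of
   phi is real. *)
Definition horizontal (c : R -> X) (t : R) : Prop :=
  [/\ ~ (D `|` zeros) (c t), {for t, continuous c} &
      exists v : C,
        (fun h : R => (h^-1)%:C * chart (c t) (c (t + h)) : C) @ 0^' --> v /\
        phi (c t) (c t) * v ^+ 2 = 1].

Definition leaf (x : X) : set X :=
  [set x' | exists c r, [/\ 0 <= r, forall t, 0 <= t <= r -> horizontal c t,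
                           c 0 = x & c r = x']].

Definition stokes_ray (l : set X) : Prop :=
  (exists x, ~ (D `|` zeros) x /\ l = leaf x) /\
  exists (c : R -> X) (r : R) (b : X),
    [/\ 0 < r, zeros b, c t @[t --> 0^'+] --> b &
        forall t, 0 < t < r -> horizontal c t /\ l (c t)].

(* A zero of phi is at finite phi-distance, so a leaf with both ends in B has
   a unit speed parametrisation by a bounded interval. *)
Definition saddle_free : Prop :=
  ~ exists (c : R -> X) (r : R) (b b' : X),
    [/\ 0 < r, zeros b /\ zeros b', forall t, 0 < t < r -> horizontal c t,
        c t @[t --> 0^'+] --> b & c t @[t --> r^'-] --> b'].

(* The complement of the Stokes graph (vertices and edges). *)
Definition off_graph : set X :=
  ~` (D `|` zeros `|` [set x | exists l, stokes_ray l /\ l x]).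

(* The faces of the graph are the connected components of its complement;
   the spectral regions are the components of their preimages. *)
Definition spectral_region (Sg : spectral_curve) (i : set Sg) : Prop :=
  exists s, off_graph (prX s) /\
    i = connected_component (prX @^-1` off_graph) s.

(* A choice of the (small) neighbourhoods U_i of the spectral regions.  The same
   region may lie on both sides of a Stokes ray, in which case it has no simply
   connected embedded neighbourhood containing that ray; hence only i `<=` U i
   is required. *)
Definition region_neighbourhoods (Sg : spectral_curve)
    (U : set Sg -> set Sg) : Prop :=
  forall i, spectral_region i ->
    [/\ open (U i), i `<=` U i, U i `<=` ~` (poles `|` ramification),
        @simply_connected R Sg (U i) &
        {in U i &, injective prX} /\
        U (sigma @` i) = sigma @` U i].

Section Pullback.
Variables (Sg : spectral_curve) (n : nat) (E : bundle X n).

Definition pull_frm (s t : Sg) : 'M[C]_n := frm E (prX s) (prX t).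

(* The pullback connection off C, from the Leibniz rule applied to
   sum_k f_k prX^*(e_k), with e_k the columns of the frame at prX s. *)
Definition pull_cov (nabla : connection D E) (p : Sg) (t : Sg -> 'cV[C]_n)
    (s : Sg) : 'cV[C]_n :=
  let f w := invmx (pull_frm s w) *m t w in
  pull_frm s s *m (\col_k ddz p (fun w => f w k 0) s) +
  ddz p (chart (prX s) \o prX) s *:
    \sum_k f s k 0 *: nabla (prX s) (fun x => col k (frm E (prX s) x)) (prX s).

End Pullback.

(* [Lam i s] is the fibre at s in U i of the flat continuation over U i of the
   germ Lambda_p^- (the flat line subbundle with residue -lam p), where p_- is
   the sink of i, through the end of i at p_-. *)
Definition sink_lines (Sg : spectral_curve) (E : sl2_connection D)
    (U : set Sg -> set Sg) (Lam : set Sg -> Sg -> set 'cV[C]_2) : Prop :=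
  forall i, spectral_region i ->
    (forall s, U i s -> exists2 v, flat_generator E v (prX s) &
       \forall t \near s, Lam i t = line (v (prX t))) /\
    (forall c, sink c -> closure i c -> exists v,
       [/\ flat_generator E v (prX c),
           E (prX c) v (prX c) = - lam (prX c) *: v (prX c) &
           \forall t \near c, i t -> Lam i t = line (v (prX t))]).

Definition transverse (Sg : spectral_curve)
    (Lam : set Sg -> Sg -> set 'cV[C]_2) : Prop :=
  forall i, spectral_region i ->
    ~ forall s, i s -> Lam i s = Lam (sigma @` i) (sigma s).

(* At s, the fibre of mu is the pairing (u, v) |-> mu s * u * v of the fibres
   of L at s and sigma s; at s in R it is recorded by z_s times
   its value, a generator of the fibre of O(R) being 1 / z_s. *)
Record odd_abelian (Sg : spectral_curve) := OddAbelian {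
  ab_bundle : bundle Sg 1;
  ab_conn :> connection (poles `|` ramification) ab_bundle;
  ab_mu : Sg -> C;
  ab_res_source : forall c, source c -> residue ab_conn c = (lam (prX c))%:M;
  ab_res_sink : forall c, sink c -> residue ab_conn c = (- lam (prX c))%:M;
  ab_res_ram : forall b, ramification b -> residue ab_conn b = (- 2^-1)%:M;
  ab_mu_neq0 : forall s, ab_mu s != 0;
  ab_mu_hol : forall s u v,
    hol_section (frm ab_bundle) u s ->
    hol_section (frm ab_bundle) v (sigma s) ->
    holo (fun t => wgt 1 ramification s t *
                   (ab_mu t * (u t 0 0 * v (sigma t) 0 0))) s;
  ab_mu_flat : forall s u v, ~ (poles `|` ramification) s ->
    hol_section (frm ab_bundle) u s ->
    hol_section (frm ab_bundle) v (sigma s) ->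
    ddz s (fun t => ab_mu t * (u t 0 0 * v (sigma t) 0 0)) s =
      ab_mu s * (ab_conn s u s 0 0 * v (sigma s) 0 0) +
      ab_mu s * (u s 0 0 * (ddz s (chart (sigma s) \o sigma) s *:
                            ab_conn (sigma s) v (sigma s)) 0 0);
  ab_mu_odd : forall s, ~ ramification s -> ab_mu (sigma s) = - ab_mu s }.

Section Abelianisation.
Variables (Sg : spectral_curve) (E : sl2_connection D).
Variable L : odd_abelian Sg.

(* h, a family of linear maps from the fibres of L to those of prX^*E, is
   holomorphic near s and intertwines the connections at s. *)
Definition flat_hom_at (h : Sg -> 'M[C]_(2, 1)) (s : Sg) : Prop :=
  forall t, hol_section (frm (ab_bundle L)) t s ->
    hol_section (@pull_frm Sg 2 (sl2_bundle E)) (fun w => h w *m t w) s /\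
    (~ (poles `|` ramification) s -> forall p, chart_dom p s ->
       pull_cov E p (fun w => h w *m t w) s = h s *m L p t s).

(* h i identifies L over U i with the pullback of Lambda_i. *)
Definition region_data (U : set Sg -> set Sg)
    (Lam : set Sg -> Sg -> set 'cV[C]_2)
    (h : set Sg -> Sg -> 'M[C]_(2, 1)) : Prop :=
  forall i s, spectral_region i -> U i s ->
    [/\ flat_hom_at (h i) s,
        h i s != 0,
        [set h i s *m u | u in setT] = Lam i s &
        forall u v : 'cV[C]_1, ab_mu L s * (u 0 0 * v 0 0) =
          vol (sl2_vol E) (prX s) (h i s *m u)
              (h (sigma @` i) (sigma s) *m v)].

(* Gluing across the lift of a Stokes ray l, at a point s of the lift with
   polar vertex c.  N is a neighbourhood of s cut by the lift into two sides,
   lying in the regions i and j; hi and hj are the continuations of h i and h j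
   to N from these sides.  The composite Lam_i -> E / Lam_(sigma i) <- Lam_j is
   the gluing map iff hi and hj agree modulo Lam_(sigma i). *)
Definition ray_gluing (Lam : set Sg -> Sg -> set 'cV[C]_2)
    (h : set Sg -> Sg -> 'M[C]_(2, 1)) : Prop :=
  forall l s c, stokes_ray l -> l (prX s) -> poles c ->
    closure (connected_component (prX @^-1` l) s) c ->
    exists (i j N Ni Nj : set Sg) (hi hj : Sg -> 'M[C]_(2, 1)),
      [/\ [/\ spectral_region i, spectral_region j, open N & N s],
          [/\ N `\` prX @^-1` l = Ni `|` Nj, Ni `&` Nj = set0,
              connected Ni & connected Nj],
          [/\ Ni `<=` i, Nj `<=` j, closure Ni s & closure Nj s],
          [/\ forall t, N t -> flat_hom_at hi t /\ flat_hom_at hj t,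
              forall t, Ni t -> hi t = h i t & forall t, Nj t -> hj t = h j t] &
          (sink c -> forall t, N t -> hi t = hj t) /\
          (source c -> forall t u, Ni t ->
             Lam (sigma @` i) (sigma t) ((hi t - hj t) *m u))].

(* k c identifies L near c in C with the pullback of Lambda_p^+ or
   Lambda_p^-, p = prX c. *)
Definition pole_data (k : Sg -> Sg -> 'M[C]_(2, 1)) : Prop :=
  forall c, poles c ->
    (exists v, [/\ flat_generator E v (prX c),
                   E (prX c) v (prX c) = can_form c c *: v (prX c) &
                   \forall s \near c, k c s != 0 /\
                     [set k c s *m u | u in setT] = line (v (prX s))]) /\
    \forall s \near c, flat_hom_at (k c) s /\
      forall u w : 'cV[C]_1, ab_mu L s * (u 0 0 * w 0 0) =
        vol (sl2_vol E) (prX s) (k c s *m u) (k (sigma c) (sigma s) *m w).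

(* The identity at a sink p_-; at a source, the isomorphism Lambda_p^+ ->
   E / Lambda_p^- = E / Lam_(sigma i) <- Lam_i. *)
Definition pole_gluing (Lam : set Sg -> Sg -> set 'cV[C]_2)
    (h : set Sg -> Sg -> 'M[C]_(2, 1)) (k : Sg -> Sg -> 'M[C]_(2, 1)) : Prop :=
  forall i c, spectral_region i -> closure i c ->
    (sink c -> \forall s \near c, i s -> h i s = k c s) /\
    (source c -> \forall s \near c, i s -> forall u,
       Lam (sigma @` i) (sigma s) ((h i s - k c s) *m u)).

(* (L, h, k) is the abelianisation of E with its canonical identifications.
   The Deligne extension over R with residue -1/2
   and the extension of mu are part of the type of L. *)
Definition abelianisation (U : set Sg -> set Sg)
    (Lam : set Sg -> Sg -> set 'cV[C]_2)
    (h : set Sg -> Sg -> 'M[C]_(2, 1)) (k : Sg -> Sg -> 'M[C]_(2, 1)) : Prop :=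
  [/\ pole_data k, region_data U Lam h, ray_gluing Lam h &
      pole_gluing Lam h k].

End Abelianisation.
End Quadratic.

Arguments ramification {R X D phi} Sg _.
Arguments can_form {R X D phi} Sg p s.
Arguments simply_connected {R T} U.
Arguments pull_cov {R X D phi Sg n E} nabla p t s.

(* Main.v *)
Require Import Defs.
From HB Require Import structures.
From mathcomp Require Import all_boot all_order all_algebra.
From mathcomp Require Import complex ring lra.
From mathcomp Require Import all_classical all_reals all_analysis.
Import Order.TTheory GRing.Theory Num.Theory.
Import numFieldNormedType.Exports.
Set Implicit Arguments.
Unset Strict Implicit.
Unset Printing Implicit Defensive.
Local Open Scope classical_set_scope.
Local Open Scope ring_scope.

(** Write the connection of a line bundle in a local frame as [d + omega].  At a
    point of [V] the forms [omega] and [eta] have at most a simple pole and the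
    same residue, so [eta - omega] is holomorphic and the exponential of one of
    its primitives, times the frame, is a local solution; two local solutions
    differ by a constant.  The solutions thus form a local system of rank one,
    which has a global section because [V] is simply connected.  Over a spectral
    region the flat inclusion is part of the data of the abelianisation, and it
    maps eigensections to eigensections.

    Holomorphy here is differentiability at every point, so the primitive needs
    Goursat's lemma (with an exceptional point, where [eta - omega] is only seen
    to be continuous), and the holomorphy of [eta], the product of a holomorphic
    function with the derivative of another, needs Cauchy's formula. *)

(** * Complex differentiation and integration *)

(** The set [V] may contain points of [C]. Since the residues of the connection and of [eta] agree
    there, turning around such a point produces no monodromy, and the simple connectedness of [V]
    itself, rather than of [V] minus the poles, suffices. At a ramification point the residue of the
    connection is -1/2 while [eta] is holomorphic, so no generator can be an eigensection there.

    Poles and ordinary points are treated by one equation [z u' = a u] with [a = z (eta - omega)]: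
    [a 0 = 0] is the equality of residues in the first case and trivial in the second.

    The covariant derivative at a pole is recorded only as a residue, and the Leibniz rule is
    available only off the poles. Identities are therefore proved on a punctured neighbourhood and
    then extended by continuity.

    Paths and homotopies are not injective, so continuation along them is expressed by sections of
    the pulled-back local system, glued over small rectangles. *)

Lemma is_derive_cvgP (K : numFieldType) (f : K -> K) (z d : K) :
  is_derive z 1 f d <->
  (fun h => h^-1 *: ((f \o shift z) (h *: 1) - f z)) @ 0^' --> d.
Proof.
split=> [[df <-]|fd]; first exact: df.
have df : derivable f z 1 by apply/cvg_ex; exists d.
by apply: DeriveDef df _; exact/cvg_lim.
Qed.

(** Carathéodory's form of differentiability: the difference quotient [q] extends continuously to
    [z]. Chain rules become algebra with slopes, and the same [q] later serves as the quotient with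
    a removable singularity. *)
Lemma caratheodoryP (K : numFieldType) (f : K -> K) (z d : K) :
  is_derive z 1 f d <->
  exists q, [/\ {for z, continuous q}, q z = d &
                forall w, f w = f z + (w - z) * q w].
Proof.
rewrite is_derive_cvgP; split=> [fd|[q [qz <- fq]]].
  exists (fun w => if w == z then d else (w - z)^-1 * (f w - f z)).
  split; last first.
  - move=> w; case: eqVneq => [->|wz]; first by rewrite subrr mul0r addr0.
    by rewrite mulrA divff ?subr_eq0// mul1r subrKC.
  - by rewrite eqxx.
  rewrite /prop_for /continuous_at eqxx; apply/(@cvgrPdist_lt K K K (nbhs z)) => e e0.
  move/cvgrPdist_lt : fd => /(_ e e0) /nbhs_normP[r r0 hr].
  apply/nbhs_normP; exists r => // w /= wr.
  case: eqVneq => [_|wz]; first by rewrite subrr normr0.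
  have := hr (w - z); rewrite /= sub0r normrN distrC => /(_ wr).
  by rewrite scaler1 subr_eq0 => /(_ wz); rewrite /shift /= subrK.
apply/cvgrPdist_lt => e e0.
move/cvgrPdist_lt : qz => /(_ e e0) /nbhs_normP[r r0 hr].
apply/nbhs_normP; exists r => // h /=; rewrite sub0r normrN => hlt h0.
rewrite /shift scaler1 fq addrAC subrr add0r addrK /= /GRing.scale /= mulKf//.
by apply: hr; rewrite /= opprD addrCA subrr addr0 normrN.
Qed.

Lemma is_derive_continuous (K : numFieldType) (f : K -> K) (z d : K) :
  is_derive z 1 f d -> {for z, continuous f}.
Proof.
by case=> /derivable1_diffP df _; exact: differentiable_continuous.
Qed.

Lemma is_derive_comp (K : numFieldType) (f g : K -> K) (z df dg : K) :
  is_derive (g z) 1 f df -> is_derive z 1 g dg ->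
  is_derive z 1 (f \o g) (df * dg).
Proof.
move=> /caratheodoryP[p [pc <- fp]] /caratheodoryP[q [qc <- gq]].
apply/caratheodoryP; exists (fun w => p (g w) * q w); split=> //=.
- apply: continuousM => //; apply: continuous_comp => //.
  by apply: (@is_derive_continuous _ _ _ (q z)); apply/caratheodoryP; exists q.
- by move=> w; rewrite fp [in X in _ + X * _]gq addrAC subrr add0r mulrAC mulrA.
Qed.

(** * The modulus as a real number *)

Section Modulus.
Context {R : realType}.
Local Notation C := (cpx R).
Local Notation nm := (@Normc.normc R).
Local Notation Re := (@complex.Re R).
Local Notation Im := (@complex.Im R).
Implicit Types z w : C.

(** The norm of the numeric field [C] takes its values in [C]. Its real counterpart [nm] makes
    estimates accessible to real arithmetic. *)
Lemma normcE z : `|z| = (nm z)%:C%C :> C.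
Proof. by case: z. Qed.

Lemma nm_ge0 z : 0 <= nm z.
Proof. by rewrite -ler0c -[X in _ <= X]normcE normr_ge0. Qed.

Lemma nmD z w : nm (z + w) <= nm z + nm w.
Proof. exact: le_normcD. Qed.

Lemma nmM z w : nm (z * w) = nm z * nm w.
Proof. exact: Normc.normcM. Qed.

Lemma nmN z : nm (- z) = nm z.
Proof. exact: normcN. Qed.

Lemma nmV z : nm z^-1 = (nm z)^-1.
Proof. exact: Normc.normcV. Qed.

Lemma nmB z w : nm (z - w) = nm (w - z).
Proof. by rewrite -nmN opprB. Qed.

Lemma nm0 : nm (0 : C) = 0.
Proof. exact: Normc.normc0. Qed.

Lemma nm1 : nm (1 : C) = 1.
Proof. exact: Normc.normc1. Qed.

Lemma nm_eq0 z : (nm z == 0) = (z == 0).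
Proof.
by apply/eqP/eqP => [/Normc.eq0_normc|->]; [|exact: nm0].
Qed.

Lemma nm_gt0 z : (0 < nm z) = (z != 0).
Proof. by rewrite lt_neqAle nm_ge0 andbT eq_sym nm_eq0. Qed.

Lemma nm_real (x : R) : nm (x%:C%C : C) = `|x|.
Proof. by rewrite /= expr0n/= addr0 sqrtr_sqr. Qed.

Lemma nm_Re z : `|Re z| <= nm z.
Proof.
case: z => a b /=; rewrite -sqrtr_sqr ler_wsqrtr// lerDl; exact: sqr_ge0.
Qed.

Lemma nm_Im z : `|Im z| <= nm z.
Proof.
case: z => a b /=; rewrite -sqrtr_sqr ler_wsqrtr// lerDr; exact: sqr_ge0.
Qed.

Lemma nm_ReIm z : nm z <= `|Re z| + `|Im z|.
Proof.
case: z => a b /=; rewrite -[leRHS]ger0_norm ?addr_ge0// -sqrtr_sqr.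
rewrite ler_wsqrtr// sqrrD !real_normK ?num_real//.
by rewrite addrAC lerDl mulrn_wge0// mulr_ge0.
Qed.

Lemma ReD z w : Re (z + w) = Re z + Re w. Proof. by case: z w => ? ? [? ?]. Qed.
Lemma ImD z w : Im (z + w) = Im z + Im w. Proof. by case: z w => ? ? [? ?]. Qed.
Lemma ReN z : Re (- z) = - Re z. Proof. by case: z. Qed.
Lemma ImN z : Im (- z) = - Im z. Proof. by case: z. Qed.
Lemma ReM z w : Re (z * w) = Re z * Re w - Im z * Im w.
Proof. by case: z w => ? ? [? ?]. Qed.
Lemma ImM z w : Im (z * w) = Re z * Im w + Im z * Re w.
Proof. by case: z w => ? ? [? ?]. Qed.

Lemma cpx_eq z w : Re z = Re w -> Im z = Im w -> z = w.
Proof. by case: z w => a b [c d] /= -> ->. Qed.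

Lemma nbhs_nmP z (A : set C) :
  nbhs z A <-> exists2 d : R, 0 < d & forall w, nm (w - z) < d -> A w.
Proof.
split=> [/nbhs_ballP[e e0]|[d d0 h]].
  rewrite -ball_normE /ball_ /= => h; case: e e0 h => a b /= e0 h.
  (* A positive radius in [C] has imaginary part zero, so it is a real radius. *)
  move: (e0); rewrite ltcE /= => /andP[/eqP b0 a0]; subst b.
  by exists a => // w hw; apply: h; rewrite /= distrC normcE ltcR.
apply/nbhs_ballP; exists (d%:C)%C; first by rewrite /= ltcR.
by rewrite -ball_normE => w /=; rewrite distrC normcE ltcR; exact: h.
Qed.

Lemma cvg_nmP (T : Type) (F : set_system T) (FF : Filter F) (f : T -> C) z :
  (f @ F --> z) <-> forall e, 0 < e -> \forall t \near F, nm (f t - z) < e.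
Proof.
split=> [fz e e0|h A /nbhs_nmP[d d0 dA]].
  by apply: (fz [set w | nm (w - z) < e]); apply/nbhs_nmP; exists e.
by apply: filterS (h _ d0) => t; exact: dA.
Qed.

Lemma continuous_nmP (f : C -> C) z : {for z, continuous f} <->
  forall e, 0 < e -> exists2 d, 0 < d & forall w, nm (w - z) < d -> nm (f w - f z) < e.
Proof.
have := @cvg_nmP C (nbhs z) _ f (f z); rewrite /prop_for /continuous_at => ->.
by split=> h e /h/nbhs_nmP.
Qed.

Lemma cvg_ReIm (T : Type) (F : set_system T) (FF : Filter F) (f : T -> C) z :
  (f @ F --> z) <-> (Re (f t) @[t --> F] --> Re z) /\ (Im (f t) @[t --> F] --> Im z).
Proof.
split=> [/cvg_nmP h|[/cvgrPdist_lt hr /cvgrPdist_lt hi]].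
  split; apply/cvgrPdist_lt => e /h; apply: filterS => t; apply: le_lt_trans.
    by rewrite distrC -ReN -ReD; exact: nm_Re.
  by rewrite distrC -ImN -ImD; exact: nm_Im.
apply/cvg_nmP => e e0; have e20 : 0 < e / 2 by rewrite divr_gt0.
apply: filterS2 (hr _ e20) (hi _ e20) => t htr hti.
apply: le_lt_trans (nm_ReIm _) _.
by rewrite ReD ReN ImD ImN distrC [X in _ + X]distrC [ltRHS]splitr ltrD.
Qed.

Lemma continuous_Re : continuous (Re : C -> R).
Proof. by move=> z; have /cvg_ReIm[] : id @ nbhs z --> z by exact: cvg_id. Qed.

Lemma continuous_Im : continuous (Im : C -> R).
Proof. by move=> z; have /cvg_ReIm[] : id @ nbhs z --> z by exact: cvg_id. Qed.

Lemma continuous_real_complex : continuous (fun t : R => (t%:C)%C : C).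
Proof. by move=> t; apply/cvg_ReIm; split; [exact: cvg_id|exact: cvg_cst]. Qed.

End Modulus.

(** The integral starts at -1 and the integrand is considered on [[-1, 2]], so that 0 and 1 are
    interior points and the derivative is two-sided there. *)
Lemma continuous_primitive (R : realType) (g : R -> R) : continuous g ->
  exists G : R -> R, forall t : R, 0 <= t <= 1 -> is_derive t 1 G (g t).
Proof.
move=> cg; pose mu := @lebesgue_measure R.
have ig : mu.-integrable `[-1, 2] (EFin \o g).
  apply: continuous_compact_integrable; first exact: segment_compact.
  exact: continuous_subspaceT.
exists (fun x => (\int[mu]_(t in [set` `[-1, x]]) g t)%R) => t /andP[t0 t1].
have t2 : t < 2 by apply: le_lt_trans t1 _; rewrite ltr1n.
have tN1 : -1 < t by apply: lt_le_trans t0; rewrite ltrN10.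
have [dG G'] := continuous_FTC1_closed t2 ig tN1 (cg t).
by apply: DeriveDef => //; rewrite -derive1E.
Qed.

(** * Integration of complex functions of a real variable *)

Section PathIntegral.
Context {R : realType}.
Local Notation C := (cpx R).
Local Notation nm := (@Normc.normc R).
Local Notation Re := (@complex.Re R).
Local Notation Im := (@complex.Im R).

(* Derivative of a path, componentwise: [R] does not act on [C] as a normed
   module. *)
Definition pderive (G : R -> C) (t : R) (d : C) : Prop :=
  is_derive t 1 (Re \o G) (Re d) /\ is_derive t 1 (Im \o G) (Im d).

Lemma pderiveD G H t d e : pderive G t d -> pderive H t e ->
  pderive (fun s => G s + H s) t (d + e).
Proof.
move=> [Gr Gi] [Hr Hi]; split.
  rewrite (_ : _ \o _ = (Re \o G) + (Re \o H)); last by apply/funext => s /=; rewrite ReD.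
  by rewrite ReD; exact: is_deriveD.
rewrite (_ : _ \o _ = (Im \o G) + (Im \o H)); last by apply/funext => s /=; rewrite ImD.
by rewrite ImD; exact: is_deriveD.
Qed.

Lemma pderiveZ (c : C) G t d : pderive G t d -> pderive (fun s => c * G s) t (c * d).
Proof.
move=> [Gr Gi]; split.
  rewrite (_ : _ \o _ = (Re c \*: (Re \o G)) - (Im c \*: (Im \o G))); last first.
    by apply/funext => s /=; rewrite ReM.
  by rewrite ReM; exact: is_deriveB.
rewrite (_ : _ \o _ = (Re c \*: (Im \o G)) + (Im c \*: (Re \o G))); last first.
  by apply/funext => s /=; rewrite ImM.
by rewrite ImM; exact: is_deriveD.
Qed.

Lemma pderive_affine G (a b t : R) d : pderive G (a + b * t) d ->
  pderive (fun s => G (a + b * s)) t ((b%:C)%C * d).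
Proof.
have hab : is_derive t 1 (fun s : R => a + b * s) b.
  rewrite (_ : (fun s => _) = cst a + (b \*: id)); last exact/funext.
  by apply: is_derive_eq; rewrite add0r /GRing.scale /= mulr1.
move=> [Gr Gi]; split.
  rewrite ReM /= mul0r subr0 mulrC.
  exact: (@is_derive_comp _ (Re \o G) (fun s => a + b * s)).
rewrite ImM /= mul0r addr0 mulrC.
exact: (@is_derive_comp _ (Im \o G) (fun s => a + b * s)).
Qed.

Lemma pderive_comp (F : C -> C) (d a v : C) (t : R) :
  is_derive (a + (t%:C)%C * v) 1 F d ->
  pderive (fun s => F (a + (s%:C)%C * v)) t (d * v).
Proof.
move=> /caratheodoryP[q [qc <- Fq]].
have cg : {for t, continuous (fun s : R => q (a + (s%:C)%C * v) * v : C)}.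
  apply: (@cvgM _ R (nbhs t)); last exact: cvg_cst.
  apply: (@cvg_comp _ _ _ (fun s : R => a + (s%:C)%C * v : C) q (nbhs t)) qc.
  apply: (@cvgD _ _ R (nbhs t)); first exact: cvg_cst.
  by apply: (@cvgM _ R (nbhs t)); [exact: continuous_real_complex|exact: cvg_cst].
have /cvg_ReIm[cr ci] := cg.
have FE s : F (a + (s%:C)%C * v) =
    F (a + (t%:C)%C * v) + ((s - t)%:C)%C * (q (a + (s%:C)%C * v) * v).
  by rewrite [LHS]Fq rmorphB /=; ring.
split; apply/caratheodoryP.
  exists (fun s => Re (q (a + (s%:C)%C * v) * v)); split => // s /=.
  by rewrite FE ReD [Re (_ * (q _ * v))]ReM /= mul0r subr0.
exists (fun s => Im (q (a + (s%:C)%C * v) * v)); split => // s /=.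
by rewrite FE ImD [Im (_ * (q _ * v))]ImM /= mul0r addr0.
Qed.

Lemma real_mean_value (g dg : R -> R) :
  (forall t : R, 0 < t < 1 -> is_derive t 1 g (dg t)) ->
  {within `[0, 1], continuous g} ->
  exists2 t : R, 0 < t < 1 & g 1 - g 0 = dg t.
Proof.
move=> dgt cg.
have dg' (x : R) : x \in `]0, 1[ -> is_derive x 1 g (dg x).
  by rewrite in_itv /=; exact: dgt.
have [t] := MVT ltr01 dg' cg.
by rewrite in_itv /= subr0 mulr1 => t01 ->; exists t.
Qed.

Lemma within_derive_continuous (g dg : R -> R) :
  (forall t : R, 0 <= t <= 1 -> is_derive t 1 g (dg t)) ->
  {within `[0, 1], continuous g}.
Proof.
move=> h; apply: continuous_in_subspaceT => t; rewrite inE /= in_itv /= => /h.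
exact: is_derive_continuous.
Qed.

(** The mean value theorem fails for complex values. It is applied to the real and imaginary parts
    separately, at unrelated times, whence the factor 2. Asking for continuity only at the ends
    allows a path that starts at an exceptional point. *)
Lemma path_mean_value (G : R -> C) (g : R -> C) (M : R) :
  (forall t : R, 0 < t < 1 -> pderive G t (g t)) ->
  {within `[0, 1], continuous (Re \o G)} ->
  {within `[0, 1], continuous (Im \o G)} ->
  (forall t : R, 0 < t < 1 -> nm (g t) <= M) ->
  nm (G 1 - G 0) <= 2 * M.
Proof.
move=> dG cr ci gM.
have [t t01 rt] := real_mean_value (fun t ht => (dG t ht).1) cr.
have [s s01 is_] := real_mean_value (fun t ht => (dG t ht).2) ci.
apply: le_trans (nm_ReIm _) _; rewrite mulr_natl mulr2n lerD//.
  by rewrite ReD ReN [X in `|X|]rt (le_trans (nm_Re _))// gM.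
by rewrite ImD ImN [X in `|X|]is_ (le_trans (nm_Im _))// gM.
Qed.

Definition path_primitive (g G : R -> C) : Prop :=
  forall t : R, 0 <= t <= 1 -> pderive G t (g t).

Lemma path_primitive_bound (g G : R -> C) (M : R) : path_primitive g G ->
  (forall t : R, 0 <= t <= 1 -> nm (g t) <= M) -> nm (G 1 - G 0) <= 2 * M.
Proof.
move=> gG gM; apply: (@path_mean_value _ g).
- by move=> t /andP[/ltW t0 /ltW t1]; apply: gG; rewrite t0.
- by apply: within_derive_continuous => t /gG[] + _; apply.
- by apply: within_derive_continuous => t /gG[_ +]; apply.
- by move=> t /andP[/ltW t0 /ltW t1]; apply: gM; rewrite t0.
Qed.

(** The integral over [[0, 1]] is the increment of any primitive, with default value 0 if there is
    none. Linearity and changes of variable are thus statements on primitives. *)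
Definition path_integral (g : R -> C) : C :=
  xget 0 [set c | exists2 G, path_primitive g G & c = G 1 - G 0].

(** The difference of two primitives has derivative 0, so the mean value bound with [M = 0] shows
    that their increments agree. *)
Lemma path_integralE (g G : R -> C) : path_primitive g G ->
  path_integral g = G 1 - G 0.
Proof.
move=> gG; rewrite /path_integral; case: xgetP => [c _ [H gH ->]|]; last first.
  by move=> /(_ (G 1 - G 0)) []; exists G.
have : path_primitive (fun=> 0) (fun t => H t + (-1) * G t).
  move=> t t01; rewrite [X in pderive _ _ X](_ : _ = g t + (-1) * g t).
    by apply: pderiveD; [exact: gH|apply: pderiveZ; exact: gG].
  by rewrite mulN1r subrr.
move/(@path_primitive_bound _ _ 0); rewrite mulr0 nm0 => /(_ (fun _ _ => lexx _)).
rewrite le_eqVlt ltNge nm_ge0 orbF nm_eq0 => /eqP h.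
by apply/eqP; rewrite -subr_eq0 -[X in _ == X]h; apply/eqP; ring.
Qed.

Lemma path_primitive_exists (g : R -> C) : continuous g ->
  exists G, path_primitive g G.
Proof.
move=> cg; have cr t : {for t, continuous (Re \o g)} by have /cvg_ReIm[] := cg t.
have ci t : {for t, continuous (Im \o g)} by have /cvg_ReIm[] := cg t.
have [Gr hr] := continuous_primitive cr; have [Gi hi] := continuous_primitive ci.
by exists (fun t => (Gr t +i* Gi t)%C) => t t01; split; [exact: hr|exact: hi].
Qed.

End PathIntegral.

(** * Integrals over segments *)

Section SegmentIntegral.
Context {R : realType}.
Local Notation C := (cpx R).
Local Notation nm := (@Normc.normc R).
Implicit Types (f g : C -> C) (a b c z w : C).

Definition seg a b (t : R) : C := a + (t%:C)%C * (b - a).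

Definition segment_integral f a b : C :=
  (b - a) * path_integral (fun t => f (seg a b t)).
Local Notation I := segment_integral.

Definition midpoint a b : C := (a + b) / 2%:R.

Lemma seg0 a b : seg a b 0 = a.
Proof. by rewrite /seg mul0r addr0. Qed.

Lemma seg1 a b : seg a b 1 = b.
Proof. by rewrite /seg mul1r subrKC. Qed.

Lemma continuous_seg a b : continuous (seg a b : R -> C).
Proof.
move=> t; apply: (@cvgD _ _ R (nbhs t)); first exact: cvg_cst.
by apply: (@cvgM _ R (nbhs t)); [exact: continuous_real_complex|exact: cvg_cst].
Qed.

Lemma continuous_on_seg f a b : continuous f -> continuous (fun t : R => f (seg a b t)).
Proof.
move=> cf t; have ct := @continuous_seg a b t.
exact: (@cvg_comp _ _ _ (seg a b) f (nbhs t) (nbhs (seg a b t)) _ ct (cf _)).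
Qed.

Lemma seg_dist a b (t : R) : 0 <= t <= 1 -> nm (seg a b t - a) <= nm (b - a).
Proof.
move=> /andP[t0 t1]; rewrite /seg addrAC subrr add0r nmM nm_real ger0_norm//.
by rewrite ler_piMl// nm_ge0.
Qed.

Lemma segment_integral_FTC F f a b :
  (forall t : R, 0 <= t <= 1 -> is_derive (seg a b t) 1 F (f (seg a b t))) ->
  I f a b = F b - F a.
Proof.
move=> dF; rewrite /segment_integral; have [->|ab] := eqVneq a b.
  by rewrite !subrr mul0r.
have ba0 : b - a != 0 by rewrite subr_eq0 eq_sym.
rewrite (@path_integralE _ _ (fun t => (b - a)^-1 * F (seg a b t))).
  by rewrite seg0 seg1 -mulrBr mulVKf.
move=> t /dF dFt; rewrite [X in pderive _ _ X](_ : _ = (b - a)^-1 * (f (seg a b t) * (b - a))).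
  by apply: pderiveZ; exact: pderive_comp.
by rewrite mulrC mulfK.
Qed.

Lemma segment_integral_bound f a b (M : R) :
  continuous (fun t : R => f (seg a b t)) ->
  (forall t : R, 0 <= t <= 1 -> nm (f (seg a b t)) <= M) ->
  nm (I f a b) <= 2 * M * nm (b - a).
Proof.
move=> /path_primitive_exists[G fG] fM.
rewrite /segment_integral (path_integralE fG) nmM mulrC ler_wpM2r ?nm_ge0//.
exact: path_primitive_bound fG fM.
Qed.

Lemma eq_segment_integral f g a b :
  continuous (fun t : R => g (seg a b t)) ->
  (forall t : R, 0 <= t <= 1 -> f (seg a b t) = g (seg a b t)) ->
  I f a b = I g a b.
Proof.
move=> /path_primitive_exists[G gG] fg; rewrite /segment_integral (path_integralE gG).
by rewrite (@path_integralE _ _ G)// => t t01; rewrite fg//; exact: gG.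
Qed.

Lemma segment_integralD f g a b :
  continuous (fun t : R => f (seg a b t)) ->
  continuous (fun t : R => g (seg a b t)) ->
  I (fun w => f w + g w) a b = I f a b + I g a b.
Proof.
move=> /path_primitive_exists[F fF] /path_primitive_exists[G gG].
rewrite /segment_integral (path_integralE fF) (path_integralE gG).
rewrite (@path_integralE _ _ (fun t => F t + G t)); first by ring.
by move=> t t01; apply: pderiveD; [exact: fF|exact: gG].
Qed.

Lemma segment_integralZ k f a b :
  continuous (fun t : R => f (seg a b t)) ->
  I (fun w => k * f w) a b = k * I f a b.
Proof.
move=> /path_primitive_exists[F fF]; rewrite /segment_integral (path_integralE fF).
rewrite (@path_integralE _ _ (fun t => k * F t)); first by ring.
by move=> t t01; apply: pderiveZ; exact: fF.
Qed.

Lemma segment_integral_rev f a b :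
  continuous (fun t : R => f (seg a b t)) -> I f b a = - I f a b.
Proof.
move=> /path_primitive_exists[F fF]; rewrite /segment_integral (path_integralE fF).
rewrite (@path_integralE _ _ (fun t => (-1) * F (1 + (-1) * t))).
  by rewrite mulr1 mulr0 subrr addr0; ring.
move=> t /andP[t0 t1].
rewrite [X in pderive _ _ X](_ : _ = (-1) * (((-1)%:C)%C * f (seg a b (1 + -1 * t)))).
  by apply/pderiveZ/pderive_affine/fF; lra.
rewrite rmorphN1 mulrA mulrNN mulr1 mul1r; congr f.
by rewrite /seg mulN1r rmorphB /=; ring.
Qed.

Lemma segment_integral_mid f a b :
  continuous (fun t : R => f (seg a b t)) ->
  I f a b = I f a (midpoint a b) + I f (midpoint a b) b.
Proof.
move=> /path_primitive_exists[F fF]; rewrite /segment_integral (path_integralE fF).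
have half2 : ((2^-1 : R)%:C)%C = 2%:R^-1 :> C by rewrite rmorphV ?unitfE// rmorph_nat.
rewrite (@path_integralE _ _ (fun t => 2%:R * F (0 + 2^-1 * t))); last first.
  move=> t /andP[t0 t1].
  rewrite [X in pderive _ _ X](_ : _ = 2%:R * (((2^-1 : R)%:C)%C * f (seg a b (0 + 2^-1 * t)))).
    by apply/pderiveZ/pderive_affine/fF; lra.
  rewrite half2 mulVKf ?pnatr_eq0//; congr f.
  by rewrite /seg /midpoint add0r rmorphM /= half2; field.
rewrite (@path_integralE _ _ (fun t => 2%:R * F (2^-1 + 2^-1 * t))); last first.
  move=> t /andP[t0 t1].
  rewrite [X in pderive _ _ X](_ : _ = 2%:R * (((2^-1 : R)%:C)%C * f (seg a b (2^-1 + 2^-1 * t)))).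
    by apply/pderiveZ/pderive_affine/fF; lra.
  rewrite half2 mulVKf ?pnatr_eq0//; congr f.
  by rewrite /seg /midpoint rmorphD rmorphM /= half2; field.
rewrite !mulr0 !mulr1 !addr0 add0r.
rewrite (_ : 2^-1 + 2^-1 = 1 :> R); last by field.
by rewrite /midpoint; field.
Qed.

End SegmentIntegral.

(** * Goursat's lemma and Cauchy's formula *)

(** The intervals of centre [u n] and radius [2 * d / 2 ^+ n], the sum of the remaining increments,
    are nested; the supremum of their left ends lies in all of them. Goursat's estimate needs this
    explicit rate. *)
Lemma real_geometric_limit (R : realType) (u : nat -> R) (d : R) : 0 <= d ->
  (forall n, `|u n.+1 - u n| <= d / 2 ^+ n) ->
  exists l, forall n, `|u n - l| <= 2 * d / 2 ^+ n.
Proof.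
move=> d0 hu; pose v n := u n - 2 * d / 2 ^+ n; pose w n := u n + 2 * d / 2 ^+ n.
have e2 n : 2 * d / 2 ^+ n = 2 * (2 * d / 2 ^+ n.+1).
  by rewrite exprS invfM; field; rewrite expf_neq0.
have e1 n : d / 2 ^+ n = 2 * d / 2 ^+ n.+1.
  by rewrite exprS invfM; field; rewrite expf_neq0.
have vS n : v n <= v n.+1.
  by have := hu n; rewrite ler_norml /v (e1 n) (e2 n) => /andP[]; move: (2 * d / _) => k; lra.
have wS n : w n.+1 <= w n.
  by have := hu n; rewrite ler_norml /w (e1 n) (e2 n) => /andP[]; move: (2 * d / _) => k; lra.
have /nondecreasing_seqP vm := vS; have /nonincreasing_seqP wm := wS.
have vw n : v n <= w n.
  have : 0 <= 2 * d / 2 ^+ n by rewrite divr_ge0 ?mulr_ge0// exprn_ge0.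
  by rewrite /v /w; lra.
have vwm m n : v m <= w n.
  by apply: le_trans (vm _ _ (leq_maxl m n)) _; apply: le_trans (vw _) (wm _ _ (leq_maxr m n)).
exists (sup (range v)) => n.
have hs : has_sup (range v).
  by split; [exists (v 0), 0|exists (w 0) => _ [m _ <-]].
have := ub_le_sup hs.2 (imageT v n).
have : sup (range v) <= w n by apply: ge_sup hs.1 _ => _ [m _ <-].
move: (sup _) => s; rewrite /v /w ler_norml => h1 h2; apply/andP.
by split; lra.
Qed.

Lemma pow2_small (R : realType) (M e : R) : 0 < e -> exists n, M / 2 ^+ n < e.
Proof.
move=> e0; exists (Num.bound `|M / e|).
rewrite ltr_pdivrMr ?exprn_gt0// mulrC -ltr_pdivrMr//.
apply: le_lt_trans (ler_norm _) _; apply: lt_le_trans (archi_boundP (normr_ge0 _)) _.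
by rewrite -natrX ler_nat ltnW// ltn_expl.
Qed.

Section Goursat.
Context {R : realType}.
Local Notation C := (cpx R).
Local Notation nm := (@Normc.normc R).
Local Notation I := (@segment_integral R).
Implicit Types (f g : C -> C) (a b c z w : C).

Definition triangle_integral f a b c : C := I f a b + I f b c + I f c a.
Local Notation T := triangle_integral.

Definition perimeter a b c : R := nm (b - a) + nm (c - b) + nm (a - c).
Local Notation D := perimeter.

Lemma geometric_limit (u : nat -> C) (d : R) : 0 <= d ->
  (forall n, nm (u n.+1 - u n) <= d / 2 ^+ n) ->
  exists l, forall n, nm (u n - l) <= 4 * d / 2 ^+ n.
Proof.
move=> d0 hu.
have [|x hx] := @real_geometric_limit R (fun n => complex.Re (u n)) d d0.
  by move=> n; rewrite -ReN -ReD (le_trans (nm_Re _)).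
have [|y hy] := @real_geometric_limit R (fun n => complex.Im (u n)) d d0.
  by move=> n; rewrite -ImN -ImD (le_trans (nm_Im _)).
exists (x +i* y)%C => n; apply: le_trans (nm_ReIm _) _.
rewrite ReD ReN ImD ImN /=; apply: le_trans (lerD (hx n) (hy n)) _.
by rewrite -mulrDl ler_pM2r ?invr_gt0 ?exprn_gt0//; lra.
Qed.

Lemma perimeter_ge0 a b c : 0 <= D a b c.
Proof. by rewrite !addr_ge0 ?nm_ge0. Qed.

Lemma nm_half z : nm (z / 2%:R) = nm z / 2.
Proof. by rewrite nmM nmV; congr (_ / _); rewrite -(rmorph_nat (real_complex R)) nm_real normr_nat. Qed.

(** The solid triangle is replaced by the larger disc of centre [a] and radius twice the perimeter;
    the factor 2 in the conclusion comes from the bound on each side. *)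
Lemma triangle_integral_bound f a b c (M : R) : continuous f ->
  (forall w, nm (w - a) <= 2 * D a b c -> nm (f w) <= M) ->
  nm (T f a b c) <= 2 * M * D a b c.
Proof.
move=> cf hM.
have D0 : nm (b - a) <= D a b c by rewrite /D -addrA lerDl addr_ge0 ?nm_ge0.
have D1 : nm (b - a) + nm (c - b) <= D a b c by rewrite /D lerDl nm_ge0.
have D2 : nm (a - c) <= D a b c by rewrite /D lerDr addr_ge0 ?nm_ge0.
have D3 := perimeter_ge0 a b c.
have tr x y w : nm (w - x) <= nm (w - y) + nm (y - x).
  by rewrite -[w - x](_ : w - y + (y - x) = _) ?nmD//; ring.
apply: le_trans (nmD _ _) _; rewrite [leRHS]mulrDr; apply: lerD; last first.
  apply: segment_integral_bound; first exact: continuous_on_seg.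
  move=> t /(seg_dist c a) h; apply: hM; apply: le_trans (tr _ c _) _.
  by rewrite [nm (c - a)]nmB; lra.
apply: le_trans (nmD _ _) _; rewrite [leRHS]mulrDr; apply: lerD.
  apply: segment_integral_bound; first exact: continuous_on_seg.
  by move=> t /(seg_dist a b) h; apply: hM; lra.
apply: segment_integral_bound; first exact: continuous_on_seg.
move=> t /(seg_dist b c) h; apply: hM; apply: le_trans (tr _ b _) _.
by have := nm_ge0 (b - a); lra.
Qed.

Lemma triangle_integral_primitive F f a b c :
  (forall z, is_derive z 1 F (f z)) -> T f a b c = 0.
Proof.
move=> dF; rewrite /triangle_integral !(@segment_integral_FTC _ F)//.
by ring.
Qed.

Lemma triangle_integralD f g a b c : continuous f -> continuous g ->
  T (fun w => f w + g w) a b c = T f a b c + T g a b c.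
Proof.
move=> cf cg; rewrite /triangle_integral !segment_integralD; try exact: continuous_on_seg.
by ring.
Qed.

(** Joining the midpoints of the sides gives four triangles: every half side occurs once, and every
    inner segment twice with opposite orientations. *)
Lemma triangle_integral_subdivision f a b c : continuous f ->
  let m := midpoint a b in let n := midpoint c a in let p := midpoint b c in
  T f a b c = T f a m n + T f m b p + (T f n p c + T f m p n).
Proof.
move=> cf m n p; rewrite /triangle_integral.
have rev x y : I f y x = - I f x y by apply: segment_integral_rev; exact: continuous_on_seg.
have mid x y : I f x y = I f x (midpoint x y) + I f (midpoint x y) y.
  by apply: segment_integral_mid; exact: continuous_on_seg.
rewrite (mid a b) (mid b c) (mid c a) -/m -/n -/p.
by rewrite (rev m p) (rev n m) (rev p n); ring.
Qed.

(** One of the four triangles carries at least a quarter of the integral, and each has half the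
    perimeter. Stability of [K] under midpoints stands in for convexity, so that no solid triangle
    has to be described. *)
Lemma goursat_step f a b c : continuous f -> exists a' b' c' : C,
  [/\ nm (a' - a) <= D a b c, D a' b' c' = D a b c / 2,
      nm (T f a b c) / 4 <= nm (T f a' b' c') &
      forall K : set C, (forall x y, K x -> K y -> K (midpoint x y)) ->
        K a -> K b -> K c -> [/\ K a', K b' & K c']].
Proof.
move=> cf; have := triangle_integral_subdivision a b c cf.
set m := midpoint a b; set n := midpoint c a; set p := midpoint b c => /= Te.
have hm : nm (m - a) = nm (b - a) / 2 by rewrite -nm_half /m /midpoint; congr nm; field.
have hm' : nm (b - m) = nm (b - a) / 2 by rewrite -nm_half /m /midpoint; congr nm; field.
have hp : nm (p - b) = nm (c - b) / 2 by rewrite -nm_half /p /midpoint; congr nm; field.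
have hp' : nm (c - p) = nm (c - b) / 2 by rewrite -nm_half /p /midpoint; congr nm; field.
have hn : nm (n - c) = nm (a - c) / 2 by rewrite -nm_half /n /midpoint; congr nm; field.
have hn' : nm (a - n) = nm (a - c) / 2 by rewrite -nm_half /n /midpoint; congr nm; field.
have hmn : nm (n - m) = nm (c - b) / 2 by rewrite -nm_half /n /m /midpoint; congr nm; field.
have hpm : nm (m - p) = nm (a - c) / 2 by rewrite -nm_half /p /m /midpoint; congr nm; field.
have hnp : nm (p - n) = nm (b - a) / 2 by rewrite -nm_half /p /n /midpoint; congr nm; field.
have Dba := nm_ge0 (b - a); have Dcb := nm_ge0 (c - b); have Dac := nm_ge0 (a - c).
have : nm (T f a b c) <= nm (T f a m n) + nm (T f m b p) + (nm (T f n p c) + nm (T f m p n)).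
  rewrite Te; apply: le_trans (nmD _ _) _; apply: lerD; exact: nmD.
have [h1 _|h1] := leP (nm (T f a b c) / 4) (nm (T f a m n)).
  exists a, m, n; split => //.
  - by rewrite subrr nm0 perimeter_ge0.
  - by rewrite /perimeter hm hmn hn'; lra.
  - by move=> K hK Ka Kb Kc; split=> //; exact: hK.
have [h2 _|h2] := leP (nm (T f a b c) / 4) (nm (T f m b p)).
  exists m, b, p; split => //.
  - by rewrite /perimeter hm; lra.
  - by rewrite /perimeter hm' hp hpm; lra.
  - by move=> K hK Ka Kb Kc; split=> //; exact: hK.
have [h3 _|h3] := leP (nm (T f a b c) / 4) (nm (T f n p c)).
  exists n, p, c; split => //.
  - by rewrite /perimeter nmB hn'; lra.
  - by rewrite /perimeter hnp hp' hn; lra.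
  - by move=> K hK Ka Kb Kc; split=> //; exact: hK.
have [h4 _|h4] := leP (nm (T f a b c) / 4) (nm (T f m p n)).
  exists m, p, n; split => //.
  - by rewrite /perimeter hm; lra.
  - by rewrite /perimeter [nm (p - m)]nmB hpm [nm (n - p)]nmB hnp [nm (m - n)]nmB hmn; lra.
  - by move=> K hK Ka Kb Kc; split=> //; exact: hK.
by lra.
Qed.

(** The triangles chosen successively shrink to a point [z0], which lies in [K] because [K] is
    closed. There [f] is affine up to a remainder of order less than one; its integral over the
    [n]-th triangle is small compared with [4 ^- n], contradicting the lower bound [uT]. *)
Lemma goursat f (K : set C) a b c : continuous f -> closed K ->
  (forall x y, K x -> K y -> K (midpoint x y)) ->
  (forall z, K z -> derivable f z 1) ->
  K a -> K b -> K c -> T f a b c = 0.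
Proof.
move=> cf clK Kmid df Ka Kb Kc.
pose P (x y : C * C * C) := [/\ nm (y.1.1 - x.1.1) <= D x.1.1 x.1.2 x.2,
  D y.1.1 y.1.2 y.2 = D x.1.1 x.1.2 x.2 / 2,
  nm (T f x.1.1 x.1.2 x.2) / 4 <= nm (T f y.1.1 y.1.2 y.2) &
  K x.1.1 -> K x.1.2 -> K x.2 -> [/\ K y.1.1, K y.1.2 & K y.2]].
have /choice[g hg] x : exists y, P x y.
  case: x => -[x y] z; have [x' [y' [z' [h1 h2 h3 h4]]]] := goursat_step x y z cf.
  by exists (x', y', z'); split => //=; exact: h4.
pose u n := iter n g (a, b, c).
pose A n := (u n).1.1; pose B n := (u n).1.2; pose E n := (u n).2.
have uK n : [/\ K (A n), K (B n) & K (E n)].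
  by elim: n => [//|n [h1 h2 h3]]; have [_ _ _] := hg (u n); exact.
have uD n : D (A n) (B n) (E n) = D a b c / 2 ^+ n.
  elim: n => [|n ih]; first by rewrite expr0 divr1.
  have [_ + _ _] := hg (u n); rewrite -/(A n) -/(B n) -/(E n) ih => hD.
  by rewrite [LHS]hD exprS invfM mulrCA mulrC.
have uT n : nm (T f a b c) / 4 ^+ n <= nm (T f (A n) (B n) (E n)).
  elim: n => [|n ih]; first by rewrite expr0 divr1.
  have [_ _ + _] := hg (u n); apply: le_trans.
  by rewrite exprSr invfM mulrA ler_pM2r ?invr_gt0.
have D0 := perimeter_ge0 a b c.
have [z0 hz0] : exists l, forall n, nm (A n - l) <= 4 * D a b c / 2 ^+ n.
  by apply: geometric_limit => // n; rewrite -uD; have [] := hg (u n).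
have Kz0 : K z0.
  apply: contrapT => nK; have /nbhs_nmP[d d0 dK] : nbhs z0 (~` K).
    by apply: open_nbhs_nbhs; split=> //; exact: closed_openC.
  have [n hn] := pow2_small (4 * D a b c) d0; have [KA _ _] := uK n.
  by apply: dK KA; exact: le_lt_trans (hz0 n) hn.
apply/eqP; rewrite -nm_eq0 eq_le nm_ge0 andbT leNgt; apply/negP => T0.
(* On the [n]-th triangle [nm (w - z0)] is at most [(2 + 4) * D1 / 2 ^+ n], so the remainder
   integrates to at most [12 * e * D1 ^+ 2 / 4 ^+ n]. This [e] makes the bound smaller than
   [nm (T f a b c) / 4 ^+ n]; the summand 1 covers [D1 = 0]. *)
pose D1 := D a b c; pose e := nm (T f a b c) / (2 * (6 * D1 ^+ 2 + 1)).
have D1p : 0 < 6 * D1 ^+ 2 + 1 by rewrite ltr_wpDl// mulr_ge0// sqr_ge0.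
have e0 : 0 < e by rewrite divr_gt0// mulr_gt0.
have /derivableP/caratheodoryP[q [qc _ fq]] := df _ Kz0.
have /continuous_nmP/(_ e e0)[d d0 hd] := qc.
have [n hn] := pow2_small (6 * D1) d0.
(* The subtracted affine function has a primitive, so [r] and [f] have the same integral over every
   triangle. *)
pose r w := f w + (- (f z0) - (w - z0) * q z0).
have cl : continuous (fun w : C => - (f z0) - (w - z0) * q z0).
  move=> w; apply: (@cvgB _ _ C (nbhs w)); first exact: cvg_cst.
  apply: (@cvgM _ C (nbhs w)); last exact: cvg_cst.
  by apply: (@cvgB _ _ C (nbhs w)); [exact: cvg_id|exact: cvg_cst].
have Tr : T r (A n) (B n) (E n) = T f (A n) (B n) (E n).
  rewrite triangle_integralD// [X in _ + X](_ : _ = 0) ?addr0//.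
  apply: (@triangle_integral_primitive (fun w => - (f z0) * w - (w - z0) ^+ 2 / 2%:R * q z0)) => z.
  apply/caratheodoryP; exists (fun w => - f z0 - (w + z - 2%:R * z0) / 2%:R * q z0).
  split; last by move=> w; field.
    apply: (@cvgB _ _ C (nbhs z)); first exact: cvg_cst.
    apply: (@cvgM _ C (nbhs z)); last exact: cvg_cst.
    apply: (@cvgM _ C (nbhs z)); last exact: cvg_cst.
    apply: (@cvgB _ _ C (nbhs z)); last exact: cvg_cst.
    by apply: (@cvgD _ _ C (nbhs z)); [exact: cvg_id|exact: cvg_cst].
  by field.
have rE w : r w = (w - z0) * (q w - q z0) by rewrite /r fq; ring.
have cr : continuous r by move=> w; apply: (@cvgD _ _ C (nbhs w)); [exact: cf|exact: cl].
have Dn0 : 0 <= D1 / 2 ^+ n by rewrite divr_ge0 ?exprn_ge0.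
have := uT n; rewrite -Tr; apply/negP; rewrite -ltNge.
have := @triangle_integral_bound r (A n) (B n) (E n) (6 * (D1 / 2 ^+ n) * e) cr.
rewrite uD -/D1 => /(_ _)/le_lt_trans; apply.
  move=> w wA; have wz : nm (w - z0) <= 6 * (D1 / 2 ^+ n).
    rewrite -[w - z0](subrKA (A n)); apply: le_trans (nmD _ _) _.
    have := hz0 n; rewrite -/D1 -mulrA; lra.
  rewrite rE nmM ler_pM ?nm_ge0//; apply/ltW/hd/(le_lt_trans wz).
  by rewrite mulrA.
rewrite (_ : 4 ^+ n = 2 ^+ n * 2 ^+ n :> R); last first.
  by rewrite -exprMn -natrM.
rewrite ltr_pdivlMr ?mulr_gt0 ?exprn_gt0//.
rewrite (_ : _ * _ = 12 * e * D1 ^+ 2); last by field; rewrite expf_neq0.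
have -> : nm (T f a b c) = e * (2 * (6 * D1 ^+ 2 + 1)) by rewrite /e divfK// gt_eqF// mulr_gt0.
by have := sqr_ge0 D1; nra.
Qed.

End Goursat.

(** * Primitives on a disc with an exceptional point *)

Section DiscPrimitive.
Context {R : realType}.
Local Notation C := (cpx R).
Local Notation nm := (@Normc.normc R).
Local Notation Re := (@complex.Re R).
Local Notation I := (@segment_integral R).
Local Notation T := (@triangle_integral R).
Implicit Types (f g : C -> C) (a b c z w : C).

Lemma is_derive_nmP (F : C -> C) z d :
  (forall e : R, 0 < e -> exists2 r : R, 0 < r & forall w, nm (w - z) < r ->
     nm (F w - F z - (w - z) * d) <= e * nm (w - z)) ->
  is_derive z 1 F d.
Proof.
move=> h; apply/caratheodoryP.
exists (fun w => if w == z then d else (w - z)^-1 * (F w - F z)); split; last first.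
- move=> w; case: eqVneq => [->|wz]; first by rewrite subrr mul0r addr0.
  by rewrite mulVKf ?subr_eq0// subrKC.
- by rewrite eqxx.
apply/continuous_nmP => e e0; have e20 : 0 < e / 2 by rewrite divr_gt0.
have [r r0 hr] := h _ e20; exists r => // w /hr; rewrite eqxx.
case: eqVneq => [_ _|wz]; first by rewrite subrr nm0.
have wz0 : 0 < nm (w - z) by rewrite nm_gt0 subr_eq0.
move=> hw; apply: (@le_lt_trans _ _ (e / 2)); last by lra.
rewrite -(ler_pM2r wz0); apply: le_trans hw; rewrite -nmM.
by rewrite mulrBl mulrAC mulVf ?subr_eq0// mul1r [d * _]mulrC.
Qed.

Lemma continuous_nm : continuous (nm : C -> R).
Proof.
move=> z; apply/(@cvgrPdist_lt _ _ _ (nbhs z)) => e e0; apply/nbhs_nmP; exists e => // w.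
apply: le_lt_trans; rewrite ler_norml; apply/andP; split.
  by have := nmD (w - z) z; rewrite subrK; lra.
by have := nmD (z - w) w; rewrite subrK nmB; lra.
Qed.

(** For [0 < d] the half plane stays away from [z], while the disc bounds the region where [f] is
    known to be derivable. This is the convex set to which Goursat's lemma is applied when [z] is
    exceptional. *)
Lemma closed_half_disc (m z : C) (r d : R) :
  closed [set w : C | nm w <= r /\ d <= Re (m * (w - z))].
Proof.
rewrite (_ : [set w : C | _] = ((nm : C -> R) @^-1` [set x | x <= r]) `&`
    ((fun w : C => Re (m * (w - z))) @^-1` [set x | d <= x])) //.
apply: closedI.
  by apply: (proj1 (continuous_closedP _) continuous_nm); exact: closed_le.
apply: (proj1 (continuous_closedP _) _); last exact: closed_ge.
move=> w; apply: (@cvg_comp _ _ _ (fun w : C => m * (w - z)) Re (nbhs w) _ _ _ (@continuous_Re R _)).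
apply: (@cvgM _ C (nbhs w)); first exact: cvg_cst.
by apply: (@cvgB _ _ C (nbhs w)); [exact: cvg_id|exact: cvg_cst].
Qed.

Lemma nm_midpoint (r : R) a b : nm a <= r -> nm b <= r -> nm (midpoint a b) <= r.
Proof.
move=> ar br; rewrite /midpoint nm_half ler_pdivrMr//.
by apply: le_trans (nmD _ _) _; lra.
Qed.

Lemma ReMr (x : R) (w : C) : Re ((x%:C)%C * w) = x * Re w.
Proof. by case: w => u v /=; rewrite mul0r subr0. Qed.

Lemma Re_midpoint (m z a b : C) :
  Re (m * (midpoint a b - z)) = (Re (m * (a - z)) + Re (m * (b - z))) / 2.
Proof.
have half2 : 2%:R^-1 = ((2^-1 : R)%:C)%C :> C by rewrite rmorphV ?unitfE// rmorph_nat.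
rewrite (_ : m * _ = 2%:R^-1 * (m * (a - z) + m * (b - z))); last first.
  by rewrite /midpoint; field.
by rewrite half2 ReMr ReD mulrC.
Qed.

Lemma midpointC a b : midpoint a b = midpoint b a.
Proof. by rewrite /midpoint addrC. Qed.

Section ExceptionalVertex.
Variables (f : C -> C) (r : R) (z m : C).
Hypothesis cf : continuous f.
Hypothesis df : forall w, nm w <= r -> w != z -> derivable f w 1.
Hypothesis zr : nm z <= r.

(** Of the four triangles of the subdivision, only the one with vertex [z] meets the exceptional
    point; the other three lie in a closed half disc that avoids it. *)
Lemma goursat_halving a b : nm a <= r -> nm b <= r ->
  0 < Re (m * (a - z)) -> 0 < Re (m * (b - z)) ->
  T f z a b = T f z (midpoint z a) (midpoint z b).
Proof.
move=> ar br az bz; rewrite (triangle_integral_subdivision z a b cf) (midpointC b z).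
have Rzz : Re (m * (z - z)) = 0 by rewrite subrr mulr0.
(* The midpoints of [z a] and [z b] have half the height of [a] and [b] above the line through [z],
   whence the division by 2. *)
pose d := Order.min (Re (m * (a - z))) (Re (m * (b - z))) / 2.
have d0 : 0 < d by rewrite divr_gt0// lt_min az bz.
have da : d <= Re (m * (a - z)) / 2 by rewrite ler_pM2r// ge_min lexx.
have db : d <= Re (m * (b - z)) / 2 by rewrite ler_pM2r// ge_min lexx orbT.
pose K := [set w : C | nm w <= r /\ d <= Re (m * (w - z))].
have G x y w : K x -> K y -> K w -> T f x y w = 0.
  apply: goursat => //; first exact: closed_half_disc.
    move=> u v [ur ud] [vr vd]; split; first exact: nm_midpoint.
    by rewrite Re_midpoint; lra.
  move=> u [ur ud]; apply: df => //; apply: contraTneq ud => ->.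
  by rewrite Rzz -ltNge.
have Ka : K a by split=> //; lra.
have Kb : K b by split=> //; lra.
have Kza : K (midpoint z a) by split; [exact: nm_midpoint|rewrite Re_midpoint Rzz; lra].
have Kzb : K (midpoint z b) by split; [exact: nm_midpoint|rewrite Re_midpoint Rzz; lra].
have Kab : K (midpoint a b) by split; [exact: nm_midpoint|rewrite Re_midpoint; lra].
by rewrite (G _ _ _ Kza Ka Kab) (G _ _ _ Kzb Kab Kb) (G _ _ _ Kza Kab Kzb) !addr0.
Qed.

Lemma goursat_shrinking n a b : nm a <= r -> nm b <= r ->
  0 < Re (m * (a - z)) -> 0 < Re (m * (b - z)) ->
  exists a' b', [/\ T f z a b = T f z a' b', nm (a' - z) = nm (a - z) / 2 ^+ n &
                    nm (b' - z) = nm (b - z) / 2 ^+ n].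
Proof.
elim: n a b => [|n ih] a b ar br az bz; first by exists a, b; rewrite expr0 !divr1.
have half x : nm (midpoint z x - z) = nm (x - z) / 2.
  by rewrite -nm_half /midpoint; congr nm; field.
have Rzz : Re (m * (z - z)) = 0 by rewrite subrr mulr0.
have [||||a' [b' [E ha hb]]] := ih (midpoint z a) (midpoint z b).
- exact: nm_midpoint.
- exact: nm_midpoint.
- by rewrite Re_midpoint Rzz; lra.
- by rewrite Re_midpoint Rzz; lra.
exists a', b'; split; first by rewrite goursat_halving.
- by rewrite ha half exprS invfM mulrA.
- by rewrite hb half exprS invfM mulrA.
Qed.

(** Halving does not change the integral, whereas the perimeter tends to 0 and [f] is bounded by
    [nm (f z) + 1] near [z]. Continuity at [z] is all that is used there. *)
Lemma goursat_exceptional_vertex a b : nm a <= r -> nm b <= r ->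
  0 < Re (m * (a - z)) -> 0 < Re (m * (b - z)) -> T f z a b = 0.
Proof.
move=> ar br az bz; apply/eqP; rewrite -nm_eq0 eq_le nm_ge0 andbT leNgt.
apply/negP => T0; pose P := 2 * (nm (a - z) + nm (b - z)).
have P0 : 0 <= P by rewrite mulr_ge0// addr_ge0 ?nm_ge0.
pose M := nm (f z) + 1.
have M0 : 0 < M by rewrite ltr_wpDl// nm_ge0.
have /continuous_nmP/(_ 1 ltr01)[d d0 hd] := @cf z.
have e0 : 0 < Order.min d (nm (T f z a b) / M) by rewrite lt_min d0 divr_gt0.
have [n hn] := pow2_small (2 * P) e0.
have [a' [b' [E ha hb]]] := goursat_shrinking n ar br az bz.
have pP : perimeter z a' b' <= P / 2 ^+ n.
  rewrite /perimeter [nm (z - b')]nmB.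
  have := nmD (b' - z) (z - a'); rewrite subrKA [nm (z - a')]nmB.
  have -> : P / 2 ^+ n = 2 * (nm (a' - z) + nm (b' - z)).
    by rewrite ha hb /P; field; rewrite expf_neq0.
  by lra.
have P2 : 2 * (P / 2 ^+ n) < Order.min d (nm (T f z a b) / M) by rewrite mulrA.
move: P2; rewrite lt_min => /andP[Pd PT].
have := @triangle_integral_bound R f z a' b' M cf.
rewrite -E => /(_ _)/le_lt_trans h.
suff : nm (T f z a b) < nm (T f z a b) by rewrite ltxx.
apply: h.
  move=> w wz; have : nm (f w - f z) < 1 by apply: hd; lra.
  have := nmD (f w - f z) (f z); rewrite subrK /M; lra.
move: PT; rewrite ltr_pdivlMr// => PT; apply: le_lt_trans PT.
by rewrite -mulrA [leRHS]mulrC mulrCA ler_pM2l// ler_pM2l.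
Qed.

End ExceptionalVertex.

Lemma segment_integral_cst c a b : I (fun=> c) a b = (b - a) * c.
Proof.
have dw (z : C) : is_derive z 1 (fun w : C => w * c) c.
  apply/caratheodoryP; exists (fun=> c); split => //; first exact: (@cst_continuous C C).
  by move=> w; ring.
by rewrite (@segment_integral_FTC R _ (fun=> c) a b (fun t _ => dw _)) mulrBl.
Qed.

(** The exceptional point is the centre, from which all the segments start. It is thus met only as a
    vertex of the triangles [0 z w]. *)
Lemma disc_primitive f (r : R) : continuous f ->
  (forall w, nm w < r -> w != 0 -> derivable f w 1) ->
  forall z, nm z < r -> is_derive z 1 (I f 0) (f z).
Proof.
move=> cf df z zr; apply: is_derive_nmP => e e0.
have e20 : 0 < e / 2 by rewrite divr_gt0.
have /continuous_nmP/(_ _ e20)[d d0 hd] := cf z.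
have cs g a b : continuous g -> continuous (fun t : R => g (seg a b t)).
  exact: continuous_on_seg.
pose s := (nm z + r) / 2.
have [k k0 hk] : exists2 k : R, 0 < k & forall w, nm (w - z) < k ->
    I f 0 w - I f 0 z = I f z w.
  have [->|z0] := eqVneq z 0.
    by exists 1 => // w _; rewrite {2}/segment_integral subrr mul0r subr0.
  have zp : 0 < nm z by rewrite nm_gt0.
  exists (Order.min (s - nm z) (nm z)); first by rewrite lt_min zp andbT /s; lra.
  move=> w; rewrite lt_min => /andP[ws wz].
  (* With [m] the conjugate of [z], the condition [0 < Re (m * w)] puts [w] on the same side as [z]
     of the line through 0 orthogonal to [z]; it holds as soon as [nm (w - z) < nm z]. *)
  have Rz : Re (z^*%C * z) = nm z ^+ 2.
    by case: (z) => x y /=; rewrite sqr_sqrtr ?addr_ge0 ?sqr_ge0//; ring.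
  have : T f 0 z w = 0.
    apply: (@goursat_exceptional_vertex f s 0 z^*%C) => //.
    - by move=> u us; apply: df; apply: le_lt_trans us _; rewrite /s; lra.
    - by rewrite nm0 /s; lra.
    - by rewrite /s; lra.
    - by have := nmD (w - z) z; rewrite subrK; lra.
    - by rewrite subr0 Rz exprn_gt0.
    - rewrite subr0 -[w](subrK z) mulrDr ReD Rz.
      have := nm_Re (z^*%C * (w - z)); rewrite ler_norml => /andP[+ _].
      have -> : nm (z^*%C * (w - z)) = nm z * nm (w - z).
        by rewrite nmM; congr (_ * _); case: (z) => x y /=; rewrite sqrrN.
      have : nm z * nm (w - z) < nm z * nm z by rewrite ltr_pM2l.
      by rewrite expr2; lra.
  rewrite /triangle_integral (@segment_integral_rev _ f 0 w); last exact: cs.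
  move=> h; apply/eqP; rewrite -subr_eq0 -oppr_eq0; apply/eqP; rewrite -[RHS]h.
  by ring.
exists (Order.min k d); first by rewrite lt_min k0.
move=> w; rewrite lt_min => /andP[/hk -> wd].
have -> : I f z w - (w - z) * f z = I (fun x => f x + - f z) z w.
  rewrite (@segment_integralD _ f (fun=> - f z)).
  - by rewrite segment_integral_cst mulrN.
  - exact: cs.
  - by move=> t; exact: cvg_cst.
apply: le_trans (@segment_integral_bound _ _ _ _ (e / 2) _ _) _.
- by apply: (cs (fun x => f x - f z)) => x; apply: (@cvgB _ _ C (nbhs x)); [exact: cf|exact: cvg_cst].
- by move=> t /(seg_dist z w) h; apply/ltW/hd/(le_lt_trans h).
- by rewrite mulrCA divff// mulr1.
Qed.

End DiscPrimitive.

(** * Continuous extension from a disc to the plane *)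

Section Extension.
Context {R : realType}.
Local Notation C := (cpx R).
Local Notation nm := (@Normc.normc R).
Local Notation Re := (@complex.Re R).
Local Notation Im := (@complex.Im R).

Definition clamp (s t : R) : R := Order.max (- s) (Order.min s t).

Lemma clamp_bound (s t : R) : 0 <= s -> `|clamp s t| <= s.
Proof.
by move=> s0; rewrite ler_norml /clamp le_max lexx /= ge_max ge_min lexx /= andbT; lra.
Qed.

Lemma clamp_id (s t : R) : `|t| <= s -> clamp s t = t.
Proof.
by rewrite ler_norml /clamp => /andP[st ts]; rewrite min_r// max_r.
Qed.

Lemma continuous_clamp (s : R) : continuous (clamp s).
Proof.
move=> t; apply: (@continuous_max R R (cst (- s)) (cst s \min id)).
  exact: cst_continuous.
apply: (@continuous_min R R (cst s) id); first exact: cst_continuous.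
exact: cvg_id.
Qed.

(** The integration lemmas ask for continuity on the whole plane, so [f] is composed with the
    retraction onto the square of half side [r / 4]. That square lies in the disc of radius [r], as
    the modulus is at most the sum of the absolute values of the two parts, and contains the disc of
    radius [r / 4]. *)
Lemma disc_extension (f : C -> C) (r : R) : 0 < r ->
  (forall z, nm z < r -> {for z, continuous f}) ->
  exists2 F : C -> C, continuous F & forall z, nm z < r / 4 -> F z = f z.
Proof.
move=> r0 cf; pose s := r / 4.
have s0 : 0 <= s by rewrite /s; lra.
pose rho (z : C) : C := (clamp s (Re z) +i* clamp s (Im z))%C.
have crho : continuous rho.
  move=> z; apply/(@cvg_ReIm R C (nbhs z)); split.
    exact: (@cvg_comp _ _ _ Re (clamp s) (nbhs z) (nbhs (Re z)) _ (@continuous_Re R z) (@continuous_clamp s _)).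
  exact: (@cvg_comp _ _ _ Im (clamp s) (nbhs z) (nbhs (Im z)) _ (@continuous_Im R z) (@continuous_clamp s _)).
exists (f \o rho).
  move=> z; apply: continuous_comp; first exact: crho.
  apply: cf; apply: le_lt_trans (nm_ReIm _) _; rewrite /rho /=.
  have := clamp_bound (Re z) s0; have := clamp_bound (Im z) s0; rewrite /s; lra.
move=> z zs /=; congr f; apply: cpx_eq; rewrite /rho /= clamp_id//.
  by apply/ltW/(le_lt_trans (nm_Re _)).
by apply/ltW/(le_lt_trans (nm_Im _)).
Qed.

End Extension.

(** * The Cauchy kernel on the edges of a square *)

Section Cauchy.
Context {R : realType}.
Local Notation C := (cpx R).
Local Notation nm := (@Normc.normc R).
Local Notation Re := (@complex.Re R).
Local Notation Im := (@complex.Im R).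
Local Notation I := (@segment_integral R).
Local Notation T := (@triangle_integral R).
Implicit Types (f g : C -> C) (a b c z w : C).

Lemma cvg_expr (U : Type) (F : set_system U) (FF : Filter F) (h : U -> C) a n :
  h u @[u --> F] --> a -> h u ^+ n @[u --> F] --> a ^+ n.
Proof.
move=> ha; elim: n => [|n ih]; first exact: cvg_cst.
rewrite exprS (_ : (fun u => _) = (fun u => h u * h u ^+ n)).
  exact: (@cvgM C U F FF h (fun u => h u ^+ n) a (a ^+ n) ha ih).
by apply/funext => u; rewrite exprS.
Qed.

(** Differentiation under the integral sign: a second-order remainder that is uniform along the
    segment integrates to a second-order remainder. *)
Lemma segment_integral_parameter (K K1 : C -> C -> C) (a b z : C) (r B : R) :
  0 < r -> 0 <= B ->
  (forall z', nm (z' - z) < r -> continuous (fun t : R => K z' (seg a b t))) ->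
  continuous (fun t : R => K1 z (seg a b t)) ->
  (forall z' (t : R), nm (z' - z) < r -> 0 <= t <= 1 ->
     nm (K z' (seg a b t) - K z (seg a b t) - (z' - z) * K1 z (seg a b t)) <=
       B * nm (z' - z) ^+ 2) ->
  is_derive z 1 (fun x => I (K x) a b) (I (K1 z) a b).
Proof.
move=> r0 B0 cK cK1 hB; apply: is_derive_nmP => e e0.
have ab0 := nm_ge0 (b - a).
pose k := 2 * B * nm (b - a) + 1.
have k0 : 0 < k by rewrite ltr_wpDl// !mulr_ge0.
exists (Order.min r (e / k)); first by rewrite lt_min r0 divr_gt0.
move=> z'; rewrite lt_min => /andP[zr ze].
have cKz : continuous (fun t : R => K z (seg a b t)) by apply: cK; rewrite subrr nm0.
have cK1' : continuous (fun t : R => - (z' - z) * K1 z (seg a b t)).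
  by move=> t; apply: (@cvgM _ R (nbhs t)); [exact: cvg_cst|exact: cK1].
have cKz' : continuous (fun t : R => (-1) * K z (seg a b t)).
  by move=> t; apply: (@cvgM _ R (nbhs t)); [exact: cvg_cst|exact: cKz].
have cD : continuous (fun t : R => (-1) * K z (seg a b t) + - (z' - z) * K1 z (seg a b t)).
  by move=> t; apply: (@cvgD _ _ R (nbhs t)); [exact: cKz'|exact: cK1'].
have cDD : continuous (fun t : R => K z' (seg a b t) +
    ((-1) * K z (seg a b t) + - (z' - z) * K1 z (seg a b t))).
  by move=> t; apply: (@cvgD _ _ R (nbhs t)); [exact: cK|exact: cD].
have e1 := @segment_integralD _ (K z') (fun w => (-1) * K z w + - (z' - z) * K1 z w)
  _ _ (cK _ zr) cD.
have e2 := @segment_integralD _ (fun w => (-1) * K z w) (fun w => - (z' - z) * K1 z w)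
  _ _ cKz' cK1'.
have e3 := @segment_integralZ _ (-1) _ _ _ cKz.
have e4 := @segment_integralZ _ (- (z' - z)) _ _ _ cK1.
rewrite (_ : I (K z') a b - I (K z) a b - (z' - z) * I (K1 z) a b =
    I (fun w => K z' w + ((-1) * K z w + - (z' - z) * K1 z w)) a b); last first.
  by rewrite e1 e2 e3 e4; ring.
apply: le_trans (segment_integral_bound (M := B * nm (z' - z) ^+ 2) cDD _) _.
  move=> t t01; rewrite [X in nm X](_ : _ = K z' (seg a b t) - K z (seg a b t) - (z' - z) * K1 z (seg a b t)).
    exact: hB.
  by ring.
rewrite expr2; move: ze; rewrite ltr_pdivlMr// /k => ze.
have := nm_ge0 (z' - z); set x := nm _ in ze * => x0; nra.
Qed.

Definition iC : C := (0 +i* 1)%C.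

Lemma iC2 : iC * iC = -1.
Proof. by apply: cpx_eq; rewrite ?ReM ?ImM /=; ring. Qed.

Lemma nm_iCX k : nm (iC ^+ k) = 1.
Proof.
elim: k => [|k ih]; first by rewrite expr0 nm1.
by rewrite exprS nmM ih mulr1 /= expr0n expr1n add0r sqrtr1.
Qed.

Section Square.
Variable s : R.
Hypothesis s0 : 0 < s.

(** The corners of a square inscribed in the circle of radius [s]. Multiplication by [iC] rotates
    each edge to the next, so one argument with index [k] serves all four. *)
Definition vertex (k : nat) : C := (s%:C)%C * iC ^+ k.
Local Notation v := vertex.

Lemma vertex4 : v 4 = v 0.
Proof. by rewrite /v (exprM iC 2 2) [iC ^+ 2]expr2 iC2 sqrrN expr1n expr0. Qed.

Lemma nm_vertex k : nm (v k) = s.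
Proof. by rewrite /v nmM nm_iCX mulr1 nm_real ger0_norm// ltW. Qed.

Lemma seg_vertex k (t : R) : seg (v k) (v k.+1) t = v k * (1 + (t%:C)%C * (iC - 1)).
Proof. by rewrite /seg /v exprS; ring. Qed.

(** After division by [v k], a point of the line carrying the edge has real and imaginary parts of
    sum 1, hence modulus at least 1/2. This holds for all real [t], which makes the kernels
    continuous on the whole real line. *)
Lemma edge_far k (t : R) z : nm z < s / 4 -> s / 4 < nm (seg (v k) (v k.+1) t - z).
Proof.
move=> zs; have : s / 2 <= nm (seg (v k) (v k.+1) t).
  rewrite seg_vertex nmM nm_vertex ler_pM2l//.
  set w := (X in nm X); have : Re w + Im w = 1.
    by rewrite /w /=; ring.
  have := nm_Re w; have := nm_Im w; rewrite !ler_norml => /andP[_ +] /andP[_]; lra.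
have := nmD (seg (v k) (v k.+1) t - z) z; rewrite subrK; lra.
Qed.

Lemma edge_neq0 k (t : R) z : nm z < s / 4 -> seg (v k) (v k.+1) t - z != 0.
Proof.
by move=> /(edge_far k t) h; rewrite -nm_gt0; apply: lt_trans h; rewrite divr_gt0.
Qed.

Section CauchyKernel.
Variables (phi : C -> C) (k : nat).
Hypothesis cphi : continuous phi.

Lemma continuous_cauchy_kernel n c z : nm z < s / 4 ->
  continuous (fun t : R => c * (phi (seg (v k) (v k.+1) t) *
                                (seg (v k) (v k.+1) t - z)^-1 ^+ n)).
Proof.
move=> zs t; apply: (@cvgM _ R (nbhs t)); first exact: cvg_cst.
apply: (@cvgM _ R (nbhs t)); first exact: continuous_on_seg.
apply: cvg_expr; apply: (@cvgV _ R (nbhs t)); first exact: edge_neq0.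
by apply: (@cvgB _ _ R (nbhs t)); [exact: continuous_seg|exact: cvg_cst].
Qed.

Lemma edge_bounded : exists2 M : R, 0 <= M &
  forall t : R, 0 <= t <= 1 -> nm (phi (seg (v k) (v k.+1) t)) <= M.
Proof.
have cn : {within `[0, 1], continuous (fun t : R => nm (phi (seg (v k) (v k.+1) t)))}.
  apply: continuous_subspaceT => t.
  apply: (@cvg_comp _ _ _ (fun t : R => phi (seg (v k) (v k.+1) t)) (nm : C -> R) (nbhs t) _ _ _ (@continuous_nm R _)).
  exact: continuous_on_seg.
have [c _ hc] := EVT_max ler01 cn.
exists (nm (phi (seg (v k) (v k.+1) c))); first exact: nm_ge0.
by move=> t t01; apply: hc; rewrite in_itv.
Qed.

(** With [x] and [y] the inverses of [w - z] and [w - z'], two applications of the resolvent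
    identity [y - x = (z' - z) * x * y] exhibit the factor [(z' - z) ^+ 2] of the remainder. The
    exponents 1 and 2 yield the first and the second derivative of a Cauchy transform. *)
Lemma is_derive_cauchy_kernel n z : (n == 1%N) || (n == 2%N) -> nm z < s / 4 ->
  is_derive z 1
    (fun x => I (fun w => 1 * (phi w * (w - x)^-1 ^+ n)) (v k) (v k.+1))
    (I (fun w => n%:R * (phi w * (w - z)^-1 ^+ n.+1)) (v k) (v k.+1)).
Proof.
move=> n12 zs; have [M M0 hM] := edge_bounded.
have B0 : 0 < 4 / s by rewrite divr_gt0.
have near z' : nm (z' - z) < s / 4 - nm z -> nm z' < s / 4.
  by have := nmD (z' - z) z; rewrite subrK; lra.
apply: (@segment_integral_parameter (fun x w => 1 * (phi w * (w - x)^-1 ^+ n))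
  (fun x w => n%:R * (phi w * (w - x)^-1 ^+ n.+1)) _ _ _ (s / 4 - nm z)
  (M * (4 / s) ^+ 3 * (1 + 3 * (4 / s)))).
- by lra.
- by apply: mulr_ge0; [rewrite mulr_ge0// exprn_ge0 ?(ltW B0)|move: B0; lra].
- by move=> z' /near z's; exact: continuous_cauchy_kernel.
- exact: continuous_cauchy_kernel.
move=> z' t /near z's t01; move: (hM t t01).
have := edge_far k t z's; have := edge_far k t zs.
have := edge_neq0 k t z's; have := edge_neq0 k t zs.
move: (seg _ _ _) => w wz wz' fz fz' pM.
set x := (w - z)^-1; set y := (w - z')^-1.
have inv4 : (s / 4)^-1 = 4 / s by rewrite invf_div.
have s4 : 0 < s / 4 by rewrite divr_gt0.
have xB : nm x <= 4 / s.
  by rewrite /x nmV -inv4 lef_pV2 ?posrE//; [exact: ltW|exact: lt_trans fz].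
have yB : nm y <= 4 / s.
  by rewrite /y nmV -inv4 lef_pV2 ?posrE//; [exact: ltW|exact: lt_trans fz'].
have yx : y = x + (z' - z) * x * y.
  by rewrite /x /y; field; rewrite wz wz'.
(* [Q] is 1 for exponent 1 and [2 x + y] for exponent 2; since [x] and [y] are bounded by [4 / s],
   one bound covers both. *)
have [Q QE QB] : exists2 Q, y ^+ n - x ^+ n - n%:R * (z' - z) * x ^+ n.+1 =
    (z' - z) ^+ 2 * (x ^+ 2 * y * Q) & nm Q <= 1 + 3 * (4 / s).
  case/orP: n12 => /eqP ->.
    exists 1; last by rewrite nm1 lerDl mulr_ge0// ltW.
    rewrite !expr1 mul1r mulr1.
    by rewrite (_ : y - x = (z' - z) * x * y); [rewrite {1}yx; ring|rewrite {1}yx; ring].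
  exists (2%:R * x + y).
    rewrite (_ : y ^+ 2 - x ^+ 2 = ((z' - z) * x * y) * (y + x)); last first.
      by rewrite -[in RHS](_ : y - x = (z' - z) * x * y); [ring|rewrite {1}yx; ring].
    have -> : (z' - z) * x * y * (y + x) - 2%:R * (z' - z) * x ^+ 3 =
        (z' - z) * x * (y * (y - x) + 2%:R * x * (y - x)) by ring.
    have -> : y - x = (z' - z) * x * y by rewrite {1}yx; ring.
    by ring.
  apply: le_trans (nmD _ _) _; rewrite nmM -(rmorph_nat (real_complex R)) nm_real normr_nat.
  by lra.
rewrite (_ : _ - _ = phi w * ((z' - z) ^+ 2 * (x ^+ 2 * y * Q))); last first.
  by rewrite -QE /x /y; ring.
have P1 : nm (x ^+ 2 * y * Q) <= (4 / s) ^+ 3 * (1 + 3 * (4 / s)).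
  rewrite nmM ler_pM ?nm_ge0// [_ ^+ 3]exprSr nmM ler_pM ?nm_ge0//.
  by rewrite !expr2 nmM ler_pM ?nm_ge0.
have -> : nm (phi w * ((z' - z) ^+ 2 * (x ^+ 2 * y * Q))) =
    nm (phi w) * nm (x ^+ 2 * y * Q) * nm (z' - z) ^+ 2.
  rewrite nmM (nmM ((z' - z) ^+ 2)) [(z' - z) ^+ 2]expr2 (nmM (z' - z)).
  by ring.
rewrite -[M * _ * _]mulrA ler_wpM2r ?sqr_ge0//.
by rewrite ler_pM ?nm_ge0.
Qed.

End CauchyKernel.
End Square.
End Cauchy.

(** * Cauchy's formula and second derivatives *)

Section CauchyFormula.
Context {R : realType}.
Local Notation C := (cpx R).
Local Notation nm := (@Normc.normc R).
Local Notation Re := (@complex.Re R).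
Local Notation Im := (@complex.Im R).
Local Notation I := (@segment_integral R).
Local Notation T := (@triangle_integral R).
Implicit Types (f g : C -> C) (a b c z w : C).

(** The part of analyticity used later. It is stable under products and inverses, so it passes from
    Cauchy transforms to their quotients. *)
Definition twice_derivable (F : C -> C) (r : R) : Prop :=
  exists F1 : C -> C, forall z, nm z < r -> is_derive z 1 F (F1 z) /\ derivable F1 z 1.

Lemma is_derive_derivable f z d : is_derive z 1 f d -> derivable f z 1.
Proof. by case. Qed.

Lemma twice_derivableM F G r : twice_derivable F r -> twice_derivable G r ->
  twice_derivable (fun z => F z * G z) r.
Proof.
move=> [F1 dF] [G1 dG]; exists (fun z => F z * G1 z + G z * F1 z) => z zr.
have [FF1 dF1] := dF z zr; have [GG1 dG1] := dG z zr; split.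
  exact: (is_deriveM FF1 GG1).
exact: (is_derive_derivable (is_deriveD
  (is_deriveM FF1 (derivableP dG1)) (is_deriveM GG1 (derivableP dF1)))).
Qed.

Lemma is_derive_inv (F : C -> C) z d : F z != 0 -> is_derive z 1 F d ->
  is_derive z 1 (fun w => (F w)^-1) (- (F z) ^- 2 * d).
Proof.
move=> Fz [dF <-]; apply: DeriveDef; first exact: derivableV.
exact: deriveV.
Qed.

Lemma twice_derivableV (F : C -> C) r : (forall z, nm z < r -> F z != 0) ->
  twice_derivable F r -> twice_derivable (fun z => (F z)^-1) r.
Proof.
move=> F0 [F1 dF]; exists (fun z => (F z)^-1 * ((F z)^-1 * (- F1 z))) => z zr.
have [FF1 dF1] := dF z zr.
have Fz := F0 z zr.
have dV := is_derive_inv Fz FF1.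
split.
  have e : - F z ^- 2 * F1 z = (F z)^-1 * ((F z)^-1 * (- F1 z)) by field.
  by rewrite -e.
have dN := is_deriveN (derivableP dF1).
have dM := is_deriveM dV dN.
have dMM := is_deriveM dV dM.
exact: is_derive_derivable dMM.
Qed.

Lemma near_twice_derivable (F G : C -> C) r : 0 < r -> (forall z, nm z < r -> F z = G z) ->
  twice_derivable F r -> twice_derivable G r.
Proof.
move=> r0 FG [F1 dF]; exists F1 => z zr; have [FF1 dF1] := dF z zr.
split; last exact: dF1.
apply: near_eq_is_derive FF1; apply/nbhs_nmP; exists (r - nm z); first by lra.
by move=> w wz; apply: FG; have := nmD (w - z) z; rewrite subrK; lra.
Qed.

Section Transform.
Variable s : R.
Hypothesis s0 : 0 < s.
Local Notation v := (vertex s).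

Definition contour_integral (K : C -> C) : C :=
  (I K (v 0) (v 1) + I K (v 1) (v 2)) + (I K (v 2) (v 3) + I K (v 3) (v 4)).

(* With the factor [1], the derivative [n%:R * _] of the kernel of exponent
   [n = 1] is, by conversion, the kernel of exponent [2]. *)
Definition cauchy_transform (n : nat) (phi : C -> C) (z : C) : C :=
  contour_integral (fun w => 1 * (phi w * (w - z)^-1 ^+ n)).

Lemma twice_derivable_cauchy_transform phi : continuous phi ->
  twice_derivable (cauchy_transform 1 phi) (s / 4).
Proof.
move=> cphi; exists (cauchy_transform 2 phi) => z zs; split.
  have d k := is_derive_cauchy_kernel s0 k cphi (n := 1) isT zs.
  exact: (is_deriveD (is_deriveD (d 0%N) (d 1%N)) (is_deriveD (d 2%N) (d 3%N))).
have d k := is_derive_cauchy_kernel s0 k cphi (n := 2) isT zs.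
exact: (is_derive_derivable
  (is_deriveD (is_deriveD (d 0%N) (d 1%N)) (is_deriveD (d 2%N) (d 3%N)))).
Qed.

(** Together with [derivable_slope], this places the slope of [f] at [z] in the setting of Goursat's
    lemma with exceptional point [z]. *)
Lemma continuous_slope f z q : continuous f -> {for z, continuous q} ->
  (forall w, f w = f z + (w - z) * q w) -> continuous q.
Proof.
move=> cf qz fq w; have [->|wz] := eqVneq w z; first exact: qz.
have wz0 : w - z != 0 by rewrite subr_eq0.
have qE x : x != z -> q x = (x - z)^-1 * (f x - f z).
  by move=> xz; rewrite (fq x) [f z + _ - _]addrAC subrr add0r mulKf// subr_eq0.
have: (x - z)^-1 * (f x - f z) @[x --> w] --> q w.
  rewrite (qE _ wz).
  apply: (@cvgM _ C (nbhs w)).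
    apply: (@cvgV _ C (nbhs w)) => //.
    by apply: (@cvgB _ _ C (nbhs w)); [exact: cvg_id|exact: cvg_cst].
  by apply: (@cvgB _ _ C (nbhs w)); [exact: cf|exact: cvg_cst].
apply: cvg_trans; apply: (@near_eq_cvg _ _ (nbhs w)).
apply/nbhs_nmP; exists (nm (w - z)); first by rewrite nm_gt0.
move=> x xw; rewrite qE//; apply: contraTneq xw => ->.
by rewrite nmB ltxx.
Qed.

Lemma derivable_slope f z w q : w != z -> derivable f w 1 ->
  (forall w, f w = f z + (w - z) * q w) -> derivable q w 1.
Proof.
move=> wz dfw fq; have wz0 : w - z != 0 by rewrite subr_eq0.
have dB : is_derive w 1 (fun x => x - z) (1 - 0).
  exact: (is_deriveB (is_derive_id _ _) (is_derive_cst _ _ _)).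
have dfB := is_deriveB (derivableP dfw) (is_derive_cst (f z) w 1).
have := is_derive_derivable (is_deriveM (@is_derive_inv (fun x => x - z) w _ wz0 dB) dfB).
apply: near_eq_derivable; apply/nbhs_nmP; exists (nm (w - z)); first by rewrite nm_gt0.
move=> x xw; have xz : x != z by apply: contraTneq xw => ->; rewrite nmB ltxx.
by change ((x - z)^-1 * (f x - f z) = q x); rewrite (fq x) [f z + _ - _]addrAC subrr add0r mulKf// subr_eq0.
Qed.

(** The contour is the sum of the boundaries of the four triangles with apex [z] over the edges; the
    inner sides cancel. *)
Lemma contour_exceptional q z : nm z < s / 4 -> continuous q ->
  (forall w, nm w <= s -> w != z -> derivable q w 1) -> contour_integral q = 0.
Proof.
move=> zs cq dq; have Tk k : T q z (v k) (v k.+1) = 0.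
  have vs j : nm (v j) <= s by rewrite nm_vertex.
  have zs' : nm z <= s by have := s0; move: zs; lra.
  (* Up to conjugation [m] is normal to the [k]-th edge: [Re (m * w)] equals [s] at both of its
     ends, whereas it is less than [s / 2] at [z], because [nm m <= 2] and [nm z < s / 4]. *)
  pose m : C := (- iC) ^+ k * (1 - iC).
  have mi : (- iC) ^+ k * iC ^+ k = 1 :> C by rewrite -exprMn mulNr iC2 opprK expr1n.
  have nmm : nm m <= 2.
    rewrite /m nmM exprNn nmM.
    have -> : nm ((-1) ^+ k : C) = 1 by rewrite -signr_odd; case: odd; rewrite ?expr1 ?nmN nm1.
    rewrite nm_iCX !mul1r; apply: le_trans (nmD _ _) _; rewrite nmN nm1.
    by rewrite -(expr1 iC) nm_iCX; lra.
  have mz : Re (m * z) < s / 2.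
    apply: le_lt_trans (ler_norm _) _; apply: le_lt_trans (nm_Re _) _.
    rewrite nmM; apply: (@le_lt_trans _ _ (2 * nm z)); last by move: zs; lra.
    by rewrite ler_wpM2r ?nm_ge0.
  apply: (@goursat_exceptional_vertex R q s z m cq dq zs' _ _ (vs _) (vs _)).
    rewrite (_ : m * (v k - z) = ((s%:C)%C * (1 - iC)) - m * z); last first.
      by rewrite /m /vertex mulrBr; congr (_ - _); rewrite -[RHS]mulr1 -mi; ring.
    by rewrite ReD ReN ReMr /=; have := s0; move: mz; lra.
  rewrite (_ : m * (v k.+1 - z) = ((s%:C)%C * (iC * (1 - iC))) - m * z); last first.
    by rewrite /m /vertex mulrBr exprS; congr (_ - _); rewrite -[RHS]mulr1 -mi; ring.
  have -> : iC * (1 - iC) = 1 + iC :> C by rewrite mulrBr iC2; ring.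
  by rewrite ReD ReN ReMr /=; have := s0; move: mz; lra.
have := Tk 0%N; have := Tk 1%N; have := Tk 2%N; have := Tk 3%N.
have rev k : I q (v k) z = - I q z (v k).
  by apply: segment_integral_rev; exact: continuous_on_seg.
rewrite /triangle_integral /contour_integral !rev (vertex4 s) => h3 h2 h1 h0.
have := congr2 +%R (congr2 +%R h0 h1) (congr2 +%R h2 h3).
by rewrite !addr0 => <-; ring.
Qed.

(** On the contour [f w / (w - z)] is [q w + f z / (w - z)] with [q] the slope of [f] at [z], and
    the integral of [q] vanishes. *)
Lemma cauchy_formula f z : continuous f ->
  (forall w, nm w <= s -> derivable f w 1) -> nm z < s / 4 ->
  cauchy_transform 1 f z = f z * cauchy_transform 1 (fun=> 1) z.
Proof.
move=> cf df zs; have zs' : nm z <= s by have := s0; move: zs; lra.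
have /derivableP/caratheodoryP[q [qc _ fq]] := df z zs'.
have cq := continuous_slope cf qc fq.
have q0 := contour_exceptional zs cq (fun w ws wz => derivable_slope wz (df w ws) fq).
have edge k : I q (v k) (v k.+1) =
    I (fun w => 1 * (f w * (w - z)^-1 ^+ 1)) (v k) (v k.+1) +
    - f z * I (fun w => 1 * (1 * (w - z)^-1 ^+ 1)) (v k) (v k.+1).
  have c1 := @continuous_cauchy_kernel R s s0 f k cf 1 1 z zs.
  have c2 := @continuous_cauchy_kernel R s s0 (fun=> 1) k (@cst_continuous C C 1) 1 1 z zs.
  have c3 : continuous (fun t : R => - f z * (1 * (1 * (seg (v k) (v k.+1) t - z)^-1 ^+ 1))).
    by move=> t; apply: (@cvgM _ R (nbhs t)); [exact: cvg_cst|exact: c2].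
  pose h1 w := 1 * (f w * (w - z)^-1 ^+ 1) : C.
  pose h2 w := 1 * (1 * (w - z)^-1 ^+ 1) : C.
  have e2 : I (fun w => - f z * h2 w) (v k) (v k.+1) = - f z * I h2 (v k) (v k.+1).
    exact: (@segment_integralZ _ (- f z) h2 _ _ c2).
  have e1 : I (fun w => h1 w + - f z * h2 w) (v k) (v k.+1) =
      I h1 (v k) (v k.+1) + I (fun w => - f z * h2 w) (v k) (v k.+1).
    exact: (@segment_integralD _ h1 (fun w => - f z * h2 w) _ _ c1 c3).
  rewrite -/h1 -/h2 -e2 -e1.
  apply: eq_segment_integral.
    by move=> t; apply: (@cvgD _ _ R (nbhs t)); [exact: c1|exact: c3].
  move=> t _; have := edge_neq0 s0 k t zs; set w := seg _ _ _ => wz.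
  by rewrite /h1 /h2 (fq w) !expr1; field.
move: q0; rewrite /contour_integral !edge /cauchy_transform /contour_integral => h.
by apply/eqP; rewrite -subr_eq0 -[X in _ == X]h; apply/eqP; ring.
Qed.

(** By rotation the four edges contribute the same number. By the mean value theorem its imaginary
    part is a value of [((1 - t) ^+ 2 + t ^+ 2)^-1], hence positive. *)
Lemma cauchy_transform1_neq0 : cauchy_transform 1 (fun=> 1) 0 != 0.
Proof.
pose l (t : R) : C := 1 + (t%:C)%C * (iC - 1).
have lE t : l t = Complex (1 - t) t.
  by apply: cpx_eq; rewrite /l /=; ring.
have n0 (t : R) : (1 - t) ^+ 2 + t ^+ 2 != 0.
  by rewrite gt_eqF//; have := sqr_ge0 (1 - t); have := sqr_ge0 t; nra.
have l0 t : l t != 0.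
  apply/eqP => h; have := congr1 Re h; have := congr1 Im h; rewrite lE /= => ->.
  by lra.
have cl : continuous (fun t => (l t)^-1 : C).
  move=> t; apply: (@cvgV _ R (nbhs t)) => //.
  apply: (@cvgD _ _ R (nbhs t)); first exact: cvg_cst.
  by apply: (@cvgM _ R (nbhs t)); [exact: continuous_real_complex|exact: cvg_cst].
have [H lH] := path_primitive_exists cl.
have edge k : I (fun w => 1 * (1 * (w - 0)^-1 ^+ 1)) (v k) (v k.+1) =
    (iC - 1) * (H 1 - H 0).
  have vk : v k != 0 by rewrite -nm_gt0 nm_vertex.
  have vE : v k.+1 - v k = v k * (iC - 1) by rewrite /vertex exprS; ring.
  rewrite /segment_integral (@path_integralE _ _ (fun t => (v k)^-1 * H t)).
    by rewrite vE -mulrBr [v k * _]mulrC -mulrA mulVKf.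
  move=> t t01; rewrite [X in pderive _ _ X](_ : _ = (v k)^-1 * (l t)^-1).
    by apply: pderiveZ; exact: lH.
  by rewrite !mul1r subr0 expr1 seg_vertex invfM.
rewrite /cauchy_transform /contour_integral !edge.
have dH (t : R) : 0 <= t <= 1 -> pderive (fun s => (iC - 1) * H s) t ((iC - 1) * (l t)^-1).
  by move=> t01; apply: pderiveZ; exact: lH.
have ci : {within `[0, 1], continuous (Im \o (fun s => (iC - 1) * H s))}.
  by apply: within_derive_continuous => t /dH[_ +]; apply.
have [t t01 Ht0] := real_mean_value (fun t (t01 : 0 < t < 1) =>
   (dH t (andb_true_intro (conj (ltW (andP t01).1) (ltW (andP t01).2)))).2) ci.
have Ht : Im ((iC - 1) * (H 1 - H 0)) = Im ((iC - 1) * (Complex (1 - t) t)^-1).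
  by rewrite mulrBr ImD ImN -lE; exact: Ht0.
apply/eqP => /(congr1 Im); rewrite !ImD Ht /= => h.
move: h; have := n0 t; set n := _ + _ => nn0.
have n_gt0 : 0 < n by rewrite lt_neqAle eq_sym nn0 /n addr_ge0 ?sqr_ge0.
have -> : (0 - 1) * - (t / n) + (1 - 0) * ((1 - t) / n) = n^-1 by field.
have : 0 < n^-1 by rewrite invr_gt0.
by lra.
Qed.

End Transform.

(* The Cauchy transforms of [f] and [1] are differentiable under the integral
   sign, and [f] is their quotient; the value [2 i pi] of the second one is not
   needed. *)
Theorem holomorphic_twice_derivable f (r : R) : 0 < r ->
  (forall z, nm z < r -> derivable f z 1) ->
  exists2 r', 0 < r' & twice_derivable f r'.
Proof.
move=> r0 df.
have cf z : nm z < r -> {for z, continuous f}.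
  by move=> /df/derivableP; exact: is_derive_continuous.
have [F cF Ff] := disc_extension r0 cf.
(* The extension [F] agrees with [f] only on the disc of radius [r / 4]; the contour, of
   circumradius [r / 8], stays strictly inside it. *)
pose s := r / 8; have s0 : 0 < s by rewrite divr_gt0.
have dF w : nm w <= s -> derivable F w 1.
  move=> ws; apply: (near_eq_derivable _ (df w _)); last by move: ws; rewrite /s; lra.
  apply/nbhs_nmP; exists (r / 4 - nm w); first by move: ws; rewrite /s; lra.
  by move=> x xw; rewrite Ff//; have := nmD (x - w) w; rewrite subrK; lra.
pose J0 := cauchy_transform s 1 (fun=> 1).
have [J1 dJ] := twice_derivable_cauchy_transform s0 (@cst_continuous C C 1).
have cJ : {for 0, continuous J0}.
  by apply: (is_derive_continuous (dJ 0 _).1); rewrite nm0 divr_gt0.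
have J00 : 0 < nm (J0 0) by rewrite nm_gt0; exact: cauchy_transform1_neq0.
have /continuous_nmP/(_ _ J00)[d d0 hd] := cJ.
pose r' := Order.min d (s / 4).
have r'0 : 0 < r' by rewrite lt_min d0 divr_gt0.
exists r' => //.
have J0n z : nm z < r' -> J0 z != 0.
  rewrite lt_min => /andP[zd _]; apply/eqP => Jz.
  by have := hd z; rewrite subr0 => /(_ zd); rewrite Jz sub0r nmN ltxx.
have sub G : twice_derivable G (s / 4) -> twice_derivable G r'.
  by move=> [G1 dG]; exists G1 => z; rewrite lt_min => /andP[_ /dG].
apply: (@near_twice_derivable (fun z => cauchy_transform s 1 F z * (J0 z)^-1)) => //.
  move=> z zr'; move: (zr'); rewrite lt_min => /andP[_ zs].
  rewrite (cauchy_formula s0 cF dF zs) mulfK ?J0n// Ff//.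
  by move: zs s0; rewrite /s; lra.
apply: twice_derivableM; first exact/sub/twice_derivable_cauchy_transform.
apply: twice_derivableV => //.
exact/sub/twice_derivable_cauchy_transform/cst_continuous.
Qed.

End CauchyFormula.

(** * The equation [z u' = a u] *)

Section LogarithmicEquation.
Context {R : realType}.
Local Notation C := (cpx R).
Local Notation nm := (@Normc.normc R).
Local Notation Re := (@complex.Re R).
Local Notation Im := (@complex.Im R).
Local Notation I := (@segment_integral R).
Implicit Types (f g : C -> C) (a b c z w : C).

Lemma is_derive_nmE f z d : is_derive z 1 f d -> forall e : R, 0 < e ->
  exists2 r : R, 0 < r & forall w, nm (w - z) < r ->
    nm (f w - f z - (w - z) * d) <= e * nm (w - z).
Proof.
move=> /caratheodoryP[q [qc <- fq]] e e0.
have /continuous_nmP/(_ e e0)[r r0 hr] := qc.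
exists r => // w wr; have -> : f w - f z - (w - z) * q z = (q w - q z) * (w - z).
  by rewrite (fq w); ring.
by rewrite nmM ler_wpM2r ?nm_ge0// ltW// hr.
Qed.

Lemma segment_mean_value f (df : C -> C) a b (M : R) :
  (forall t : R, 0 <= t <= 1 -> is_derive (seg a b t) 1 f (df (seg a b t))) ->
  (forall t : R, 0 <= t <= 1 -> nm (df (seg a b t)) <= M) ->
  nm (f b - f a) <= 2 * (M * nm (b - a)).
Proof.
move=> fd dM.
have := @path_primitive_bound R (fun t => df (seg a b t) * (b - a))
  (fun t => f (seg a b t)) (M * nm (b - a)).
rewrite seg0 seg1; apply.
  by move=> t t01; apply: pderive_comp; exact: fd.
by move=> t t01; rewrite nmM ler_wpM2r ?nm_ge0 ?dM.
Qed.

(** Removable singularity: by Taylor's formula of order two, [f z / z] is also derivable at 0, with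
    derivative half the second derivative of [f]. It serves to divide a holomorphic function by the
    local coordinate at a zero. *)
Lemma derivable_slope0 f (r : R) : 0 < r -> twice_derivable f r -> f 0 = 0 ->
  exists q : C -> C, [/\ forall w, f w = w * q w, is_derive (0 : C) 1 f (q 0) &
    forall w, nm w < r -> derivable q w 1].
Proof.
move=> r0 [f1 df] f0; have n0r : nm (0 : C) < r by rewrite nm0.
have [ff1 /derivableP df1] := df _ n0r; move: df1; set d := 'D_1 f1 0 => df1.
have /caratheodoryP[q [qc q0 fq]] := ff1.
have fE w : f w = w * q w by rewrite fq f0 add0r subr0.
exists q; split; [exact: fE|by rewrite q0|].
move=> w wr; have [->|w0] := eqVneq w 0; last first.
  by apply: (derivable_slope w0 _ fq); apply: is_derive_derivable (df w wr).1.
apply: (@is_derive_derivable _ _ _ (d / 2%:R)); apply: is_derive_nmP => e e0.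
have e20 : 0 < e / 2 by rewrite divr_gt0.
have [k k0 hk] := is_derive_nmE df1 e20.
exists (Order.min k r); first by rewrite lt_min k0.
move=> x; rewrite subr0 lt_min => /andP[xk xr].
have [->|x0] := eqVneq x 0; first by rewrite subrr mul0r subr0 nm0 mulr0.
(* The derivative of [h] is the first-order remainder of [f1] at 0, at most [e / 2 * nm x] on the
   segment. The mean value bound gives [e * nm x ^+ 2], and division by [x] gives the remainder of
   [q]. *)
pose h y := f y + - (f1 0 * y + d / 2%:R * (y * y)).
have hd (y : C) : nm y < r -> is_derive y 1 h (f1 y - f1 0 - (y - 0) * d).
  move=> yr; have [fy _] := df y yr.
  have i := @is_derive_id C C y 1.
  apply: is_derive_eq (is_deriveD fy (is_deriveN (is_deriveD
    (is_deriveM (is_derive_cst (f1 0) y 1) i)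
    (is_deriveM (is_derive_cst (d / 2%:R) y 1) (is_deriveM i i))))) _.
  by rewrite /GRing.scale /=; field.
have s0 (t : R) : 0 <= t <= 1 -> nm (seg 0 x t) <= nm x.
  by move=> /(seg_dist 0 x); rewrite !subr0.
have := @segment_mean_value h (fun y => f1 y - f1 0 - (y - 0) * d) 0 x (e / 2 * nm x).
have -> : h x - h 0 = x * (q x - q 0 - x * (d / 2%:R)).
  by rewrite /h f0 (fE x) q0; ring.
rewrite subr0 nmM => mv; rewrite -(ler_pM2l (_ : 0 < nm x)) ?nm_gt0//.
apply: le_trans (mv _ _) _.
- by move=> t /s0 h1; apply: hd; exact: le_lt_trans xr.
- move=> t /s0 h1; apply: le_trans (hk _ _) _; rewrite subr0; first exact: le_lt_trans xk.
  by rewrite ler_pM2l.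
by rewrite le_eqVlt; apply/orP; left; apply/eqP; field.
Qed.

(** * The complex exponential and functions with zero derivative *)

Definition cexp (z : C) : C := ((expR (Re z))%:C)%C * Complex (cos (Im z)) (sin (Im z)).

Lemma cexp0 : cexp 0 = 1.
Proof. by rewrite /cexp /= expR0 cos0 sin0 mul1r. Qed.

Lemma cexpD z w : cexp (z + w) = cexp z * cexp w.
Proof.
rewrite /cexp ReD ImD expRD cosD sinD rmorphM /=.
set x := expR _; set y := expR _.
rewrite (_ : Complex _ _ = Complex (cos (Im z)) (sin (Im z)) *
  Complex (cos (Im w)) (sin (Im w))); first by ring.
by apply: cpx_eq; rewrite /=; ring.
Qed.

Lemma cexp_neq0 z : cexp z != 0.
Proof.
apply/eqP => h; have := cexpD z (- z); rewrite h subrr cexp0 mul0r => /eqP.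
by rewrite oner_eq0.
Qed.

(** The slopes [P], [K], [S] of [expR], [cos], [sin] at 0 are close to 1, 0, 1, and [cexp w - 1 - w]
    is a combination of [P - 1], [K], [S - 1] and products with a small factor. The other points
    follow by the addition formula. *)
Lemma is_derive_cexp0 : is_derive (0 : C) 1 cexp 1.
Proof.
have /caratheodoryP[p [pc p0 ep]] := is_derive_expR (0 : R).
have /caratheodoryP[c [cc c0 ec]] := is_derive_cos (0 : R).
have /caratheodoryP[s [sc s0 es]] := is_derive_sin (0 : R).
have {}ep x : expR x = 1 + x * p x by rewrite ep expR0 subr0.
have {}ec x : cos x = 1 + x * c x by rewrite ec cos0 subr0.
have {}es x : sin x = x * s x by rewrite es sin0 subr0 add0r.
rewrite expR0 in p0; rewrite sin0 oppr0 in c0; rewrite cos0 in s0.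
(* The three contributions below are [n * d], [n * (3 * d)] and [n * (5 * d)], in all [9 * d * n];
   [d <= 1] gives the bounds 2 on [P] and [S] and 1 on [K]. *)
apply: is_derive_nmP => e e0_; pose d := Order.min 1 (e / 9).
have d0 : 0 < d by rewrite lt_min ltr01 divr_gt0.
have d1 : d <= 1 by rewrite ge_min lexx.
have d9 : d <= e / 9 by rewrite ge_min lexx orbT.
clearbody d.
have close (h : R -> R) l : {for 0, continuous h} -> h 0 = l ->
    exists2 k : R, 0 < k & forall x, `|x| < k -> `|h x - l| < d.
  move=> /(@cvgrPdist_lt _ _ _ (nbhs (0 : R)))/(_ d d0)/nbhs_normP[k k0 hk] <-.
  by exists k => // x xk; rewrite distrC; apply: hk; rewrite /= sub0r normrN.
have [k1 k1p hp] := close _ _ pc p0; have [k2 k2p hc] := close _ _ cc c0.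
have [k3 k3p hs] := close _ _ sc s0.
exists (Order.min (Order.min k1 k2) (Order.min k3 d)); first by rewrite !lt_min k1p k2p k3p d0.
move=> w; rewrite !subr0 mulr1 cexp0 !lt_min => /andP[/andP[w1 w2] /andP[w3 wd]].
have xw := nm_Re w; have yw := nm_Im w.
have := hp (Re w) (le_lt_trans xw w1); have := hc (Im w) (le_lt_trans yw w2).
have := hs (Im w) (le_lt_trans yw w3); have := le_lt_trans xw wd.
rewrite /cexp ep ec es subr0; move: xw yw (p _) (c _) (s _) => + + P K S.
have n0 := nm_ge0 w.
have -> : (((1 + Re w * P)%:C)%C * Complex (1 + Im w * K) (Im w * S) - 1 - w : C) =
   Complex (Re w * (P - 1) + Im w * (K + Re w * P * K)) (Im w * (S - 1 + Re w * P * S)).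
  by apply: cpx_eq; rewrite /=; case: (w) => u v /=; ring.
move: (Re w) (Im w) (nm w) n0 => x y n n0 xn yn xd Sd Kd Pd.
apply: le_trans (nm_ReIm _) _ => /=.
have P2 : `|P| <= 2 by rewrite -[P](subrK 1); apply: le_trans (ler_normD _ _) _; rewrite normr1; lra.
have S2 : `|S| <= 2 by rewrite -[S](subrK 1); apply: le_trans (ler_normD _ _) _; rewrite normr1; lra.
have xP : `|x * P| <= 2 * d by rewrite normrM mulrC ler_pM// ltW.
have t1 : `|x * (P - 1)| <= n * d by rewrite normrM ler_pM// ltW.
have t2 : `|y * (K + x * P * K)| <= n * (3 * d).
  rewrite normrM ler_pM//; apply: le_trans (ler_normD _ _) _; rewrite [`|x * P * K|]normrM.
  have : `|x * P| * `|K| <= 2 * d * 1 by rewrite ler_pM//; apply/ltW/(lt_le_trans Kd).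
  by lra.
have t3 : `|y * (S - 1 + x * P * S)| <= n * (5 * d).
  rewrite normrM ler_pM//; apply: le_trans (ler_normD _ _) _; rewrite [`|x * P * S|]normrM.
  have : `|x * P| * `|S| <= 2 * d * 2 by rewrite ler_pM//.
  by lra.
apply: le_trans (lerD (le_trans (ler_normD _ _) (lerD t1 t2)) t3) _.
rewrite -!mulrDr mulrC ler_wpM2r//; lra.
Qed.

Lemma is_derive_cexp z : is_derive z 1 cexp (cexp z).
Proof.
have dB : is_derive z 1 (fun x => x - z) (1 - 0).
  exact: (is_deriveB (is_derive_id _ _) (is_derive_cst _ _ _)).
have d0 : is_derive (z - z) 1 cexp 1 by rewrite subrr; exact: is_derive_cexp0.
have := @is_derive_comp C cexp (fun x => x - z) z _ _ d0 dB.
rewrite mul1r subr0 => dc.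
have dM := is_deriveM (is_derive_cst (cexp z) z 1) dc.
have E : cst (cexp z) * (cexp \o (fun x => x - z)) = cexp.
  by apply/funext => x; rewrite -[in RHS](subrKC z x) cexpD.
rewrite E in dM; apply: is_derive_eq dM _.
by rewrite /GRing.scale /= mulr1 mulr0 addr0.
Qed.

(* [u = exp G] with [G] a primitive of [a z / z]; the quotient is continuous at
   [0] and holomorphic elsewhere, which is enough for the existence of [G]. *)
Lemma logarithmic_equation (a : C -> C) (r : R) : 0 < r ->
  (forall z, nm z < r -> derivable a z 1) -> a 0 = 0 ->
  exists2 r', 0 < r' & exists u : C -> C, forall z, nm z < r' ->
    u z != 0 /\ exists2 d, is_derive z 1 u d & z * d = a z * u z.
Proof.
move=> r0 da a0; have n0r : nm (0 : C) < r by rewrite nm0.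
have /derivableP/caratheodoryP[q [qc _ aq]] := da _ n0r.
have aE w : a w = w * q w by rewrite aq a0 add0r subr0.
have dq w : w != 0 -> nm w < r -> derivable q w 1.
  by move=> w0 wr; apply: (derivable_slope w0 (da w wr) aq).
have cq w : nm w < r -> {for w, continuous q}.
  move=> wr; have [->//|w0] := eqVneq w 0.
  by have /derivableP := dq w w0 wr; exact: is_derive_continuous.
have [Q cQ Qq] := disc_extension r0 cq.
have r40 : 0 < r / 4 by rewrite divr_gt0.
exists (r / 4) => //; exists (fun z => cexp (I Q 0 z)) => z zr.
split; first exact: cexp_neq0.
have dQ w : nm w < r / 4 -> w != 0 -> derivable Q w 1.
  move=> wr w0; apply: (near_eq_derivable _ (dq w w0 _)); last by move: wr r0; lra.
  apply/nbhs_nmP; exists (r / 4 - nm w); first by move: wr; lra.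
  by move=> x xw; rewrite Qq//; have := nmD (x - w) w; rewrite subrK; lra.
exists (cexp (I Q 0 z) * Q z).
  exact: (@is_derive_comp C cexp (I Q 0) z _ _ (is_derive_cexp _) (disc_primitive cQ dQ zr)).
by rewrite aE Qq//; ring.
Qed.

(** Along the segment from 0 to [z] the derivative is needed only at interior times, so continuity
    at the exceptional point 0 suffices for the mean value bound with [M = 0]. *)
Lemma derive0_constant f (r : R) : (forall z, nm z < r -> {for z, continuous f}) ->
  (forall z, nm z < r -> z != 0 -> is_derive z 1 f 0) ->
  forall z, nm z < r -> f z = f 0.
Proof.
move=> cf df z zr; have [->//|z0] := eqVneq z 0.
have sz (t : R) : 0 <= t <= 1 -> nm (seg 0 z t) < r.
  by move=> /(seg_dist 0 z); rewrite !subr0 => /le_lt_trans; apply.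
have cfs (t : R) : 0 <= t <= 1 -> f (seg 0 z x) @[x --> t] --> f (seg 0 z t).
  move=> t01; apply: (@cvg_comp _ _ _ (seg 0 z) f (nbhs t) (nbhs (seg 0 z t))).
    exact: continuous_seg.
  exact: cf (sz t t01).
have := @path_mean_value R (fun t => f (seg 0 z t)) (fun t => 0 * (z - 0)) 0.
rewrite seg0 seg1 mulr0 => h.
apply/eqP; rewrite -subr_eq0 -nm_eq0 eq_le nm_ge0 andbT; apply: h.
- move=> t /andP[t0 t1]; apply: pderive_comp; apply: df.
    by apply: sz; rewrite !ltW.
  rewrite add0r subr0 mulf_eq0 negb_or z0 andbT.
  by rewrite -nm_gt0 nm_real normr_gt0 gt_eqF.
- apply: continuous_in_subspaceT => t; rewrite inE /= in_itv /= => /cfs.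
  by move=> /(@cvg_ReIm R R (nbhs t))[].
- apply: continuous_in_subspaceT => t; rewrite inE /= in_itv /= => /cfs.
  by move=> /(@cvg_ReIm R R (nbhs t))[].
- by move=> t _; rewrite mul0r nm0.
Qed.

End LogarithmicEquation.

(** * Local systems of rank one *)

Section Lifts.
Variables (R : realType) (T : topologicalType) (F : fieldType).
Implicit Types e f : T -> F.
(** A local system of rank one presented by its germs: [loc e x] is to be read as [e] being a
    nonzero flat section near [x]. The hypotheses on [loc] below make the condition open, allow
    multiplication by nonzero constants and ensure unique continuation. *)
Variable loc : (T -> F) -> T -> Prop.

Definition continuous_on (Q : topologicalType) (A : set Q) (h : Q -> T) : Prop :=
  forall q, A q -> forall N, nbhs (h q) N -> \forall q' \near q, A q' -> N (h q').

Lemma continuous_onP (Q : topologicalType) (A : set Q) (h : Q -> T) :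
  {within A, continuous h} <-> continuous_on A h.
Proof.
rewrite subspace_continuousP; split=> hA q Aq.
  by move=> N /(hA q Aq).
move=> N /(hA q Aq); exact.
Qed.

(** A supremum argument in place of a Lebesgue number: a property of intervals that is additive and
    holds for all short intervals near each point holds for [[0, 1]]. *)
Lemma cousin (P : R -> R -> Prop) :
  (forall a m b, 0 <= a -> a <= m -> m <= b -> b <= 1 -> P a m -> P m b -> P a b) ->
  (forall x : R, 0 <= x <= 1 -> exists2 d : R, 0 < d & forall a b, 0 <= a -> a <= b ->
     b <= 1 -> x - d < a -> b < x + d -> P a b) ->
  P 0 1.
Proof.
move=> glue hloc; pose S := [set x : R | 0 <= x <= 1 /\ P 0 x].
have S0 : S 0.
  split; first by rewrite lexx ler01.
  have [|d d0 hd] := hloc 0; first by rewrite lexx ler01.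
  by apply: hd => //; lra.
have ubS : ubound S 1 by move=> x [/andP[]].
have hS : has_sup S by split; [exists 0|exists 1].
pose s := sup S.
have s0 : 0 <= s by apply: ub_le_sup => //; exact: hS.2.
have s1 : s <= 1 by apply: ge_sup => //; exists 0.
have [|d d0 hd] := hloc s; first by rewrite s0 s1.
have [x [/andP[x0 x1] Px] sx] := sup_adherent d0 hS.
have xs : x <= s by apply: ub_le_sup; [exact: hS.2|split=> //; rewrite x0 x1].
(* [b] exceeds the supremum unless it is stopped by 1, so it must be 1. *)
pose b := Order.min 1 (s + d / 2).
have b1 : b <= 1 by rewrite ge_min lexx.
have bs : b <= s + d / 2 by rewrite ge_min lexx orbT.
have xb : x <= b by rewrite le_min x1 /=; lra.
have Pb : P 0 b.
  by apply: (glue 0 x b) => //; apply: hd => //; lra.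
have : b <= s by apply: ub_le_sup; [exact: hS.2|split=> //; rewrite b1 andbT; lra].
case: (leP 1 (s + d / 2)) => hb bs'.
  by move: Pb; rewrite /b min_l.
have bE : b = s + d / 2 by rewrite /b min_r ?ltW.
by exfalso; move: bs'; rewrite bE; move: d0; clear; lra.
Qed.

Lemma locally_constant (Q : topologicalType) (A : set Q) (g : Q -> F) : connected A ->
  (forall q, A q -> \forall q' \near q, A q' -> g q' = g q) ->
  forall q q', A q -> A q' -> g q' = g q.
Proof.
move=> cA hg q q' Aq Aq'.
pose B := [set x | A x /\ g x = g q].
suff : B = A by move=> BA; have : A q' by []; rewrite -BA => -[].
apply: cA; first by exists q.
- exists ([set x | A x -> g x = g q]^°); first exact: open_interior.
  apply/seteqP; split=> [x [Ax gx]|x [Ax /nbhs_singleton h]]; last by split=> //; exact: h.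
  split => //; rewrite /interior /=; apply: filterS (hg x Ax) => y h Ay.
  by rewrite h.
- exists (~` ([set x | A x -> g x <> g q]^°)).
    by apply: open_closedC; exact: open_interior.
  apply/seteqP; split=> [x [Ax gx]|x [Ax nx]].
    by split=> // /nbhs_singleton /(_ Ax).
  split => //; apply: contrapT => gx; apply: nx; rewrite /interior /=.
  by apply: filterS (hg x Ax) => y h Ay; rewrite h.
Qed.

Hypothesis loc_near : forall e x, loc e x -> \forall y \near x, loc e y.
Hypothesis loc_neq0 : forall e x, loc e x -> e x != 0.
Hypothesis locZ : forall k e x, k != 0 -> loc e x -> loc (fun y => k * e y) x.
Hypothesis loc_unique : forall e f x, loc e x -> loc f x -> e x = f x ->
  \forall y \near x, e y = f y.

(** A nowhere zero flat section over [A] of the pullback of the local system along [h]. The values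
    depend on [q] and not on [h q], as continuation along a loop requires. *)
Definition lift_on (Q : topologicalType) (A : set Q) (h : Q -> T) (v : Q -> F) : Prop :=
  forall q, A q -> exists2 e, loc e (h q) & \forall q' \near q, A q' -> v q' = e (h q').

(** * Uniqueness and gluing of lifts *)

Section LiftTheory.
Context {Q : topologicalType}.
Implicit Types (A B : set Q) (h : Q -> T) (v w : Q -> F).

Lemma lift_neq0 A h v q : lift_on A h v -> A q -> v q != 0.
Proof.
move=> hv Aq; have [e le /nbhs_singleton/(_ Aq) ->] := hv q Aq.
exact: loc_neq0.
Qed.

Lemma eq_lift A h h' v : (forall q, A q -> h q = h' q) ->
  lift_on A h v -> lift_on A h' v.
Proof.
move=> hh hv q Aq; have [e le he] := hv q Aq; exists e; first by rewrite -hh.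
by apply: filterS he => q' hq' Aq'; rewrite -hh// hq'.
Qed.

Lemma lift_comp (Q' : topologicalType) (A : set Q) (A' : set Q') (g : Q' -> Q) h v :
  (forall q, A' q -> A (g q)) -> continuous g ->
  lift_on A h v -> lift_on A' (h \o g) (v \o g).
Proof.
move=> AA cg hv q Aq; have [e le he] := hv (g q) (AA q Aq); exists e => //.
have hn : nbhs q (g @^-1` [set q' | A q' -> v q' = e (h q')]) := cg q _ he.
by apply: filterS hn => q' /= hq' Aq'; exact/hq'/AA.
Qed.

Lemma liftZ k A h v : k != 0 -> lift_on A h v -> lift_on A h (fun q => k * v q).
Proof.
move=> k0 hv q Aq; have [e le he] := hv q Aq.
exists (fun y => k * e y); first exact: locZ.
by apply: filterS he => q' hq' Aq'; rewrite hq'.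
Qed.

Lemma lift_section A h e : (forall q, A q -> loc e (h q)) -> lift_on A h (e \o h).
Proof. by move=> he q Aq; exists e; [exact: he|exact: nearW]. Qed.

Lemma near_eq_section A h e f q : continuous_on A h -> A q ->
  loc e (h q) -> loc f (h q) -> e (h q) = f (h q) ->
  \forall q' \near q, A q' -> e (h q') = f (h q').
Proof. by move=> ch Aq le lf ef; exact: (ch q Aq [set y | e y = f y] (loc_unique le lf ef)). Qed.

(** The ratio of two lifts is locally constant by [loc_unique], hence constant on a connected
    set. *)
Lemma lift_unique A h v w : connected A -> continuous_on A h ->
  lift_on A h v -> lift_on A h w ->
  forall q q', A q -> A q' -> v q' * w q = v q * w q'.
Proof.
move=> cA ch hv hw q q' Aq Aq'.
suff : v q' / w q' = v q / w q.
  have wq := lift_neq0 hw Aq; have wq' := lift_neq0 hw Aq'.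
  by move/eqP; rewrite eqr_div// => /eqP.
apply: (locally_constant (g := fun q => v q / w q) cA) => // {q q' Aq Aq'} q Aq.
have [e le he] := hv q Aq; have [f lf hf] := hw q Aq.
have fq := loc_neq0 lf; have eq0 := loc_neq0 le.
pose k := e (h q) / f (h q).
have k0 : k != 0 by rewrite mulf_neq0// invr_eq0.
have := near_eq_section ch Aq le (locZ k0 lf) _; rewrite divfK// => /(_ erefl).
have ve := nbhs_singleton he Aq; have wf := nbhs_singleton hf Aq.
apply: filterS3 he hf => q' hq' fq' kq' Aq'.
rewrite hq'// fq'// kq'// ve wf mulfK//.
by move: fq' => /(_ Aq') <-; exact: lift_neq0 hw Aq'.
Qed.

(** A point outside a closed piece has a neighbourhood missing it; at a common point the germs of
    [v] and [k w] agree by unique continuation. *)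
Lemma lift_glue A B h v w k : closed A -> closed B ->
  continuous_on (A `|` B) h -> lift_on A h v -> lift_on B h w -> k != 0 ->
  (forall q, A q -> B q -> v q = k * w q) ->
  exists u, lift_on (A `|` B) h u.
Proof.
move=> clA clB ch hv hw k0 vw.
have off (D : set Q) q : closed D -> ~ D q -> \forall q' \near q, ~ D q'.
  by move=> clD nD; apply: open_nbhs_nbhs; split=> //; exact: closed_openC.
exists (fun q => if q \in A then v q else k * w q) => q ABq.
have [Aq|nA] := pselect (A q); last first.
  case: ABq => // Bq; have [e le he] := hw q Bq.
  exists (fun y => k * e y); first exact: locZ.
  apply: filterS2 (off A q clA nA) he => q' nA' hq' [//|Bq'].
  by rewrite memNset// hq'.
have [e le he] := hv q Aq; exists e => //.
have [Bq|nB] := pselect (B q); last first.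
  apply: filterS2 (off B q clB nB) he => q' nB' hq' [Aq'|//].
  by rewrite mem_set// hq'.
have [f lf hf] := hw q Bq.
have ef : e (h q) = k * f (h q).
  by rewrite -(nbhs_singleton he Aq) -(nbhs_singleton hf Bq) vw.
have ch' := near_eq_section ch ABq le (locZ k0 lf) ef.
apply: filterS3 he hf ch' => q' he' hf' ef' AB'.
have [Aq'|nA'] := pselect (A q'); first by rewrite mem_set// he'.
by rewrite memNset// ef'//; case: AB' => // Bq'; rewrite hf'.
Qed.

End LiftTheory.

Lemma connected_segment (a b : R) : connected `[a, b]%classic.
Proof. exact/connected_intervalP/interval_is_interval. Qed.

Lemma closed_segment (a b : R) : closed `[a, b]%classic.
Proof. exact: itv_closed. Qed.

(** * Lifts over a square *)

Section Square.
Variable h : R * R -> T.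
Let rect (a b c d : R) : set (R * R) := `[a, b]%classic `*` `[c, d]%classic.
Hypothesis ch : continuous_on (rect 0 1 0 1) h.
Hypothesis existence : forall q, rect 0 1 0 1 q -> exists e, loc e (h q).
Let good a b c d := exists v, lift_on (rect a b c d) h v.

Lemma rectP a b c d x y : rect a b c d (x, y) <->
  [/\ a <= x, x <= b, c <= y & y <= d].
Proof.
rewrite /rect; split=> [[] /=|[? ? ? ?]].
  by rewrite !in_itv /= => /andP[? ?] /andP[? ?].
by split; rewrite /= in_itv /=; apply/andP.
Qed.

Lemma closed_rectangle a b c d : closed (rect a b c d).
Proof.
apply: closedI.
  apply: (proj1 (continuous_closedP _) _ _ (@closed_segment a b)).
  by move=> x; exact: cvg_fst.
apply: (proj1 (continuous_closedP _) _ _ (@closed_segment c d)).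
by move=> x; exact: cvg_snd.
Qed.

Lemma sub_rectangle a b c d : 0 <= a -> b <= 1 -> 0 <= c -> d <= 1 ->
  rect a b c d `<=` rect 0 1 0 1.
Proof.
by move=> a0 b1 c0 d1 [x y] /rectP[? ? ? ?]; apply/rectP; split; lra.
Qed.

Lemma continuous_on_rectangle a b c d : 0 <= a -> b <= 1 -> 0 <= c -> d <= 1 ->
  continuous_on (rect a b c d) h.
Proof.
move=> a0 b1 c0 d1 q qr N hN; have sub := sub_rectangle a0 b1 c0 d1.
have hn : nbhs q [set q' | rect 0 1 0 1 q' -> N (h q')] := ch (sub q qr) hN.
by apply: filterS hn => q' hq' /sub.
Qed.

(** The common side is the image under [g] of a segment, hence connected. The two lifts are
    proportional along it, with the factor found at the end [g k], and glue after rescaling. *)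
Lemma rectangle_glue a b c d A B (g : R -> R * R) (k l : R) :
  0 <= a -> b <= 1 -> 0 <= c -> d <= 1 ->
  rect a b c d = A `|` B -> closed A -> closed B ->
  continuous g -> k <= l ->
  (forall q, A q -> B q -> exists2 t, `[k, l]%classic t & q = g t) ->
  (forall t, `[k, l]%classic t -> A (g t) /\ B (g t)) ->
  (exists v, lift_on A h v) -> (exists v, lift_on B h v) -> good a b c d.
Proof.
move=> a0 b1 c0 d1 U clA clB cg kl ABg gAB [v hv] [w hw].
have chr := continuous_on_rectangle a0 b1 c0 d1.
have kk : `[k, l]%classic k by rewrite /= in_itv /= lexx.
have hg : continuous_on `[k, l]%classic (h \o g).
  move=> t /gAB[At _] N hN; have Ug : rect a b c d (g t) by rewrite U; left.
  have hn : nbhs t (g @^-1` [set q' | rect a b c d q' -> N (h q')]) := cg t _ (chr _ Ug _ hN).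
  by apply: filterS hn => t' /= ht' /gAB[At' _]; apply: ht'; rewrite U; left.
have vg : lift_on `[k, l]%classic (h \o g) (v \o g).
  by apply: lift_comp hv => // t /gAB[].
have wg : lift_on `[k, l]%classic (h \o g) (w \o g).
  by apply: lift_comp hw => // t /gAB[].
have wk := lift_neq0 wg kk; have vk := lift_neq0 vg kk.
rewrite /good U; apply: (lift_glue clA clB _ hv hw (k := v (g k) / w (g k))).
- by rewrite -U.
- by rewrite mulf_neq0 ?invr_eq0.
move=> q Aq Bq; have [t kt ->] := ABg q Aq Bq.
have := lift_unique (@connected_segment k l) hg vg wg kk kt => /= E.
by rewrite mulrAC -E mulfK.
Qed.

Lemma good_glue_h a m b c d : 0 <= a -> a <= m -> m <= b -> b <= 1 ->
  0 <= c -> c <= d -> d <= 1 ->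
  good a m c d -> good m b c d -> good a b c d.
Proof.
move=> a0 am mb b1 c0 cd d1.
apply: (@rectangle_glue _ _ _ _ _ _ (fun t => (m, t)) c d) => //.
- apply/seteqP; split=> [[x y] /rectP[? ? ? ?]|[x y] [] /rectP[? ? ? ?]].
  + by case: (leP x m) => xm; [left|right]; apply/rectP; split; lra.
  + by apply/rectP; split; lra.
  + by apply/rectP; split; lra.
- exact: closed_rectangle.
- exact: closed_rectangle.
- by move=> t; apply: (@cvg_pair _ _ _ (nbhs t) (nbhs m) (nbhs t)); [exact: cvg_cst|exact: cvg_id].
- move=> [x y] /rectP[? ? ? ?] /rectP[? ? ? ?]; exists y.
    by rewrite /= in_itv /=; lra.
  by congr pair; lra.
- by move=> t; rewrite /= in_itv /= => /andP[? ?]; split; apply/rectP; split; lra.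
Qed.

Lemma good_glue_v a b c m d : 0 <= c -> c <= m -> m <= d -> d <= 1 ->
  0 <= a -> a <= b -> b <= 1 ->
  good a b c m -> good a b m d -> good a b c d.
Proof.
move=> c0 cm md d1 a0 ab b1.
apply: (@rectangle_glue _ _ _ _ _ _ (fun t => (t, m)) a b) => //.
- apply/seteqP; split=> [[x y] /rectP[? ? ? ?]|[x y] [] /rectP[? ? ? ?]].
  + by case: (leP y m) => xm; [left|right]; apply/rectP; split; lra.
  + by apply/rectP; split; lra.
  + by apply/rectP; split; lra.
- exact: closed_rectangle.
- exact: closed_rectangle.
- by move=> t; apply: (@cvg_pair _ _ _ (nbhs t) (nbhs t) (nbhs m)); [exact: cvg_id|exact: cvg_cst].
- move=> [x y] /rectP[? ? ? ?] /rectP[? ? ? ?]; exists x.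
    by rewrite /= in_itv /=; lra.
  by congr pair; lra.
- by move=> t; rewrite /= in_itv /= => /andP[? ?]; split; apply/rectP; split; lra.
Qed.

(** Cousin's lemma is used twice: along the second coordinate it produces a lift over a strip around
    each vertical line, and along the first coordinate the strips are glued. *)
Lemma square_lift : good 0 1 0 1.
Proof.
apply: (cousin (P := fun a b => good a b 0 1)).
  by move=> a m b a0 am mb b1; apply: good_glue_h.
move=> t /andP[t0 t1].
(* The width [r] is part of the property since it shrinks at each gluing; finitely many gluings
   leave it positive. *)
pose P c d := exists2 r : R, 0 < r & forall a b, 0 <= a -> a <= b -> b <= 1 ->
  t - r < a -> b < t + r -> good a b c d.
suff : P 0 1 by [].
apply: cousin.
  move=> c m d c0 cm md d1 [r r0 hr] [s s0 hs]; exists (Order.min r s); first by rewrite lt_min r0.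
  move=> a b a0 ab b1; rewrite ltrBlDr -ltrBlDl -ltrBlDl !lt_min => /andP[tr ts] /andP[br bs].
  apply: (good_glue_v c0 cm md d1 a0 ab b1).
    by apply: hr => //; lra.
  by apply: hs => //; lra.
move=> u /andP[u0 u1].
have tu : rect 0 1 0 1 (t, u) by apply/rectP.
have [e le] := existence tu.
have /nbhs_ballP[r r0 hr] := ch tu (loc_near le).
exists r => // c d c0 cd d1 uc ud; exists r => // a b a0 ab b1 ta tb.
exists (e \o h); apply: lift_section => -[x y] /rectP[ax xb cy yd].
apply: (hr (x, y)); last by apply/rectP; split; lra.
by split; rewrite /ball /= ltr_norml; lra.
Qed.

End Square.

(** * Continuation along paths and triviality of the monodromy *)

Variable V : set T.
Hypothesis existence : forall x, V x -> exists e, loc e x.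
Let I01 := `[0 : R, 1]%classic.

Lemma I01P (t : R) : I01 t <-> 0 <= t <= 1.
Proof. by rewrite /I01 /= in_itv. Qed.

(** A path is regarded as a map of the square that does not depend on the second coordinate, and the
    lift is normalised at the start. *)
Lemma path_lift c x y : path_in V c x y ->
  exists2 v : R -> F, lift_on I01 c v & v 0 = 1.
Proof.
move=> [/continuous_onP cc cV _ _].
have [||v hv] := @square_lift (fun q => c q.1).
- move=> [t u] [/= t01 _] N hN.
  have hn : nbhs (t, u) (fst @^-1` [set t' | I01 t' -> N (c t')]).
    exact: (@cvg_fst _ _ (nbhs t) (nbhs u) _ _ (cc t t01 N hN)).
  by apply: filterS hn => -[t' u'] /= ht' [/= /ht'].
- by move=> [t u] [/= /cV t01 _]; exact: existence.
have hv' : lift_on I01 c (v \o (fun t => (t, 0))).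
  apply: (@lift_comp _ _ _ I01 (fun t => (t, 0)) (fun q => c q.1) v _ _ hv).
    by move=> t t01; split=> //; apply/I01P; rewrite /= lexx ler01.
  by move=> t; apply: (@cvg_pair _ _ _ (nbhs t) (nbhs t) (nbhs (0 : R))); [exact: cvg_id|exact: cvg_cst].
have I0 : I01 0 by apply/I01P; rewrite lexx ler01.
have v0 := lift_neq0 hv' I0.
exists (fun t => (v (0, 0))^-1 * v (t, 0)); last by rewrite mulVf.
by apply: liftZ hv'; rewrite invr_eq0.
Qed.

Lemma path_lift_unique c x y (v w : R -> F) : path_in V c x y ->
  lift_on I01 c v -> lift_on I01 c w -> forall s t, I01 s -> I01 t -> v t * w s = v s * w t.
Proof.
move=> [/continuous_onP cc _ _ _] hv hw s t s01 t01.
exact: (lift_unique (@connected_segment 0 1) cc hv hw s01 t01).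
Qed.

Lemma reverse_path c x y : path_in V c x y -> path_in V (fun t : R => c (1 - t)) y x.
Proof.
move=> [/continuous_onP cc cV c0 c1].
have I1 t : I01 t -> I01 (1 - t) by move=> /I01P /andP[? ?]; apply/I01P; lra.
split.
- apply/continuous_onP => t t01 N hN.
  have ct : {for t, continuous (fun t : R => 1 - t)}.
    by apply: (@cvgB _ _ R (nbhs t)); [exact: cvg_cst|exact: cvg_id].
  have hn : nbhs t ((fun t : R => 1 - t) @^-1` [set t' | I01 t' -> N (c t')]) :=
    ct _ (cc _ (I1 _ t01) N hN).
  by apply: filterS hn => t' /= ht' /I1/ht'.
- by move=> t /I1; exact: cV.
- by rewrite subr0.
- by rewrite subrr.
Qed.

Lemma concat_path c d x y z : path_in V c x y -> path_in V d y z ->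
  exists2 p, path_in V p x z & forall t : R, I01 t ->
    p (t / 2) = c t /\ p ((1 + t) / 2) = d t.
Proof.
move=> [/continuous_onP cc cV c0 c1] [/continuous_onP cd dV d0 d1].
pose p t := if t <= 2^-1 then c (2 * t) else d (2 * t - 1).
have pd t : 2^-1 <= t -> p t = d (2 * t - 1).
  move=> h2; rewrite /p; case: (leP t 2^-1) => // ht; have -> : t = 2^-1 by apply/eqP; rewrite eq_le ht h2.
  by rewrite divff// subrr c1 d0.
have pc t : t <= 2^-1 -> p t = c (2 * t) by rewrite /p => ->.
have Ic t : I01 t -> t <= 2^-1 -> I01 (2 * t).
  by move=> /I01P /andP[? ?] ?; apply/I01P; lra.
have Id t : I01 t -> 2^-1 <= t -> I01 (2 * t - 1).
  by move=> /I01P /andP[? ?] ?; apply/I01P; lra.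
have c2 (t : R) : {for t, continuous (fun t : R => 2 * t)}.
  by apply: (@cvgM _ R (nbhs t)); [exact: cvg_cst|exact: cvg_id].
have c21 (t : R) : {for t, continuous (fun t : R => 2 * t - 1)}.
  by apply: (@cvgB _ _ R (nbhs t)); [exact: c2|exact: cvg_cst].
exists p; last first.
  move=> t /I01P /andP[t0 t1]; split.
    by rewrite pc; [congr c; field|lra].
  by rewrite pd; [congr d; field|lra].
split.
- apply/continuous_onP => t t01 N hN.
  have A : \forall t' \near t, I01 t' -> t' <= 2^-1 -> N (p t').
    have [t2|t2] := leP t 2^-1.
      rewrite pc// in hN.
      have hn : nbhs t ((fun t : R => 2 * t) @^-1` [set t' | I01 t' -> N (c t')]) :=
        c2 t _ (cc _ (Ic _ t01 t2) N hN).
      by apply: filterS hn => t' /= ht' It' t'2; rewrite pc//; exact/ht'/Ic.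
    have hn : \forall t' \near t, 2^-1 < t' by exact: lt_nbhsr.
    by apply: filterS hn => t' ht' _ /(lt_le_trans ht'); rewrite ltxx.
  have B : \forall t' \near t, I01 t' -> 2^-1 <= t' -> N (p t').
    have [t2|t2] := leP 2^-1 t.
      rewrite pd// in hN.
      have hn : nbhs t ((fun t : R => 2 * t - 1) @^-1` [set t' | I01 t' -> N (d t')]) :=
        c21 t _ (cd _ (Id _ t01 t2) N hN).
      by apply: filterS hn => t' /= ht' It' t'2; rewrite pd//; exact/ht'/Id.
    have hn : \forall t' \near t, t' < 2^-1 by exact: lt_nbhsl.
    by apply: filterS hn => t' ht' _ /le_lt_trans/(_ ht'); rewrite ltxx.
  apply: filterS2 A B => t' hA hB It'.
  by case: (leP t' 2^-1) => [/hA|/ltW/hB]; apply.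
- move=> t t01; case: (leP t 2^-1) => t2; first by rewrite pc//; exact/cV/Ic.
  by rewrite pd ?ltW//; apply/dV/Id => //; exact: ltW.
- by rewrite pc ?invr_ge0// mulr0.
- by rewrite pd ?invf_le1 ?ler1n// mulr1 addrK.
Qed.

Hypothesis simplyV : simply_connected (R := R) V.

Lemma constant_lift x (v : R -> F) : V x -> lift_on I01 (fun=> x) v -> v 1 = v 0.
Proof.
move=> /existence[e le] hv.
have he : lift_on I01 (fun=> x) (e \o (fun=> x)) by exact: lift_section.
have cx : continuous_on I01 (fun=> x).
  move=> t t01 N /nbhs_singleton Nx; apply: (@filterE _ (nbhs t)) => t' _.
  exact: Nx.
have I0 : I01 0 by apply/I01P; rewrite lexx ler01.
have I1 : I01 1 by apply/I01P; rewrite lexx ler01.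
have := lift_unique (@connected_segment 0 1) cx hv he I0 I1.
by move=> /= /(mulIf (loc_neq0 le)).
Qed.

(** A null homotopy sends three sides of the square to [x], where lifts are constant. A lift over
    the square thus takes equal values at the two ends of the fourth side, which is the loop. *)
Lemma loop_lift c x (w : R -> F) : path_in V c x x -> lift_on I01 c w -> w 1 = w 0.
Proof.
move=> pc hw; have [_ _ hV] := simplyV.
have [H [/continuous_onP cH HV Hc Hx]] := hV x c pc.
have [_ cV c0 c1] := pc.
have I0 : I01 0 by apply/I01P; rewrite lexx ler01.
have I1 : I01 1 by apply/I01P; rewrite lexx ler01.
have Vx : V x by rewrite -c0; exact: cV.
have [||v hv] := @square_lift H.
- exact: cH.
- by move=> q /HV; exact: existence.
have horizontal u : I01 u -> lift_on I01 (fun t => H (t, u)) (fun t => v (t, u)).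
  move=> u01; apply: (lift_comp (g := fun t => (t, u)) _ _ hv) => //.
  by move=> t; apply: (@cvg_pair _ _ _ (nbhs t) (nbhs t) (nbhs u)); [exact: cvg_id|exact: cvg_cst].
have vertical t : I01 t -> lift_on I01 (fun u => H (t, u)) (fun u => v (t, u)).
  move=> t01; apply: (lift_comp (g := fun u => (t, u)) _ _ hv) => //.
  by move=> u; apply: (@cvg_pair _ _ _ (nbhs u) (nbhs t) (nbhs u)); [exact: cvg_cst|exact: cvg_id].
have E1 : v (1, 1) = v (0, 1).
  apply: (@constant_lift x (fun t => v (t, 1))) => //.
  by apply: eq_lift (horizontal 1 I1) => t /Hc[].
have E2 : v (0, 1) = v (0, 0).
  apply: (@constant_lift x (fun u => v (0, u))) => //.
  by apply: eq_lift (vertical 0 I0) => t /Hx[].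
have E3 : v (1, 1) = v (1, 0).
  apply: (@constant_lift x (fun u => v (1, u))) => //.
  by apply: eq_lift (vertical 1 I1) => t /Hx[].
have hv0 : lift_on I01 c (fun t => v (t, 0)).
  by apply: eq_lift (horizontal 0 I0) => t /Hc[].
have := path_lift_unique pc hw hv0 I0 I1.
rewrite -E3 E1 E2 => /mulIf; apply.
exact: (lift_neq0 hv0 I0).
Qed.

(** A lift [u] along [c] followed by the reverse of [d] restricts to lifts [u (t / 2)] of [c] and
    [u (1 - t / 2)] of [d]. They start alike because the loop has no monodromy, and both end at
    [u (1 / 2)]. *)
Lemma path_lift_endpoint c d x y (v w : R -> F) :
  path_in V c x y -> path_in V d x y -> lift_on I01 c v -> lift_on I01 d w ->
  v 0 = w 0 -> v 1 = w 1.
Proof.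
move=> pc pd hv hw vw0.
have [p pp hp] := concat_path pc (reverse_path pd).
have [u hu _] := path_lift pp.
have I0 : I01 0 by apply/I01P; rewrite lexx ler01.
have I1 : I01 1 by apply/I01P; rewrite lexx ler01.
have half t : I01 t -> I01 (t / 2) /\ I01 (1 - t / 2).
  by move=> /I01P/andP[? ?]; split; apply/I01P; lra.
have hu1 : lift_on I01 c (fun t => u (t / 2)).
  apply: (@eq_lift _ _ (p \o (fun t => t / 2))); first by move=> t /hp[].
  apply: lift_comp hu; first by move=> t /half[].
  by move=> t; apply: (@cvgM _ R (nbhs t)); [exact: cvg_id|exact: cvg_cst].
have hu2 : lift_on I01 d (fun t => u (1 - t / 2)).
  apply: (@eq_lift _ _ (p \o (fun t => 1 - t / 2))).
    move=> t /I01P/andP[t0 t1]; have I1t : I01 (1 - t) by apply/I01P; lra.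
    by have [_] := hp _ I1t; rewrite subKr => <- /=; congr p; field.
  apply: (lift_comp (g := fun t : R => 1 - t / 2) _ _ hu); first by move=> t /half[].
  move=> t; apply: (@cvgB _ _ R (nbhs t)); first exact: cvg_cst.
  by apply: (@cvgM _ R (nbhs t)); [exact: cvg_id|exact: cvg_cst].
have E1 := path_lift_unique pc hv hu1 I0 I1.
have E2 := path_lift_unique pd hw hu2 I0 I1.
have u10 := loop_lift pp hu.
have h12 : 1 - 2^-1 = 2^-1 :> R by lra.
move: E1 E2; rewrite !mul0r subr0 !mul1r h12 u10 vw0 => <- /mulIf -> //.
by have := lift_neq0 hu I0.
Qed.

Hypothesis openV : open V.
Hypothesis locally_path_connected : forall (x : T) (N : set T), nbhs x N ->
  \forall y \near x, exists c : R -> T, path_in N c x y.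

(** The value at [x] is the end value of the lift that starts with 1 at a base point, along any
    path. The conclusion compares [e] with a local section [f] because [loc] is not assumed to
    depend only on the germ. *)
Lemma global_section : exists e, forall x, V x -> exists2 f, loc f x & \forall y \near x, e y = f y.
Proof.
have [[x0 Vx0] pathV _] := simplyV.
have I0 : I01 0 by apply/I01P; rewrite lexx ler01.
have I1 : I01 1 by apply/I01P; rewrite lexx ler01.
have [e he] : exists e : T -> F, forall x, V x -> exists c v,
    [/\ path_in V c x0 x, lift_on I01 c v, v 0 = 1 & v 1 = e x].
  have /choice[e he] x : exists k, V x -> exists c v,
      [/\ path_in V c x0 x, lift_on I01 c v, v 0 = 1 & v 1 = k].
    have [Vx|nV] := pselect (V x); last by exists 0.
    have [c pc] := pathV x0 x Vx0 Vx; have [v hv v0] := path_lift pc.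
    by exists (v 1) => _; exists c, v.
  by exists e.
exists e => x Vx; have [f lf] := existence Vx.
have [c [v [pc hv v0 v1]]] := he x Vx.
pose k := e x / f x.
have fx := loc_neq0 lf.
have k0 : k != 0 by rewrite mulf_neq0 ?invr_eq0// -v1 (lift_neq0 hv I1).
exists (fun y => k * f y); first exact: locZ.
(* A point [y] near [x] is reached by a path inside the domain where [f] is a local section; along
   this path the lift continues as the multiple [k * f]. *)
have NV : nbhs x (V `&` loc f).
  by apply: filterI; [exact: open_nbhs_nbhs|exact: loc_near].
apply: filterS (locally_path_connected NV) => y [d pd].
have pdV : path_in V d x y.
  by case: pd => cd dV d0 d1; split=> // t /dV[].
have pdf : lift_on I01 d (f \o d).
  by case: pd => cd dV d0 d1; apply: lift_section => t /dV[].
have [_ dV d0 d1] := pdV.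
have Vy : V y by rewrite -d1; exact: dV.
have [c' [v' [pc' hv' v'0 <-]]] := he y Vy.
have [p pp hp] := concat_path pc pdV.
have [u hu u0] := path_lift pp.
rewrite (path_lift_endpoint pc' pp hv' hu); last by rewrite v'0 u0.
have hu1 : lift_on I01 c (fun t => u (t / 2)).
  apply: (@eq_lift _ _ (p \o (fun t => t / 2))); first by move=> t /hp[].
  apply: lift_comp hu; first by move=> t /I01P/andP[? ?]; apply/I01P; lra.
  by move=> t; apply: (@cvgM _ R (nbhs t)); [exact: cvg_id|exact: cvg_cst].
have hu2 : lift_on I01 d (fun t => u ((1 + t) / 2)).
  apply: (@eq_lift _ _ (p \o (fun t => (1 + t) / 2))); first by move=> t /hp[].
  apply: (lift_comp (g := fun t : R => (1 + t) / 2) _ _ hu).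
    by move=> t /I01P/andP[? ?]; apply/I01P; lra.
  move=> t; apply: (@cvgM _ R (nbhs t)); last exact: cvg_cst.
  by apply: (@cvgD _ _ R (nbhs t)); [exact: cvg_cst|exact: cvg_id].
have := path_lift_unique pc hv hu1 I0 I1.
have := path_lift_unique pdV hu2 pdf I0 I1 => /=.
rewrite mul0r !mul1r u0 v0 addr0 mul1r mulr1 d0 d1 v1 => E2 E1.
have -> : 1 = (1 + 1) / 2 :> R by rewrite divff.
rewrite mul1r in E1; apply: (mulIf fx); rewrite E2 -E1 /k.
by rewrite mulrAC divfK.
Qed.

End Lifts.

(** * Line bundles with connection on a Riemann surface *)

Section Surfaces.
Context {R : realType}.
Local Notation C := (cpx R).
Local Notation nm := (@Normc.normc R).

Section OneSurface.
Variable S : surface R.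
Implicit Types (p q x y : S) (f g : S -> C).

Lemma near_chart_inv p x (A : set S) : chart_dom p x -> nbhs x A ->
  \forall w \near chart p x, A (chart_inv p w).
Proof.
move=> px xA.
have cw : chart_inv p w @[w --> chart p x] --> chart_inv p (chart p x).
  by apply: chart_inv_continuous; exists x.
by rewrite chartK// in cw; exact: cw.
Qed.

Lemma near_chart p x (A : set C) : chart_dom p x -> nbhs (chart p x) A ->
  \forall y \near x, A (chart p y).
Proof. by move=> px pA; exact: chart_continuous px _ pA. Qed.

Lemma near_chart_dom p x : chart_dom p x -> \forall y \near x, chart_dom p y.
Proof. by move=> px; apply: open_nbhs_nbhs; split=> //; exact: chart_dom_open. Qed.

Lemma near_chart_invK p x : chart_dom p x -> \forall w \near chart p x,
  chart_dom p (chart_inv p w) /\ chart p (chart_inv p w) = w.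
Proof.
move=> px; have : nbhs (chart p x) (chart p @` chart_dom p).
  by apply: open_nbhs_nbhs; split; [exact: chart_image_open|exists x].
by apply: filterS => _ [y py <-]; rewrite chartK.
Qed.

Definition dz p f x (d : C) : Prop := is_derive (chart p x) 1 (f \o chart_inv p) d.

Lemma dz_ddz p f x d : dz p f x d -> ddz p f x = d.
Proof. by move=> [_ <-]; rewrite /ddz derive1E. Qed.

Lemma cdiffP f x : cdiff f x <-> exists d, dz x f x d.
Proof.
split=> [/derivableP h|[d [h _]]]; last exact: h.
by exists ('D_1 (f \o chart_inv x) (chart x x)).
Qed.

Lemma near_dz p f g x d : chart_dom p x -> (\forall y \near x, f y = g y) ->
  dz p f x d -> dz p g x d.
Proof.
move=> px fg; apply: near_eq_is_derive.
by apply: filterS (near_chart_inv px fg).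
Qed.

Lemma dz_chart p q f x d : chart_dom p x -> chart_dom q x -> dz p f x d ->
  exists2 d', dz q (chart p) x d' & dz q f x (d * d').
Proof.
move=> px qx fd; have /derivableP cd := chart_transition qx px.
exists ('D_1 (chart p \o chart_inv q) (chart q x)) => //.
have fd' : is_derive ((chart p \o chart_inv q) (chart q x)) 1 (f \o chart_inv p) d.
  by rewrite /= chartK.
apply: near_eq_is_derive (is_derive_comp fd' cd).
have := near_chart_inv qx (near_chart_dom px).
by apply: filterS => w pw /=; rewrite chartK.
Qed.

Lemma ddz_chart p q f x d : chart_dom p x -> chart_dom q x -> dz p f x d ->
  ddz q f x = ddz q (chart p) x * ddz p f x.
Proof.
move=> px qx fd; have [d' cd fd'] := dz_chart px qx fd.
by rewrite (dz_ddz fd) (dz_ddz cd) (dz_ddz fd') mulrC.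
Qed.

Lemma cdiff_dz p f x : chart_dom p x -> cdiff f x <-> exists d, dz p f x d.
Proof.
move=> px; rewrite cdiffP; have xx := chart_dom_self x; split=> -[d fd].
  by have [d' _ fd'] := dz_chart xx px fd; exists (d * d').
by have [d' _ fd'] := dz_chart px xx fd; exists (d * d').
Qed.

Lemma cdiff_near f g x : (\forall y \near x, f y = g y) -> cdiff f x -> cdiff g x.
Proof.
move=> fg /cdiffP[d fd]; apply/cdiffP; exists d; apply: near_dz fd => //.
exact: chart_dom_self.
Qed.

Lemma cdiffM f g x : cdiff f x -> cdiff g x -> cdiff (fun y => f y * g y) x.
Proof. by move=> df dg; exact: derivableM df dg. Qed.

Lemma cdiffB f g x : cdiff f x -> cdiff g x -> cdiff (fun y => f y - g y) x.
Proof. by move=> df dg; exact: derivableB df dg. Qed.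

Lemma cdiff_cst k x : cdiff (fun=> k) x.
Proof. exact: (derivable_cst k (chart x x) 1). Qed.

Lemma cdiff_chart p x : chart_dom p x -> cdiff (chart p) x.
Proof. by move=> px; exact: chart_transition (chart_dom_self x) px. Qed.

Lemma cdiff_continuous f x : cdiff f x -> {for x, continuous f}.
Proof.
move=> /cdiffP[d /is_derive_continuous cf]; have xx := chart_dom_self x.
have e : (f \o chart_inv x) (chart x x) = f x by rewrite /= chartK.
have c : (f \o chart_inv x) (chart x y) @[y --> x] --> f x.
  case: _ / e.
  exact: (@cvg_comp _ _ _ (chart x) (f \o chart_inv x) (nbhs x) _ _ (chart_continuous xx) cf).
apply: cvg_trans c; apply: (@near_eq_cvg _ _ (nbhs x)).
by apply: filterS (near_chart_dom xx) => y xy /=; rewrite chartK.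
Qed.

Lemma cdiffV f x : f x != 0 -> cdiff f x -> cdiff (fun y => (f y)^-1) x.
Proof.
move=> fx df; have fx' : (f \o chart_inv x) (chart x x) != 0.
  by rewrite /= chartK//; exact: chart_dom_self.
exact: derivableV fx' df.
Qed.

Lemma chart_disc x (A : set S) : nbhs x A -> exists2 r : R, 0 < r &
  forall z : C, nm z < r -> [/\ chart_dom x (chart_inv x z),
    chart x (chart_inv x z) = z & A (chart_inv x z)].
Proof.
move=> xA; have xx := chart_dom_self x.
have h : nbhs (0 : C) (fun w => (chart_dom x (chart_inv x w) /\
    chart x (chart_inv x w) = w) /\ A (chart_inv x w)).
  by rewrite -(chart_self x); exact: filterI (near_chart_invK xx) (near_chart_inv xx xA).
have [r r0 hr] := proj1 (nbhs_nmP _ _) h; exists r => // z zr.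
by have [|[? ?] ?] := hr z; rewrite ?subr0.
Qed.

Lemma near_chart_disc x (r : R) : 0 < r -> \forall y \near x, nm (chart x y) < r.
Proof.
move=> r0; have h : nbhs (chart x x) [set w : C | nm w < r].
  by rewrite chart_self; apply/nbhs_nmP; exists r => // w; rewrite subr0.
exact: near_chart (chart_dom_self x) h.
Qed.

Lemma chart_eq0 x y : chart_dom x y -> chart x y = 0 -> y = x.
Proof.
move=> xy h; rewrite -(chartK xy) h -[in LHS](chart_self x) chartK//.
exact: chart_dom_self.
Qed.

Lemma cdiff_derivable f x : (\forall y \near x, cdiff f y) -> exists2 r : R, 0 < r &
  forall z : C, nm z < r -> derivable (f \o chart_inv x) z 1.
Proof.
move=> /chart_disc[r r0 hr]; exists r => // z /hr[dz_ zE].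
by move=> /(cdiff_dz _ dz_)[d [+ _]]; rewrite zE.
Qed.

Lemma derivable_cdiff (u : C -> C) x y (d : C) : chart_dom x y ->
  is_derive (chart x y) 1 u d -> dz x (u \o chart x) y d.
Proof.
move=> xy; apply: near_eq_is_derive; apply: filterS (near_chart_invK xy) => w [_ /=].
by move=> ->.
Qed.

Lemma cdiff_comp_chart (u : C -> C) x (r : R) : 0 < r ->
  (forall z, nm z < r -> derivable u z 1) -> \forall y \near x, cdiff (u \o chart x) y.
Proof.
move=> r0 du.
apply: filterS2 (near_chart_dom (chart_dom_self x)) (near_chart_disc x r0) => y xy yr.
apply/(cdiff_dz _ xy); have /derivableP h := du _ yr.
by exists ('D_1 u (chart x y)); exact: derivable_cdiff.
Qed.

(** A point of a surface is not isolated: the point of coordinate [r / 2] in the chart centred at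
    [x] lies in any prescribed neighbourhood for small [r] and differs from [x]. *)
Lemma continuous_punctured_eq f g x : {for x, continuous f} -> {for x, continuous g} ->
  (\forall y \near x, y != x -> f y = g y) -> f x = g x.
Proof.
move=> cf cg fg; apply/eqP; rewrite -subr_eq0 -nm_eq0; apply/eqP.
apply/eqP; rewrite eq_le nm_ge0 andbT leNgt; apply/negP => h.
have h0 : 0 < nm (f x - g x) / 2 by rewrite divr_gt0.
have [r r0 hr] := chart_disc (filterI fg (filterI
  (proj1 (@cvg_nmP R S (nbhs x) _ f (f x)) cf _ h0)
  (proj1 (@cvg_nmP R S (nbhs x) _ g (g x)) cg _ h0))).
have n2 : nm (((r / 2)%:C)%C : C) < r by rewrite nm_real ger0_norm; lra.
have [_ zE [e [hf hg]]] := hr _ n2.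
have zx : chart_inv x ((r / 2)%:C)%C != x.
  apply: contra_eq_neq zE => ->; rewrite chart_self eq_sym -nm_eq0 nm_real.
  by rewrite normr_eq0 gt_eqF// divr_gt0.
have := nmD (f x - f (chart_inv x ((r / 2)%:C)%C)) (g (chart_inv x ((r / 2)%:C)%C) - g x).
rewrite -[X in nm (_ + (X - _))](e zx) subrKA nmB.
by move: hf hg h; lra.
Qed.

Lemma locally_path_connected x (N : set S) : nbhs x N ->
  \forall y \near x, exists c : R -> S, path_in N c x y.
Proof.
move=> /chart_disc[r r0 hr]; have xx := chart_dom_self x.
apply: filterS2 (near_chart_dom xx) (near_chart_disc x r0) => y xy yr.
have tr (t : R) : `[0, 1]%classic t -> nm ((t%:C)%C * chart x y) < r.
  rewrite /= in_itv /= => /andP[t0 t1]; apply: le_lt_trans yr.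
  by rewrite nmM nm_real ger0_norm// ler_piMl// nm_ge0.
exists (fun t => chart_inv x ((t%:C)%C * chart x y)); split.
- apply: continuous_in_subspaceT => t; rewrite inE => /tr tx.
  have ct : {for t, continuous (fun t : R => (t%:C)%C * chart x y : C)}.
    by apply: (@cvgM _ R (nbhs t)); [exact: continuous_real_complex|exact: cvg_cst].
  apply: (@cvg_comp _ _ _ (fun t : R => (t%:C)%C * chart x y : C) (chart_inv x) (nbhs t) _ _ ct).
  apply: chart_inv_continuous; have [dx zE _] := hr _ tx.
  by exists (chart_inv x ((t%:C)%C * chart x y)).
- by move=> t /tr /hr[].
- by rewrite mul0r -[X in chart_inv _ X](chart_self x) chartK.
- by rewrite mul1r chartK.
Qed.

End OneSurface.

Lemma dz_comp (S X : surface R) (pr : S -> X) (p : X) (x y : S) (f : X -> C) (d e : C) :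
  {for y, continuous pr} -> chart_dom p (pr y) -> chart_dom x y ->
  dz p f (pr y) d -> dz x (chart p \o pr) y e -> dz x (f \o pr) y (d * e).
Proof.
move=> cpr py xy fd pe.
have fd' : is_derive ((chart p \o pr \o chart_inv x) (chart x y)) 1 (f \o chart_inv p) d.
  by rewrite /= chartK.
apply: near_eq_is_derive (is_derive_comp fd' pe).
have npr : \forall z \near y, chart_dom p (pr z) := cpr _ (near_chart_dom py).
by apply: filterS (near_chart_inv xy npr) => w pw /=; rewrite chartK.
Qed.

End Surfaces.

(** * Sections of a line bundle as scalar functions *)

Section LineBundle.
Context {R : realType} (S : surface R).
Local Notation C := (cpx R).
Local Notation nm := (@Normc.normc R).

Lemma near_and (T : topologicalType) (x : T) (A B : set T) :
  nbhs x A -> nbhs x B -> nbhs x (A `&` B).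
Proof. exact: filterI. Qed.

(** The scalar [f] is relative to the pointwise basis of the fibres, which carries no continuity;
    only its quotient by [line_frame] can be holomorphic. *)
Definition line_section (f : S -> C) : S -> 'cV[C]_1 := fun y => (f y)%:M.

Lemma line_sectionE (s : S -> 'cV[C]_1) : s = line_section (fun y => s y 0 0).
Proof. by apply/funext => y; rewrite /line_section -mx11_scalar. Qed.

Lemma mx11_eq (u v : 'cV[C]_1) : u 0 0 = v 0 0 -> u = v.
Proof. by move=> uv; rewrite (mx11_scalar u) (mx11_scalar v) uv. Qed.

Lemma invmx11_mul (A : 'M[C]_1) (v : 'cV[C]_1) k : (invmx A *m v) k 0 = (A 0 0)^-1 * v 0 0.
Proof. by rewrite (mx11_scalar A) invmx_scalar mul_scalar_mx (ord1 k) !mxE mulr1n. Qed.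

Variable L : bundle S 1.

Definition line_frame (x y : S) : C := frm L x y 0 0.

Lemma line_frame_neq0 x y : fdom L x y -> line_frame x y != 0.
Proof. by move=> /frm_unit; rewrite unitmxE det_mx11 unitfE. Qed.

Lemma near_fdom x : \forall y \near x, fdom L x y.
Proof. by apply: open_nbhs_nbhs; split; [exact: fdom_open|exact: fdom_self]. Qed.

Lemma line_frame_transition p q x : fdom L p x -> fdom L q x ->
  cdiff (fun y => (line_frame p y)^-1 * line_frame q y) x.
Proof.
move=> px qx; have := @frm_transition _ _ _ L p q x 0 0 px qx.
by apply: cdiff_near; apply: (@filterE _ (nbhs x)) => y; rewrite invmx11_mul.
Qed.

Lemma cdiff_frame p q f x : fdom L p x -> fdom L q x ->
  cdiff (fun y => (line_frame p y)^-1 * f y) x -> cdiff (fun y => (line_frame q y)^-1 * f y) x.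
Proof.
move=> px qx df; have := cdiffM (line_frame_transition qx px) df; apply: cdiff_near.
have npx : \forall y \near x, fdom L p y.
  by apply: open_nbhs_nbhs; split => //; exact: fdom_open.
by apply: filterS npx => y /line_frame_neq0 py; rewrite mulrA mulfK.
Qed.

(** [hol_section] tests each nearby point in the frame attached to that point; holomorphy of the
    transitions allows the single frame of [x] instead. *)
Lemma hol_sectionP f x : hol_section (frm L) (line_section f) x <->
  \forall y \near x, cdiff (fun w => (line_frame x w)^-1 * f w) y.
Proof.
have E y : (forall k : 'I_1, cdiff (fun w => (invmx (frm L y w) *m line_section f w) k 0) y) <->
    cdiff (fun w => (line_frame y w)^-1 * f w) y.
  have e k w : (invmx (frm L y w) *m line_section f w) k 0 = (line_frame y w)^-1 * f w.
    by rewrite invmx11_mul /line_section mxE mulr1n.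
  split=> [/(_ 0)|h k]; last move: h; apply: cdiff_near; exact: (@filterE _ (nbhs y)).
rewrite /hol_section; split=> h; apply: filterS2 (near_fdom x) h => y xy.
  by move=> /E; apply: cdiff_frame => //; exact: fdom_self.
by move=> h; apply/E; apply: cdiff_frame h => //; exact: fdom_self.
Qed.

Lemma near_hol_section (s : S -> 'cV[C]_1) x : hol_section (frm L) s x ->
  \forall y \near x, hol_section (frm L) s y.
Proof. by rewrite /hol_section => h; exact: nbhs_interior. Qed.

Lemma eq_hol_section (s t : S -> 'cV[C]_1) x : (\forall y \near x, s y = t y) ->
  hol_section (frm L) s x -> hol_section (frm L) t x.
Proof.
rewrite (line_sectionE s) (line_sectionE t) !hol_sectionP => /nbhs_interior st hs.
apply: filterS2 st hs => y st; apply: cdiff_near.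
apply: filterS st => w /(congr1 (fun v : 'cV[C]_1 => v 0 0)).
by rewrite /line_section !mxE !mulr1n => ->.
Qed.

(** * Local eigensections with a given logarithmic eigenform *)

Section Connection.
Variables (P : set S) (nabla : connection P L) (eta : S -> S -> C) (V : set S).
Hypothesis openV : open V.
Hypothesis eta_chart : forall p q x, V x -> chart_dom p x -> chart_dom q x ->
  eta q x = if x \in P then eta p x else ddz q (chart p) x * eta p x.
Hypothesis eta_hol : forall x, V x ->
  \forall y \near x, cdiff (fun w => wgt 1 P x w * eta x w) y.
Hypothesis eta_res : forall x, V x -> P x -> residue nabla x 0 0 = eta x x.
Hypothesis discreteP : forall x, V x -> \forall y \near x, y != x -> ~ P y.

Lemma eigen_chart p q (s : S -> 'cV[C]_1) x : V x -> chart_dom p x -> chart_dom q x ->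
  hol_section (frm L) s x -> nabla p s x = eta p x *: s x ->
  nabla q s x = eta q x *: s x.
Proof.
move=> Vx px qx hs e; rewrite (cov_chart nabla px qx hs) (eta_chart Vx px qx) e.
by case: ifP => // _; rewrite scalerA.
Qed.

Lemma near_V x : V x -> \forall y \near x, V y.
Proof. by move=> Vx; exact: open_nbhs_nbhs. Qed.

Lemma cov_line_leibniz p g f x : chart_dom p x -> ~ P x -> holo g x ->
  hol_section (frm L) (line_section f) x ->
  nabla p (line_section (fun y => g y * f y)) x 0 0 =
    ddz p g x * f x + g x * nabla p (line_section f) x 0 0.
Proof.
move=> px nP hg hf.
have -> : line_section (fun y => g y * f y) = (fun y => g y *: line_section f y).
  by apply/funext => y; rewrite /line_section scale_scalar_mx.
by rewrite (cov_leibniz nabla px nP hg hf) /line_section !mxE mulr1n.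
Qed.

(* Both sides are continuous once multiplied by [wgt], so the equation extends
   over the point [x], whether or not it is a pole. *)
Lemma eigen_extension e x : V x -> hol_section (frm L) (line_section e) x ->
  (\forall y \near x, y != x -> nabla x (line_section e) y = eta x y *: line_section e y) ->
  nabla x (line_section e) x = eta x x *: line_section e x.
Proof.
move=> Vx he ne; have := cov_hol nabla he.
rewrite (line_sectionE (fun y => _ *: _)) => /hol_sectionP/nbhs_singleton/cdiff_continuous cA.
have /hol_sectionP/nbhs_singleton de := he.
have /cdiff_continuous cB := cdiffM (nbhs_singleton (eta_hol Vx)) de.
have w1 : wgt 1 P x x = 1 by rewrite /wgt eqxx andbF.
have := continuous_punctured_eq cA cB _; rewrite w1 => E.
apply: mx11_eq; move: E; rewrite scale1r mul1r mulrCA => E.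
rewrite /line_section !mxE mulr1n; apply: (mulfI (_ : (line_frame x x)^-1 != 0)).
  by rewrite invr_eq0 line_frame_neq0//; exact: fdom_self.
apply: E; apply: filterS ne => y hy /hy ->.
by rewrite /line_section !mxE mulr1n; ring.
Qed.

(** The equation at [y] is written in the chart centred at [y], so the condition is visibly open in
    [x]. At a pole it reads as an equation between residues. *)
Definition flat_germ (e : S -> C) (x : S) : Prop := V x /\
  \forall y \near x, [/\ hol_section (frm L) (line_section e) y, e y != 0 &
    nabla y (line_section e) y = eta y y *: line_section e y].

(** The equation has to be checked only off [x], in the one chart of [x]: there are no other poles
    nearby, so the Leibniz rule applies, and [eigen_extension] supplies the centre. *)
Lemma flat_germ_intro e x : V x ->
  (\forall y \near x, hol_section (frm L) (line_section e) y /\ e y != 0) ->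
  (\forall y \near x, y != x -> nabla x (line_section e) y = eta x y *: line_section e y) ->
  flat_germ e x.
Proof.
move=> Vx he ne; split=> //.
have H := near_and (near_V Vx) (near_chart_dom (chart_dom_self x)).
apply: filterS2 H (near_and he ne) => y [Vy xy] [[hy ey] ny]; split => //.
have [yx|yx] := eqVneq y x; last first.
  by apply: (eigen_chart Vy xy (chart_dom_self y) hy); exact: ny.
by rewrite yx; apply: eigen_extension => //; exact: (nbhs_singleton he).1.
Qed.

Lemma flat_germ_near e x : flat_germ e x -> \forall y \near x, flat_germ e y.
Proof.
by move=> [Vx /nbhs_interior he]; apply: filterS2 (near_V Vx) he => y Vy hy; split.
Qed.

Lemma flat_germ_at e x : flat_germ e x -> [/\ hol_section (frm L) (line_section e) x,
  e x != 0 & nabla x (line_section e) x = eta x x *: line_section e x].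
Proof. by move=> [_ /nbhs_singleton]. Qed.

Lemma flat_germ_eigen e x : flat_germ e x -> \forall y \near x,
  nabla x (line_section e) y = eta x y *: line_section e y.
Proof.
move=> [Vx he]; have H := near_and (near_V Vx) (near_chart_dom (chart_dom_self x)).
apply: filterS2 H he => y [Vy xy] [hy ey ny].
exact: (eigen_chart Vy (chart_dom_self y) xy hy ny).
Qed.

Lemma holo_cst (k : C) (x : S) : holo (fun=> k) x.
Proof. by apply: (@filterE _ (nbhs x)) => y; exact: cdiff_cst. Qed.

Lemma ddz_cst (k : C) (p x : S) : ddz p (fun=> k) x = 0.
Proof. by rewrite /ddz derive1E; exact: derive_cst. Qed.

Lemma flat_germZ k e x : k != 0 -> flat_germ e x -> flat_germ (fun y => k * e y) x.
Proof.
move=> k0 fe; have [Vx he] := fe.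
have hk y : hol_section (frm L) (line_section e) y -> hol_section (frm L) (line_section (fun y => k * e y)) y.
  rewrite !hol_sectionP; apply: filterS => z dz_.
  have := cdiffM (@cdiff_cst R S k z) dz_; apply: cdiff_near.
  by apply: (@filterE _ (nbhs z)) => w; ring.
apply: flat_germ_intro => //.
  by apply: filterS he => y [/hk hy ey _]; split=> //; rewrite mulf_neq0.
have H := near_and (near_chart_dom (chart_dom_self x)) (discreteP Vx).
apply: filterS2 H (near_and he (flat_germ_eigen fe)) => y [xy nP] [[hy ey _] ny] yx.
apply: mx11_eq; rewrite (cov_line_leibniz xy (nP yx) (holo_cst k y) hy) ny.
by rewrite ddz_cst mul0r add0r /line_section !mxE !mulr1n; ring.
Qed.

(** The quotient of two solutions is holomorphic near [x] and has derivative 0 off [x], hence is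
    constant on a disc. *)
Lemma flat_germ_unique e f x : flat_germ e x -> flat_germ f x -> e x = f x ->
  \forall y \near x, e y = f y.
Proof.
move=> fe ff ef; have [Vx he] := fe; have [_ hf] := ff.
have xx := chart_dom_self x.
pose g y := e y / f y.
have [/hol_sectionP de e0 _] := flat_germ_at fe.
have [/hol_sectionP df f0 _] := flat_germ_at ff.
have dg : \forall y \near x, cdiff g y.
  apply: filterS2 (near_and (near_fdom x) hf) (near_and de df) => y [xy [_ fy _]] [dey dfy].
  have fy' : (line_frame x y)^-1 * f y != 0 by rewrite mulf_neq0// invr_eq0 line_frame_neq0.
  have := cdiffM dey (cdiffV fy' dfy); apply: cdiff_near.
  have nxy : \forall w \near y, fdom L x w.
    by apply: open_nbhs_nbhs; split => //; exact: fdom_open.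
  apply: filterS nxy => w /line_frame_neq0 fw; rewrite /g invfM invrK mulrACA.
  by rewrite mulVf// mul1r.
have dg0 : \forall y \near x, y != x -> dz x g y 0.
  have H1 := near_and (nbhs_interior dg) (near_and (near_chart_dom xx) (discreteP Vx)).
  have H2 := near_and (nbhs_interior hf) (near_and (flat_germ_eigen fe) (flat_germ_eigen ff)).
  apply: filterS2 H1 H2 => y [hgy [xy nP]] [hfy [ney nfy]] yx.
  have [hy fy _] := nbhs_singleton hfy.
  have [d gd] := proj1 (cdiff_dz _ xy) (nbhs_singleton hgy).
  suff : ddz x g y = 0 by rewrite (dz_ddz gd) => d0; rewrite d0 in gd.
  have := cov_line_leibniz xy (nP yx) hgy hy.
  (* The covariant derivative of [e = g f] is both [eta e] and [g' f + g eta f], so [g' f = 0]. *)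
  have egf : \forall z \near y, line_section e z = line_section (fun w => g w * f w) z.
    by apply: filterS hfy => z [_ fz _]; rewrite /line_section /g divfK.
  rewrite -(cov_local nabla xy egf) ney nfy /line_section !mxE !mulr1n.
  rewrite {2}/g mulrCA divfK// => /eqP; rewrite -subr_eq0 opprD addrCA subrr addr0.
  by rewrite oppr_eq0 mulf_eq0 (negPf fy) orbF => /eqP.
have [r r0 hr] := chart_disc (near_and dg (near_and dg0 hf)).
have gd (z : C) : nm z < r -> exists d, is_derive z 1 (g \o chart_inv x) d.
  move=> /hr[xz zE [/(cdiff_dz _ xz)[d]]]; rewrite /dz zE => gd _.
  by exists d.
have c1 (z : C) : nm z < r -> {for z, continuous (g \o chart_inv x)}.
  by move=> /gd[d]; exact: is_derive_continuous.
have c2 (z : C) : nm z < r -> z != 0 -> is_derive z 1 (g \o chart_inv x) 0.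
  move=> zr z0; have [xz zE [_ [h _]]] := hr z zr.
  have zx : chart_inv x z != x.
    by apply: contra_neq z0 => h'; rewrite -zE h' chart_self.
  by have := h zx; rewrite /dz zE.
have inv0 : chart_inv x 0 = x by rewrite -[X in chart_inv _ X](chart_self x) chartK.
apply: filterS2 (near_and (near_chart_dom xx) (near_chart_disc x r0)) hf => y [xy yr] [_ fy _].
have := derive0_constant c1 c2 yr; rewrite /= chartK// inv0 {2}/g ef divff// => gy.
by rewrite -[RHS]mul1r -gy /g divfK.
Qed.

Lemma flat_germ_exists x : V x -> exists e, flat_germ e x.
Proof.
move=> Vx; have xx := chart_dom_self x.
have heps y : fdom L x y -> hol_section (frm L) (line_section (line_frame x)) y.
  move=> xy; apply/hol_sectionP.
  have nxy : \forall w \near y, fdom L x w.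
    by apply: open_nbhs_nbhs; split => //; exact: fdom_open.
  by apply: filterS2 nxy (near_fdom y) => z xz yz; exact: line_frame_transition.
have fx0 : line_frame x x != 0 by apply/line_frame_neq0/fdom_self.
pose om y := (line_frame x y)^-1 * nabla x (line_section (line_frame x)) y 0 0.
pose D y := wgt 1 P x y * eta x y - wgt 1 P x y * om y.
have dD : \forall y \near x, cdiff D y.
  have := cov_hol nabla (heps _ (fdom_self L x)).
  rewrite (line_sectionE (fun y => _ *: _)) => /hol_sectionP.
  apply: filterS2 (eta_hol Vx) => y d1 d2; apply: cdiffB d1 _.
  apply: cdiff_near d2; apply: (@filterE _ (nbhs y)) => w.
  by rewrite mxE /om mulrCA.
(* In both cases [a] is [z (eta - om)]: at a pole the weight in [D] already supplies [z], and
   [a x = 0] expresses the equality of residues; elsewhere the factor is added by hand and vanishes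
   at [x]. *)
pose a y := (if x \in P then 1 else chart x y) * D y.
have da : \forall y \near x, cdiff a y.
  apply: filterS2 (near_chart_dom xx) dD => y xy; apply: cdiffM.
  by case: (x \in P); [exact: cdiff_cst|exact: cdiff_chart].
have ax : a x = 0.
  rewrite /a; case: ifPn => [/set_mem Px|_]; last by rewrite chart_self mul0r.
  rewrite mul1r /D -mulrBr -(eta_res Vx Px) /residue.
  have E : forall A B : 'M[C]_1, (A *m invmx B) 0 0 = (B 0 0)^-1 * A 0 0.
    move=> A B; rewrite (mx11_scalar A) (mx11_scalar B) invmx_scalar -scalar_mxM !mxE !mulr1n.
    by rewrite mulrC.
  rewrite E mxE (_ : (fun y => col _ _) = line_section (line_frame x)).
    by rewrite /om subrr mulr0.
  by apply/funext => y; apply: mx11_eq; rewrite /line_section !mxE mulr1n.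
have [r r0 dr] := cdiff_derivable da.
have inv0 : chart_inv x 0 = x by rewrite -[X in chart_inv _ X](chart_self x) chartK.
have [|r' r'0 [u hu]] := logarithmic_equation r0 dr.
  by rewrite /= inv0.
have cu : \forall y \near x, cdiff (u \o chart x) y.
  have du (z : C) : nm z < r' -> derivable u z 1 by move=> /hu[_ [d [? _]]].
  exact: cdiff_comp_chart r'0 du.
exists (fun y => (u \o chart x) y * line_frame x y); apply: flat_germ_intro => //.
  have he : hol_section (frm L) (line_section (fun y => (u \o chart x) y * line_frame x y)) x.
    apply/hol_sectionP; apply: filterS2 (nbhs_interior (near_fdom x)) cu => y xy.
    apply: cdiff_near; apply: filterS xy => w /line_frame_neq0 fw.
    by rewrite mulrCA mulVf// mulr1.
  apply: filterS2 (near_hol_section he) (near_and (near_fdom x) (near_chart_disc x r'0)) => y hy [xy yr'].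
  by split=> //; rewrite mulf_neq0 ?line_frame_neq0//; have [] := hu _ yr'.
have H1 := near_and (near_chart_dom xx) (near_and (near_fdom x) (near_chart_disc x r'0)).
have H2 := near_and (nbhs_interior cu) (discreteP Vx).
apply: filterS2 H1 H2 => y [xy [fxy yr']] [cuy nP] yx.
apply: mx11_eq; rewrite (cov_line_leibniz xy (nP yx) cuy (heps _ fxy)).
have [_ [d ud zd]] := hu _ yr'; rewrite (dz_ddz (derivable_cdiff xy ud)).
(* Off the centre the equation may be divided by [z]. It becomes [u' = (eta - om) u], the
   eigensection equation for [u] times the frame. *)
have z0 : chart x y != 0 by apply: contra_neq yx; exact: chart_eq0.
have aE : a y = chart x y * (eta x y - om y).
  rewrite /a /D /wgt yx andbT; case: ifP => _; last by rewrite !mul1r.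
  by rewrite expr1 mul1r mulrBr.
move: zd; rewrite /= chartK// aE -mulrA => /(mulfI z0) ->.
have -> : nabla x (line_section (line_frame x)) y 0 0 = om y * line_frame x y.
  by rewrite /om mulrAC mulVf ?mul1r// line_frame_neq0.
by rewrite /line_section !mxE mulr1n; ring.
Qed.

Theorem flat_section_exists : simply_connected (R := R) V ->
  exists s, generator L V s /\ eigensection nabla eta V s.
Proof.
move=> sV.
have [e he] := @global_section R S C flat_germ flat_germ_near
  (fun e x fe => let: And3 _ h _ := flat_germ_at fe in h) flat_germZ
  flat_germ_unique V flat_germ_exists sV openV (@locally_path_connected R S).
exists (line_section e); split=> [x Vx|x p Vx px]; have [f ff ef] := he x Vx;
  have [hf f0 nf] := flat_germ_at ff;
  have sef : \forall y \near x, line_section f y = line_section e y by apply: filterS ef => y; rewrite /line_section => ->.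
- split; first exact: eq_hol_section hf.
  rewrite -(nbhs_singleton sef); apply: contra_neq f0 => /(congr1 (fun v : 'cV[C]_1 => v 0 0)).
  by rewrite /line_section !mxE mulr1n.
- rewrite -(cov_local nabla px sef) -(nbhs_singleton sef).
  exact: (eigen_chart Vx (chart_dom_self x) px hf nf).
Qed.

End Connection.
End LineBundle.

(** * The canonical form *)

Section CanonicalForm.
Context {R : realType} {X : surface R} (D : set X) (phi : X -> X -> cpx R).
Variable Sg : spectral_curve D phi.
Local Notation C := (cpx R).
Local Notation pr := (@prX R X D phi Sg).
Implicit Types (s t : Sg).

(** A point of the curve is determined by its image and its tautological coordinate, whose square is
    prescribed; a fibre thus has at most the two points [s0] and [sigma s0]. *)
Lemma finite_poles : finite_set D -> finite_set (poles (Sg := Sg)).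
Proof.
move=> finD; have fibre p : finite_set [set s : Sg | prX s = p].
  have [[s0 s0p]|no] := pselect (exists s : Sg, prX s = p); last first.
    by apply: (@sub_finite_set _ _ set0) => // s sp; case: no; exists s.
  apply: (@sub_finite_set _ _ [set s0; sigma s0]); last exact: finite_set2.
  move=> s /= sp.
  have sq (t : Sg) : prX t = p -> taut p t ^+ 2 = phi p p.
    by move=> tp; apply/(@prX_taut_image _ _ _ _ Sg); exists t.
  have : taut p s ^+ 2 == taut p s0 ^+ 2 by rewrite !sq.
  rewrite eqf_sqr => /orP[/eqP e|/eqP e]; [left|right]; apply: prX_taut_inj.
  - by rewrite sp s0p.
  - by rewrite sp.
  - by rewrite prX_sigma sp s0p.
  - by rewrite sp e -s0p taut_sigma.
rewrite (_ : poles (Sg := Sg) = \bigcup_(p in D) [set s : Sg | prX s = p]).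
  exact: bigcup_finite.
apply/seteqP; split=> [s ps|s [p Dp /= sp]]; first by exists (prX s).
by rewrite /poles /= sp.
Qed.

Lemma discrete_poles s : finite_set D -> \forall t \near s, t != s -> ~ poles t.
Proof.
move=> finD; pose P := [set t : Sg | poles t /\ t != s].
have finP : finite_set P by apply: sub_finite_set (finite_poles finD) => t [].
have clP : closed P.
  apply: (proj1 accessible_finite_set_closed) => //.
  exact/hausdorff_accessible/surface_hausdorff.
have nP : nbhs s (~` P).
  by apply: open_nbhs_nbhs; split; [exact: closed_openC|move=> [_ /eqP]].
by apply: filterS nP => t nPt ts pt; apply: nPt.
Qed.

(** [P] is meant to be the polar set of the connection on [L], which also contains the ramification;
    away from the latter it agrees with [poles]. *)
Lemma can_form_chart (p q s : Sg) (P : set Sg) : chart_dom p s -> chart_dom q s ->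
  (P s <-> poles s) ->
  can_form Sg q s = if s \in P then can_form Sg p s else ddz q (chart p) s * can_form Sg p s.
Proof.
move=> ps qs PE.
have -> : (s \in P) = (prX s \in D).
  by apply/idP/idP => /set_mem h; apply/mem_set/PE.
rewrite /can_form; case: (prX s \in D); first by [].
have /(cdiff_dz _ ps)[d dp] : cdiff (chart (prX s) \o pr) s.
  by apply: prX_hol; exact: chart_dom_self.
by rewrite (ddz_chart ps qs dp) mulrCA.
Qed.

Lemma wgt1 (S : surface R) (P : set S) (p : S) : ~ P p -> wgt 1 P p = fun=> 1.
Proof. by move=> nP; apply/funext => x; rewrite /wgt memNset. Qed.

(* In the charts at [s] and [prX s], writing [Z] for [prX], the coefficient of
   the canonical form is [taut * Z'].  At a pole [taut = T / Z] with [T]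
   holomorphic and [Z = z q], [q] nowhere zero, whence [z eta = T Z' / q]. *)
Lemma can_form_hol s (P : set Sg) : ~ ramification Sg s -> finite_set D ->
  (P s <-> poles s) ->
  \forall t \near s, cdiff (fun t => wgt 1 P s t * can_form Sg s t) t.
Proof.
move=> nram finD PE; set p := prX s; have ss := chart_dom_self s.
have pp := chart_dom_self p.
have npr : \forall t \near s, chart_dom p (prX t).
  exact: (@prX_continuous R X D phi Sg s _ (near_chart_dom pp)).
pose Z := chart p \o pr.
have dZ : \forall t \near s, cdiff Z t by apply: filterS npr => t; exact: prX_hol.
have [r r0 dr] := cdiff_derivable dZ.
have [r1 r10 tZ] := holomorphic_twice_derivable r0 dr.
have [Z1 hZ1] := tZ.
have inv0 : chart_inv s 0 = s by rewrite -[X in chart_inv _ X](chart_self s) chartK.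
have Z0 : (Z \o chart_inv s) 0 = 0 by rewrite /= inv0 /Z /= -/p chart_self.
have [q [Zq q0 dq]] := derivable_slope0 r10 tZ Z0.
pose T t := wgt 1 D p (prX t) * taut p t.
have dT : \forall t \near s, cdiff T t by exact: taut_hol.
have cZ1 : \forall t \near s, cdiff (Z1 \o chart s) t.
  have dZ1 (z : C) : Normc.normc z < r1 -> derivable Z1 z 1 by move=> /hZ1[].
  exact: cdiff_comp_chart r10 dZ1.
(* [can_form] refers to the chart at the moving point [prX t]. Passing to the fixed chart [p], the
   derivative [c] of the change of chart appears both in the chain rule and in the transformation of
   [taut]. *)
have eta_taut : \forall t \near s, ~ poles t ->
    can_form Sg s t = taut p t * Z1 (chart s t).
  have H := near_and (near_chart_dom ss) (near_chart_disc s r10).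
  apply: filterS3 npr H dZ => t pt [st tr] dZt nt.
  have dzZ : dz s Z t (Z1 (chart s t)) by have [] := hZ1 _ tr.
  have [c dc] : exists c, dz p (chart (prX t)) (prX t) c.
    exact/(cdiff_dz _ pt)/cdiff_chart/chart_dom_self.
  have nD : (prX t \in D) = false by rewrite memNset.
  have dcZ := dz_comp (@prX_continuous R X D phi Sg t) pt st dc dzZ.
  rewrite /can_form nD (dz_ddz dcZ) (taut_chart (chart_dom_self (prX t)) pt) nD.
  by rewrite (dz_ddz dc); ring.
have noP := discrete_poles s finD.
have [Ps|nPs] := pselect (P s); last first.
  have np t : (t != s -> ~ poles t) -> ~ poles t.
    by move=> h; have [->|/h//] := eqVneq t s; rewrite -PE.
  have nD : ~ D p by move=> Dp; apply: nPs; apply/PE.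
  apply: filterS2 (near_and dT cZ1) (nbhs_interior (near_and eta_taut noP)) => t [dTt dZt] hE.
  apply: cdiff_near (cdiffM dTt dZt); apply: filterS hE => w [ew /np nw].
  by rewrite wgt1// mul1r ew// /T wgt1// mul1r.
have Dp : D p by apply/PE.
(* [q 0] is the derivative of the projection in the two charts, nonzero because [s] is not a
   ramification point. *)
have nq0 : q 0 != 0.
  apply/eqP => h; apply: nram; rewrite /ramification /=.
  have : dz s Z s (q 0) by rewrite /dz chart_self.
  by move=> /dz_ddz; rewrite h.
have dqs : \forall t \near s, cdiff (q \o chart s) t by exact: cdiff_comp_chart r10 dq.
have qn0 : \forall t \near s, (q \o chart s) t != 0.
  have c := cdiff_continuous (nbhs_singleton dqs).
  have h : nbhs ((q \o chart s) s) [set w : C | w != 0].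
    apply/nbhs_nmP; exists (Normc.normc (q 0)); first by rewrite nm_gt0.
    move=> w; rewrite /= chart_self => wq; apply: contraTneq wq => ->.
    by rewrite sub0r nmN ltxx.
  exact: c _ h.
have H1 := near_and dT (near_and cZ1 (near_and dqs qn0)).
have H2 := nbhs_interior (near_and eta_taut (near_and noP (near_and qn0 (near_chart_dom ss)))).
apply: filterS2 H1 H2 => t [dTt [dZt [dqt qt]]] hE.
apply: cdiff_near (cdiffM dTt (cdiffM dZt (cdiffV qt dqt))).
apply: filterS hE => w [ew [nw [qw sw]]]; have [->|ws] := eqVneq w s.
  (* At the pole itself the recorded value of the form is its residue [taut p s]. The expression
     [T Z' / q] takes this value there since [Z'] and [q] agree at 0. *)
  have Zs : Z1 0 = q 0.
    have n0 : Normc.normc (0 : C) < r1 by rewrite nm0.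
    have [d1 _] := hZ1 0 n0.
    have e1 : dz s Z s (Z1 0) by rewrite /dz chart_self.
    have e2 : dz s Z s (q 0) by rewrite /dz chart_self.
    by rewrite -(dz_ddz e1) -(dz_ddz e2).
  rewrite /= chart_self Zs divff// mulr1 /T /wgt !eqxx !andbF !mul1r.
  by rewrite /can_form mem_set// mulr1.
have nwp := nw ws; rewrite (ew nwp).
have wp : prX w != p by apply: contra_notN nwp => /eqP h; rewrite /poles /= h.
rewrite /T /wgt (mem_set Dp) (mem_set Ps) wp ws !expr1.
have -> : chart p (prX w) = chart s w * q (chart s w).
  by rewrite -Zq /= chartK.
by rewrite /=; field.
Qed.

Lemma can_form_residue (a lam : X -> C) s : generic_residue_data D lam a ->
  generic_quadratic D phi a -> poles s -> source lam s \/ sink lam s.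
Proof.
move=> ga [_ phia _] ps; have [la _ _] := ga _ ps.
have ce : can_form Sg s s = taut (prX s) s by rewrite /can_form mem_set// mulr1.
have : taut (prX s) s ^+ 2 = phi (prX s) (prX s).
  by apply/(@prX_taut_image _ _ _ _ Sg); exists s.
rewrite (phia _ ps) -la => /eqP; rewrite eqf_sqr => /orP[/eqP e|/eqP e].
  by left; split; rewrite // ce.
by right; split; rewrite // ce.
Qed.

End CanonicalForm.

(** The inclusion over [U i] is the datum [h i] of the abelianisation rather than some existing map,
    which expresses that it is canonical. The eigensection in the second half is arbitrary, so that
    half applies to every generator provided by the first. *)
Theorem proposition3p4 (R : realType) (X : surface R) (g d : nat) (D : set X)
    (a lam : X -> cpx R) (phi : X -> X -> cpx R)
    (Sg : spectral_curve D phi)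
    (E : sl2_connection D) (L : odd_abelian lam Sg)
    (U : set Sg -> set Sg) (Lam : set Sg -> Sg -> set 'cV[cpx R]_2)
    (h : set Sg -> Sg -> 'M[cpx R]_(2, 1))
    (k : Sg -> Sg -> 'M[cpx R]_(2, 1)) :
  compact_curve X -> has_genus X g ->
  D !=set0 -> (D #= `I_d)%card -> (2 < d + 2 * g)%N ->
  generic_residue_data D lam a ->
  generic_quadratic D phi a -> saddle_free D phi ->
  has_residue_data lam E ->
  region_neighbourhoods U ->
  sink_lines lam E U Lam -> transverse Lam ->
  abelianisation E L U Lam h k ->
  (forall V : set Sg, open V -> simply_connected (R := R) V ->
     V `<=` ~` ramification Sg ->
     exists e, generator (ab_bundle L) V e /\
               eigensection L (can_form Sg) V e) /\
  (forall i, spectral_region i ->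
     (forall s, U i s -> flat_hom_at E L (h i) s /\ h i s != 0) /\
     forall (W : set Sg) e, open W ->
       generator (ab_bundle L) W e ->
       eigensection L (can_form Sg) W e ->
       forall s p, W s -> U i s -> chart_dom p s ->
         pull_cov E p (fun t => h i t *m e t) s =
           can_form Sg p s *: (h i s *m e s)).
Proof.
move=> _ _ _ finD _ ga gq _ _ rU _ _ [_ rd _ _]; split.
  move=> V openV sV VR; apply: flat_section_exists => //.
  - move=> p q s Vs ps qs; apply: can_form_chart => //.
    by split=> [[//|/(VR s Vs)]|]; [|left].
  - move=> s Vs; apply: can_form_hol; [exact: VR| |].
      by exists d.
    by split=> [[//|/(VR s Vs)]|]; [|left].
  (* A point of [C] is a source or a sink, and in each case the residue imposed on [L] is that of
     the canonical form. *)
  - move=> s Vs [ps|/(VR s Vs)//].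
    have [src|snk] := can_form_residue ga gq ps.
      by rewrite (ab_res_source L src) src.2 mxE eqxx mulr1n.
    by rewrite (ab_res_sink L snk) snk.2 mxE eqxx mulr1n.
  - move=> s Vs; have fD : finite_set D by exists d.
    apply: filterS2 (near_V openV Vs) (discrete_poles s fD) => t /VR nr np ts.
    by case; [exact: np|].
move=> i hi; split; first by move=> s Us; have [fh h0 _ _] := rd i s hi Us.
move=> W e oW gW eW s p Ws Us ps.
have [fh _ _ _] := rd i s hi Us.
have [_ _ sub _ _] := rU i hi.
have [hes _] := gW s Ws.
rewrite scalemxAr -(eW s p Ws ps).
exact: (fh e hes).2 (sub s Us) p ps.
Qed.
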